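(* There exist planar piecewise quadratic Kolmogorov differential systems of the form $$Z_i:\quad \dot{x} = x (a_i + b_i x + c_i y),\qquad \dot{y} = y (d_i + e_i x + f_i y),\qquad \text{if } (x,y)\in\Sigma_i=\{(x,y)\in\mathbb{R}^2 : (-1)^i h(x,y)>0\},\quad i=1,2,$$ with real coefficients and $h$ a real polynomial of degree one, having at least six crossing limit cycles of small amplitude.
   Context: The separation line is $\Sigma=\{h(x,y)=0\}$; in $\Sigma_i$ the trajectories are those of the vector field $Z_i$. A crossing point of $\Sigma$ is a point at which both $Z_1$ and $Z_2$ are transversal to $\Sigma$ and point to the same side of it, so that trajectories are concatenated. A crossing limit cycle is an isolated periodic orbit that meets both zones $\Sigma_1,\Sigma_2$ and intersects $\Sigma$ only at crossing points (no sliding segment). Small amplitude: the limit cycles bifurcate from a monodromic pseudo-equilibrium $p\in\Sigma$ (a point of $\Sigma$ around which trajectories rotate, so that a return map is defined near it). That is, there is a point $p$ and a system of the class with a monodromic pseudo-equilibrium at $p$ such that, for every neighbourhood $U$ of $p$, there are systems of the class, with coefficients arbitrarily close to those of the given one, having the stated number of crossing limit cycles entirely contained in $U$. *)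

(* Defs.v *)
From Stdlib Require Import Reals.
From Coquelicot Require Import Coquelicot.
Open Scope R_scope.

Inductive zone : Set := zone1 | zone2.

Definition other (i : zone) : zone :=
  match i with zone1 => zone2 | zone2 => zone1 end.

(* (-1)^i *)
Definition zsign (i : zone) : R :=
  match i with zone1 => -1 | zone2 => 1 end.

Record kolmogorov : Set := Kolmogorov { ka : R; kb : R; kc : R; kd : R; ke : R; kf : R }.

Definition xdot (K : kolmogorov) (q : R * R) : R :=
  fst q * (ka K + kb K * fst q + kc K * snd q).

Definition ydot (K : kolmogorov) (q : R * R) : R :=
  snd q * (kd K + ke K * fst q + kf K * snd q).

(* The separating polynomial is h(x, y) = h0 + hx x + hy y. *)
Record pw_system : Set :=
  PwSystem { field : zone -> kolmogorov; h0 : R; hx : R; hy : R }.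

Definition h (S : pw_system) (q : R * R) : R :=
  h0 S + hx S * fst q + hy S * snd q.

Definition h_degree_one (S : pw_system) : Prop := hx S <> 0 \/ hy S <> 0.

Definition in_zone (S : pw_system) (i : zone) (q : R * R) : Prop :=
  0 < zsign i * h S q.

Definition on_line (S : pw_system) (q : R * R) : Prop := h S q = 0.

(* Derivative of h along Z_i. *)
Definition lie (S : pw_system) (i : zone) (q : R * R) : R :=
  hx S * xdot (field S i) q + hy S * ydot (field S i) q.

Definition crossing_point (S : pw_system) (q : R * R) : Prop :=
  on_line S q /\ 0 < lie S zone1 q * lie S zone2 q.

(* Concatenation at a crossing point: gamma leaves the line, on each side of
   the time t, into the zone prescribed by the common sign of Z_1 h and Z_2 h.
   In particular gamma does not slide along the line. *)
Definition crosses (S : pw_system) (gamma : R -> R * R) (t : R) : Prop :=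
  at_left t (fun s => h S (gamma s) * lie S zone1 (gamma t) < 0) /\
  at_right t (fun s => 0 < h S (gamma s) * lie S zone1 (gamma t)).

(* Trajectories on an open set I of times that meet the separation line only
   at crossing points. *)
Definition crossing_trajectory (S : pw_system) (I : R -> Prop)
    (gamma : R -> R * R) : Prop :=
  forall t : R, I t ->
    continuous gamma t /\
    (forall i : zone, in_zone S i (gamma t) ->
       is_derive (fun s => fst (gamma s)) t (xdot (field S i) (gamma t)) /\
       is_derive (fun s => snd (gamma s)) t (ydot (field S i) (gamma t))) /\
    (on_line S (gamma t) -> crossing_point S (gamma t) /\ crosses S gamma t).

Definition periodic_trajectory (S : pw_system) (gamma : R -> R * R) : Prop :=
  crossing_trajectory S (fun _ => True) gamma /\
  (exists T : R, 0 < T /\ forall t, gamma (t + T) = gamma t) /\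
  (exists t : R, gamma t <> gamma 0).

Definition orbit (gamma : R -> R * R) (q : R * R) : Prop :=
  exists t : R, gamma t = q.

Definition same_orbit (gamma delta : R -> R * R) : Prop :=
  forall q : R * R, orbit gamma q <-> orbit delta q.

(* The orbit of gamma has a tube containing no other periodic orbit.  For a
   crossing periodic orbit, a thin enough tube meets the line only at crossing
   points, so periodic orbits with sliding or tangential contact need not be
   considered among the competitors delta. *)
Definition isolated_orbit (S : pw_system) (gamma : R -> R * R) : Prop :=
  exists eps : posreal, forall delta : R -> R * R,
    periodic_trajectory S delta ->
    (forall t : R, exists s : R, ball (gamma s) eps (delta t)) ->
    same_orbit gamma delta.

Definition crossing_limit_cycle (S : pw_system) (gamma : R -> R * R) : Prop :=
  periodic_trajectory S gamma /\
  (forall i : zone, exists t : R, in_zone S i (gamma t)) /\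
  isolated_orbit S gamma.

(* The points of the separation line, for p on it. *)
Definition line_point (S : pw_system) (p : R * R) (r : R) : R * R :=
  (fst p - r * hy S, snd p + r * hx S).

(* Every trajectory starting close to p on one half of the line crosses zone i
   to the other half, then the other zone back to the first half, remaining
   close to p; r |-> r2 is the return map.  The half-line r > 0 is no loss of
   generality since i is arbitrary.  Both Z_1 h and Z_2 h vanish at such a p,
   as they change sign there along the line. *)
Definition monodromic_pseudo_equilibrium (S : pw_system) (p : R * R) : Prop :=
  on_line S p /\
  exists i : zone, forall eps : posreal, exists delta : posreal,
    forall r : R, 0 < r < delta ->
    exists (gamma : R -> R * R) (alpha t1 t2 beta r1 r2 : R),
      alpha < 0 /\ 0 < t1 /\ t1 < t2 /\ t2 < beta /\ 0 < r1 /\ 0 < r2 /\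
      crossing_trajectory S (fun t => alpha < t < beta) gamma /\
      gamma 0 = line_point S p r /\
      gamma t1 = line_point S p (- r1) /\
      gamma t2 = line_point S p r2 /\
      (forall t, 0 < t < t1 -> in_zone S i (gamma t)) /\
      (forall t, t1 < t < t2 -> in_zone S (other i) (gamma t)) /\
      (forall t, 0 <= t <= t2 -> ball p eps (gamma t)).

Definition kolmogorov_close (eta : R) (K L : kolmogorov) : Prop :=
  Rabs (ka L - ka K) < eta /\ Rabs (kb L - kb K) < eta /\
  Rabs (kc L - kc K) < eta /\ Rabs (kd L - kd K) < eta /\
  Rabs (ke L - ke K) < eta /\ Rabs (kf L - kf K) < eta.

Definition coefficients_close (eta : R) (S T : pw_system) : Prop :=
  (forall i : zone, kolmogorov_close eta (field S i) (field T i)) /\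
  Rabs (h0 T - h0 S) < eta /\ Rabs (hx T - hx S) < eta /\
  Rabs (hy T - hy S) < eta.

(* n crossing limit cycles with pairwise distinct orbits, all inside U. *)
Definition has_crossing_limit_cycles (S : pw_system) (n : nat)
    (U : R * R -> Prop) : Prop :=
  exists gamma : nat -> R -> R * R,
    (forall k, (k < n)%nat ->
       crossing_limit_cycle S (gamma k) /\ forall t, U (gamma k t)) /\
    (forall j k, (j < k)%nat -> (k < n)%nat ->
       ~ same_orbit (gamma j) (gamma k)).

(* Main.v *)
Require Import Defs.
From Stdlib Require Import Reals.
From Coquelicot Require Import Coquelicot.
From Stdlib Require Import Lra Lia Psatz ZArith List Ranalysis5.
From Stdlib Require ClassicalChoice.
Import ListNotations.
Open Scope R_scope.

(** Both fields are taken with an x-equation of logistic type,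
<<
   x' = x (a + b x),   y' = y (d + e x + f y),
>>
   so that 1/y solves a linear equation over x.  Such a field has an explicit
   first integral, and with h = x - 1 - y and the coordinate t = 1/(x - 1) - 1
   a closed trajectory through the points s < r of the line is the same thing
   as a common solution of H_1(s) = H_1(r) and H_2(s) = H_2(r), where H_i is
   the first integral of Z_i on the line.  The differential equations thus
   reduce to two functions of one variable.

   The unperturbed system is
<<
   Z_1 = (x (4 - 3 x), y (2 - 3 x)),   Z_2 = (x (3 x - 4), y (2 - 3 x + 8 y)),
>>
   with an invisible fold of both fields at (2, 1).  With S = sqrt (4 - t^2),
   H_1 is S and H_2 is S + 3/S up to a constant (Hline_base_even): both are
   even, and (2, 1) is a center.  Four parameters of Z_1 and three of Z_2 are
   moved in the direction c.  The first variation of the difference of the two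
   half-return maps is, up to a positive factor, the function splitting c, a
   combination of t, t^3, logarithms and one more elementary integral.  Its
   Taylor coefficients at t, t^3, ..., t^13 form an invertible linear system in
   c (splitting_independent), so the seven functions are independent on each
   interval (0, d), and some c makes splitting c alternate in sign at seven
   points of (0, d) (interpolation).  A small perturbation in this direction
   then has six small closed trajectories by the intermediate value theorem.

   The sign changes alone do not isolate these trajectories.  But H_2 is affine
   in f, so the closed trajectory through r exists exactly for f = K(r), with K
   of class C^1.  By the one-dimensional theorem of Sard (regular_value), f can
   be moved slightly to a regular value of K; the solutions r are then isolated
   (isolated_solutions).

   A periodic competitor near a closed trajectory need not close up after one
   turn.  It does so at the turn where t is largest: the arcs next to that turn
   reach no further, and monotonicity of the half-return maps on both sides
   forces the turn to close (extremal_turn).  Hence isolated solutions of the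
   equations in (s, r) give isolated periodic orbits (isolated_by_return). *)

(** * Elementary calculus *)

Lemma mean_value (f df : R -> R) (a b : R) :
  a < b ->
  (forall x, a < x < b -> is_derive f x (df x)) ->
  (forall x, a <= x <= b -> continuous f x) ->
  exists c, a < c < b /\ f b - f a = df c * (b - a).
Proof.
  intros ab D C.
  assert (pr1 : forall c, a < c < b -> derivable_pt f c).
  { intros c Hc. exists (df c). apply is_derive_Reals, D, Hc. }
  assert (pr2 : forall c, a < c < b -> derivable_pt id c).
  { intros c _. apply derivable_pt_id. }
  destruct (MVT f id a b pr1 pr2 ab) as [c [P E]].
  - intros c Hc. apply continuity_pt_filterlim, C, Hc.
  - intros c _. apply derivable_continuous_pt, derivable_pt_id.
  - exists c; split; [exact P|].
    assert (E1 : derive_pt f c (pr1 c P) = df c).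
    { apply derive_pt_eq_0, is_derive_Reals, D, P. }
    assert (E2 : derive_pt id c (pr2 c P) = 1).
    { apply derive_pt_eq_0, derivable_pt_lim_id. }
    rewrite E1, E2 in E. unfold id in E. lra.
Qed.

Lemma derive_continuous (f : R -> R) (x l : R) : is_derive f x l -> continuous f x.
Proof. intros H. apply (ex_derive_continuous f x). exists l; exact H. Qed.

Ltac use_derive D :=
  match type of D with is_derive ?f ?x ?l =>
    replace (Derive (fun y : R => f y) x) with l by (symmetry; apply is_derive_unique, D)
  end.

Lemma increasing_of_derive (f df : R -> R) (a b : R) :
  a < b ->
  (forall x, a < x < b -> is_derive f x (df x)) ->
  (forall x, a <= x <= b -> continuous f x) ->
  (forall x, a < x < b -> 0 < df x) -> f a < f b.
Proof.
  intros ab D C P. destruct (mean_value f df a b ab D C) as [c [Hc E]].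
  specialize (P c Hc). assert (0 < df c * (b - a)) by (apply Rmult_lt_0_compat; lra). lra.
Qed.

Lemma constant_of_derive (f : R -> R) (a b : R) :
  a <= b ->
  (forall x, a < x < b -> is_derive f x 0) ->
  (forall x, a <= x <= b -> continuous f x) -> f a = f b.
Proof.
  intros ab D C. destruct ab as [ab|ab]; [|now rewrite ab].
  destruct (mean_value f (fun _ => 0) a b ab D C) as [c [Hc E]]. lra.
Qed.

Lemma constant_near_0 (f : R -> R) :
  (forall x, -1 < x < 1 -> is_derive f x 0) -> forall t, -1 < t < 1 -> f 0 = f t.
Proof.
  intros D t Ht. assert (C : forall x, -1 < x < 1 -> continuous f x).
  { intros x Hx. eapply derive_continuous, D, Hx. }
  destruct (Rle_or_lt 0 t) as [l|l]; [|symmetry];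
    (apply constant_of_derive; [lra| |]); intros x Hx; (apply D || apply C); lra.
Qed.

Lemma continuous_pos (g : R -> R) (x : R) :
  continuous g x -> 0 < g x -> locally x (fun y => 0 < g y).
Proof. intros C P. apply C. now apply (open_gt 0). Qed.

Lemma first_exit (g : R -> R) (a u : R) :
  (forall x, continuous g x) -> a < u -> 0 < g a -> g u <= 0 ->
  exists b, a < b <= u /\ g b = 0 /\ forall v, a <= v < b -> 0 < g v.
Proof.
  intros C au Ha Hu.
  (* The exit time is the supremum of the times up to which g stays positive. *)
  set (E := fun b => a <= b <= u /\ forall v, a <= v <= b -> 0 < g v).
  destruct (completeness E) as [b [Ub Lb]].
  - exists u. intros x [Hx _]. lra.
  - exists a. split; [lra|]. intros v Hv. now replace v with a by lra.
  - assert (Ea : E a). { split; [lra|]. intros v Hv. now replace v with a by lra. }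
    assert (ab : a <= b) by now apply Ub.
    assert (bu : b <= u). { apply Lb. intros x [Hx _]. lra. }
    assert (Pos : forall v, a <= v < b -> 0 < g v).
    { intros v Hv. destruct (Rlt_or_le 0 (g v)) as [h|h]; [exact h|exfalso].
      assert (b <= v); [|lra]. apply Lb. intros x [Hx Px].
      destruct (Rle_or_lt x v) as [h'|h']; [exact h'|]. specialize (Px v). lra. }
    assert (Hb : g b = 0).
    { destruct (Rtotal_order (g b) 0) as [h|[h|h]]; [exfalso|exact h|exfalso].
      - assert (L : locally b (fun y => 0 < - g y)).
        { apply continuous_pos; [|lra]. apply (continuous_opp g), C. }
        destruct L as [e Le]. destruct (Rle_lt_or_eq_dec a b ab) as [h'|h'].
        + set (y := Rmax a (b - e / 2)).
          assert (y < b). { unfold y. apply Rmax_lub_lt; [lra|]. destruct e; simpl; lra. }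
          assert (a <= y) by apply Rmax_l. assert (b - e / 2 <= y) by apply Rmax_r.
          assert (0 < - g y).
          { apply Le. change (Rabs (y - b) < e). rewrite Rabs_left by lra.
            destruct e; simpl in *; lra. }
          specialize (Pos y). lra.
        + subst b. lra.
      - assert (L : locally b (fun y => 0 < g y)) by now apply continuous_pos.
        destruct L as [e Le].
        assert (bu' : b < u). { destruct bu as [h'|h']; [exact h'|]. subst b. lra. }
        set (y := Rmin u (b + e / 2)).
        assert (b < y). { unfold y. apply Rmin_glb_lt; [lra|]. destruct e; simpl; lra. }
        assert (y <= u) by apply Rmin_l. assert (y <= b + e / 2) by apply Rmin_r.
        assert (y <= b); [|lra]. apply Ub. split; [lra|].
        intros v Hv. destruct (Rlt_or_le v b) as [h'|h']; [apply Pos; lra|].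
        apply Le. change (Rabs (v - b) < e). rewrite Rabs_pos_eq by lra.
        destruct e; simpl in *; lra. }
    exists b. split; [|split; [exact Hb|exact Pos]]. split; [|exact bu].
    destruct ab as [h'|h']; [exact h'|]. subst b. lra.
Qed.

Lemma last_entry (g : R -> R) (a u : R) :
  (forall x, continuous g x) -> u < a -> 0 < g a -> g u <= 0 ->
  exists b, u <= b < a /\ g b = 0 /\ forall v, b < v <= a -> 0 < g v.
Proof.
  intros C ua Ha Hu.
  destruct (first_exit (fun x => g (- x)) (- a) (- u)) as [b [Hb [E P]]].
  - intros x. apply (continuous_comp (fun x => - x) g); [|apply C].
    apply (continuous_opp (fun x : R => x)), continuous_id.
  - lra.
  - now rewrite Ropp_involutive.
  - now rewrite Ropp_involutive.
  - exists (- b). split; [lra|]. split; [exact E|].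
    intros v Hv. replace v with (- - v) by ring. apply P. lra.
Qed.

(** * Logistic sides, the coordinate t and the first integrals *)

(** Parameters of a field with logistic x-equation.  The invariant line
    a + b x = 0 is t = sL, and sal, sga and - sal - sga are exponents of the
    integrating factor Phi. *)
Record side := Side { sL : R; sal : R; sga : R; sf : R }.

(** With k = -1 in zone 1 and k = 1 in zone 2, t increases along the
    trajectories of zone 1 and decreases along those of zone 2. *)
Definition lv_field (k : R) (s : side) : kolmogorov :=
  Kolmogorov (- k * (2 + sL s)) (k * (1 + sL s)) 0
             (- k * sal s * (sL s + 2)) (- k * sga s * (1 + sL s)) (sf s).

Definition pwsys (sd : zone -> side) : pw_system :=
  PwSystem (fun i => lv_field (zsign i) (sd i)) (-1) 1 (-1).

(** On the line y = x - 1 one has 1 + t = 1/y.  The base point (2, 1) is t = 0,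
    and the half-return maps of the unperturbed system become t -> - t. *)
Definition tcoord (x : R) : R := (2 - x) / (x - 1).
Definition xcoord (t : R) : R := (2 + t) / (1 + t).

(** The derivative of t along the field depends on t alone. *)
Definition mu (k : R) (s : side) (t : R) : R := - k * ((2 + t) * (sL s - t)).
(** Integrating factor of the linear equation satisfied by 1/y as a function of t. *)
Definition Phi (s : side) (t : R) : R :=
  exp (sal s * ln (2 + t) - (sal s + sga s) * ln (sL s - t) + sga s * ln (1 + t)).
Definition psi (s : side) (t : R) : R := Phi s t / ((2 + t) * (sL s - t)).
Definition Psi (s : side) (t : R) : R := RInt (psi s) 0 t.
(** The first integral on the separation line: the half-return map of a zone
    exchanges points with the same value. *)
Definition Hline (k : R) (s : side) (t : R) : R := - k * (1 + t) * Phi s t + sf s * Psi s t.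
(** The derivative of h along the field is - y^2 fold_poly on the line, so a
    root is a fold point. *)
Definition fold_poly (k : R) (s : side) (t : R) : R :=
  - k * ((2 + t) * (sL s - t) + sal s * (sL s + 2) * (1 + t)
         + sga s * (1 + sL s) * (2 + t)) + sf s.
Definition first_int (k : R) (s : side) (q : R * R) : R :=
  - k * Phi s (tcoord (fst q)) / snd q + sf s * Psi s (tcoord (fst q)).

Lemma Phi_pos s t : 0 < Phi s t.
Proof. apply exp_pos. Qed.

Lemma is_derive_Phi s t : 1 < sL s -> -1 < t < 1 ->
  is_derive (Phi s) t
    (Phi s t * (sal s / (2 + t) + (sal s + sga s) / (sL s - t) + sga s / (1 + t))).
Proof.
  intros HL Ht. unfold Phi. auto_derive; [repeat split; lra|].
  rewrite Rmult_comm. unfold Rminus. f_equal. field. repeat split; lra.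
Qed.

Lemma continuous_psi s t : 1 < sL s -> -1 < t < 1 -> continuous (psi s) t.
Proof.
  intros HL Ht. unfold psi. apply derive_continuous with
   (l := Derive (fun t => Phi s t / ((2 + t) * (sL s - t))) t).
  apply Derive_correct. auto_derive. split; [|split; [|exact I]].
  - eexists; now apply is_derive_Phi.
  - apply Rgt_not_eq, Rmult_lt_0_compat; lra.
Qed.

Lemma ex_RInt_psi s a b : 1 < sL s -> -1 < a < 1 -> -1 < b < 1 -> ex_RInt (psi s) a b.
Proof.
  intros HL Ha Hb. apply (ex_RInt_continuous (V := R_CompleteNormedModule)).
  intros z Hz. apply continuous_psi; [exact HL|]. revert Hz.
  unfold Rmin, Rmax; destruct (Rle_dec a b); lra.
Qed.

Lemma is_derive_Psi s t : 1 < sL s -> -1 < t < 1 -> is_derive (Psi s) t (psi s t).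
Proof.
  intros HL Ht. apply (is_derive_RInt (psi s) (Psi s) 0).
  - assert (Hp : 0 < Rmin (t + 1) (1 - t)) by (apply Rmin_glb_lt; lra).
    exists (mkposreal _ Hp). intros y Hy. unfold Psi. apply (RInt_correct (psi s)).
    apply ex_RInt_psi; [exact HL|lra|].
    change (Rabs (y - t) < Rmin (t + 1) (1 - t)) in Hy.
    pose proof (Rmin_l (t + 1) (1 - t)). pose proof (Rmin_r (t + 1) (1 - t)).
    apply Rabs_def2 in Hy. lra.
  - now apply continuous_psi.
Qed.

Lemma is_derive_Hline k s t : k * k = 1 -> 1 < sL s -> -1 < t < 1 ->
  is_derive (Hline k s) t (psi s t * fold_poly k s t).
Proof.
  intros Hk HL Ht. unfold Hline.
  assert (D1 := is_derive_Phi s t HL Ht). assert (D2 := is_derive_Psi s t HL Ht).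
  auto_derive.
  - split; [eexists; exact D1|]. split; [eexists; exact D2|exact I].
  - use_derive D1. use_derive D2.
    unfold psi, fold_poly. field. repeat split; lra.
Qed.

(** The bound on t keeps the singular points t = -2, -1 and t = sL of the
    integrating factor away. *)
Definition chart (q : R * R) : Prop :=
  1 < fst q /\ - (1/4) < tcoord (fst q) < 1/4 /\ 0 < snd q.

Lemma zsign_sq (i : zone) : zsign i * zsign i = 1.
Proof. destruct i; simpl; ring. Qed.

Lemma h_pwsys sd q : h (pwsys sd) q = fst q - 1 - snd q.
Proof. unfold h, pwsys; simpl. ring. Qed.

Lemma tcoord_1 x : 1 < x -> 1 + tcoord x = / (x - 1).
Proof. intros Hx. unfold tcoord. field. lra. Qed.

Lemma xcoord_tcoord x : 1 < x -> xcoord (tcoord x) = x.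
Proof. intros Hx. unfold xcoord, tcoord. field. split; lra. Qed.

Lemma tcoord_xcoord t : -1 < t -> tcoord (xcoord t) = t.
Proof. intros Ht. unfold xcoord, tcoord. field. split; lra. Qed.

Lemma xcoord_gt t : -1 < t -> 1 < xcoord t.
Proof.
  intros Ht. unfold xcoord. replace ((2 + t) / (1 + t)) with (1 + / (1 + t)) by (field; lra).
  assert (0 < / (1 + t)) by (apply Rinv_0_lt_compat; lra). lra.
Qed.

(** Since the first integral is compared with its value Hline on the line, the
    zone of a point is the sign of a difference of levels. *)
Lemma zone_gap k s q : 1 < fst q -> 0 < snd q ->
  Hline k s (tcoord (fst q)) - first_int k s q
  = k * (fst q - 1 - snd q) * (Phi s (tcoord (fst q)) / (snd q * (fst q - 1))).
Proof.
  intros Hx Hy. unfold Hline, first_int. rewrite tcoord_1 by exact Hx. field. split; lra.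
Qed.

Lemma first_int_on_line k s q : 1 < fst q -> fst q - 1 - snd q = 0 -> first_int k s q = Hline k s (tcoord (fst q)).
Proof.
  intros Hx Hq. assert (G := zone_gap k s q Hx). rewrite Hq in G.
  assert (0 < snd q) by lra. specialize (G H). lra.
Qed.

Lemma zone_pos sd q i : chart q ->
  in_zone (pwsys sd) i q <->
  first_int (zsign i) (sd i) q < Hline (zsign i) (sd i) (tcoord (fst q)).
Proof.
  intros [Hx [Ht Hy]]. unfold in_zone. rewrite h_pwsys.
  assert (G := zone_gap (zsign i) (sd i) q Hx Hy).
  assert (0 < Phi (sd i) (tcoord (fst q)) / (snd q * (fst q - 1))).
  { apply Rdiv_lt_0_compat; [apply Phi_pos|]. apply Rmult_lt_0_compat; lra. }
  set (c := Phi (sd i) (tcoord (fst q)) / (snd q * (fst q - 1))) in *.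
  set (u := zsign i * (fst q - 1 - snd q)) in *.
  split; intros A.
  - assert (0 < u * c) by (apply Rmult_lt_0_compat; lra). lra.
  - destruct (Rlt_or_le 0 u) as [h|h]; [exact h|].
    assert (0 < u * c) by lra. assert (0 <= - u * c) by (apply Rmult_le_pos; lra). lra.
Qed.

Lemma on_line_iff sd q : on_line (pwsys sd) q <-> snd q = fst q - 1.
Proof. unfold on_line. rewrite h_pwsys. lra. Qed.

Lemma lie_pwsys sd q i : chart q -> on_line (pwsys sd) q ->
  lie (pwsys sd) i q = - (snd q * snd q) * fold_poly (zsign i) (sd i) (tcoord (fst q)).
Proof.
  intros [Hx [Ht Hy]] Hq. apply on_line_iff in Hq.
  unfold lie, xdot, ydot, fold_poly, tcoord; simpl. rewrite Hq. field. lra.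
Qed.

Lemma derive_tcoord sd i (g : R -> R * R) u :
  chart (g u) ->
  is_derive (fun v : R => fst (g v)) u (xdot (lv_field (zsign i) (sd i)) (g u)) ->
  is_derive (fun v : R => tcoord (fst (g v))) u (mu (zsign i) (sd i) (tcoord (fst (g u)))).
Proof.
  intros [Hx _] D.
  set (x := fun v : R => fst (g v)) in *.
  apply (is_derive_ext (fun v : R => (2 - x v) / (x v - 1))); [reflexivity|].
  change (1 < x u) in Hx.
  auto_derive.
  - split; [eexists; exact D|]. split; [eexists; exact D|]. split; [lra|exact I].
  - use_derive D.
    change (fst (g u)) with (x u).
    unfold xdot, mu, lv_field, tcoord; simpl. change (fst (g u)) with (x u). field. lra.
Qed.

Lemma derive_quotient_sum (a b c : R -> R) (u a' b' c' k f : R) :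
  is_derive a u a' -> is_derive b u b' -> is_derive c u c' -> c u <> 0 ->
  is_derive (fun v : R => k * a v / c v + f * b v) u
    (k * (a' * c u - a u * c') / (c u * c u) + f * b').
Proof.
  intros A B C Hc. auto_derive.
  - split; [eexists; exact A|]. split; [eexists; exact C|]. split; [exact Hc|].
    split; [eexists; exact B|exact I].
  - use_derive A. use_derive B. use_derive C.
    field. exact Hc.
Qed.

Lemma derive_first_int sd i (g : R -> R * R) u :
  1 < sL (sd i) -> chart (g u) ->
  is_derive (fun v : R => fst (g v)) u (xdot (lv_field (zsign i) (sd i)) (g u)) ->
  is_derive (fun v : R => snd (g v)) u (ydot (lv_field (zsign i) (sd i)) (g u)) ->
  is_derive (fun v : R => first_int (zsign i) (sd i) (g v)) u 0.
Proof.
  intros HL Hd D1 D2. assert (D3 := derive_tcoord sd i g u Hd D1).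
  destruct Hd as [Hx [Ht Hy]]. set (k := zsign i) in *. set (s := sd i) in *.
  assert (Ht1 : -1 < tcoord (fst (g u)) < 1) by lra.
  assert (P1 := is_derive_Phi s _ HL Ht1). assert (P2 := is_derive_Psi s _ HL Ht1).
  assert (Q1 := is_derive_comp (Phi s) (fun v : R => tcoord (fst (g v))) u _ _ P1 D3).
  assert (Q2 := is_derive_comp (Psi s) (fun v : R => tcoord (fst (g v))) u _ _ P2 D3).
  assert (Q := derive_quotient_sum _ _ _ u _ _ _ (- k) (sf s) Q1 Q2 D2
    (Rgt_not_eq _ _ Hy)).
  cbv beta in Q.
  match type of Q with is_derive _ _ ?l => replace 0 with l; [exact Q|] end.
  unfold scal, ydot, lv_field, mu, psi; simpl. unfold mult; simpl.
  set (t := tcoord (fst (g u))) in *.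
  assert (Ex : fst (g u) = (2 + t) / (1 + t)).
  { change (fst (g u) = xcoord (tcoord (fst (g u)))). now rewrite xcoord_tcoord. }
  rewrite Ex.
  field. repeat split; lra.
Qed.

(** * Arcs of trajectories *)

(** Each field has a single fold z i in the strip, and it is invisible: the
    monotonicity of fold_poly makes z i the only maximum of Hline there. *)
Definition folded (sd : zone -> side) (z : zone -> R) : Prop :=
  forall i, 1 < sL (sd i) /\ -(1/4) < z i < 1/4 /\ fold_poly (zsign i) (sd i) (z i) = 0 /\
    forall t u, -(1/4) <= t -> t < u -> u <= 1/4 ->
      fold_poly (zsign i) (sd i) u < fold_poly (zsign i) (sd i) t.

Lemma psi_pos s t : 1 < sL s -> -1 < t < 1 -> 0 < psi s t.
Proof.
  intros HL Ht. unfold psi. apply Rdiv_lt_0_compat; [apply Phi_pos|].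
  apply Rmult_lt_0_compat; lra.
Qed.

Lemma Hline_increasing sd z i t u : folded sd z -> -(1/4) <= t -> t < u -> u <= z i ->
  Hline (zsign i) (sd i) t < Hline (zsign i) (sd i) u.
Proof.
  intros G Ht tu Hu. destruct (G i) as [HL [Hz [Nz Nd]]].
  apply (increasing_of_derive _
    (fun t => psi (sd i) t * fold_poly (zsign i) (sd i) t)); [exact tu| | |].
  - intros x Hx. apply is_derive_Hline; [apply zsign_sq|exact HL|lra].
  - intros x Hx. eapply derive_continuous, is_derive_Hline; [apply zsign_sq|exact HL|lra].
  - intros x Hx. apply Rmult_lt_0_compat; [apply psi_pos; [exact HL|lra]|].
    rewrite <- Nz. apply Nd; lra.
Qed.

Lemma Hline_decreasing sd z i t u : folded sd z -> z i <= t -> t < u -> u <= 1/4 ->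
  Hline (zsign i) (sd i) u < Hline (zsign i) (sd i) t.
Proof.
  intros G Ht tu Hu. destruct (G i) as [HL [Hz [Nz Nd]]].
  apply Ropp_lt_cancel.
  apply (increasing_of_derive (fun t => - Hline (zsign i) (sd i) t)
    (fun t => - (psi (sd i) t * fold_poly (zsign i) (sd i) t))); [exact tu| | |].
  - intros x Hx. apply (is_derive_opp (Hline (zsign i) (sd i))).
    apply is_derive_Hline; [apply zsign_sq|exact HL|lra].
  - intros x Hx. apply (continuous_opp (Hline (zsign i) (sd i))).
    eapply derive_continuous, is_derive_Hline; [apply zsign_sq|exact HL|lra].
  - intros x Hx. rewrite Ropp_mult_distr_r.
    apply Rmult_lt_0_compat; [apply psi_pos; [exact HL|lra]|].
    assert (fold_poly (zsign i) (sd i) x < fold_poly (zsign i) (sd i) (z i)) by (apply Nd; lra). lra.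
Qed.

Lemma level_sides sd z i t u : folded sd z -> -(1/4) < t -> t < u -> u < 1/4 ->
  Hline (zsign i) (sd i) t = Hline (zsign i) (sd i) u -> t < z i < u.
Proof.
  intros G Ht tu Hu E. split.
  - destruct (Rlt_or_le t (z i)) as [h|h]; [exact h|].
    assert (X := Hline_decreasing sd z i t u G h tu). lra.
  - destruct (Rlt_or_le (z i) u) as [h|h]; [exact h|].
    assert (X := Hline_increasing sd z i t u G). lra.
Qed.

Lemma Hline_inj_left sd z i t u : folded sd z -> -(1/4) < t <= z i -> -(1/4) < u <= z i ->
  Hline (zsign i) (sd i) t <= Hline (zsign i) (sd i) u -> t <= u.
Proof.
  intros G Ht Hu E. destruct (Rle_or_lt t u) as [h|h]; [exact h|].
  assert (X := Hline_increasing sd z i u t G). lra.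
Qed.

Lemma Hline_inj_right sd z i t u : folded sd z -> z i <= t < 1/4 -> z i <= u < 1/4 ->
  Hline (zsign i) (sd i) t <= Hline (zsign i) (sd i) u -> u <= t.
Proof.
  intros G Ht Hu E. destruct (Rle_or_lt u t) as [h|h]; [exact h|].
  assert (X := Hline_decreasing sd z i t u G). lra.
Qed.

Lemma continuous_h_plane S q : continuous (h S) q.
Proof.
  unfold h.
  apply (continuous_plus (fun q : R * R => h0 S + hx S * fst q) (fun q : R * R => hy S * snd q)).
  - apply (continuous_plus (fun q : R * R => h0 S) (fun q : R * R => hx S * fst q)).
    + apply continuous_const.
    + apply (continuous_mult (fun q : R * R => hx S) (fun q : R * R => fst q)).
      * apply continuous_const.
      * apply continuous_fst.
  - apply (continuous_mult (fun q : R * R => hy S) (fun q : R * R => snd q)).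
    + apply continuous_const.
    + apply continuous_snd.
Qed.

Lemma continuous_h S (g : R -> R * R) u : continuous g u -> continuous (fun v => h S (g v)) u.
Proof. intros C. apply (continuous_comp g (h S)); [exact C|apply continuous_h_plane]. Qed.

Lemma continuous_fst_comp (g : R -> R * R) u : continuous g u -> continuous (fun v => fst (g v)) u.
Proof. intros C. apply (continuous_comp g fst); [exact C|]. apply continuous_fst. Qed.

Lemma continuous_snd_comp (g : R -> R * R) u : continuous g u -> continuous (fun v => snd (g v)) u.
Proof. intros C. apply (continuous_comp g snd); [exact C|]. apply continuous_snd. Qed.

Lemma continuous_tcoord x : 1 < x -> continuous tcoord x.
Proof.
  intros Hx. apply derive_continuous with (l := - / (x - 1) ^ 2). unfold tcoord.
  auto_derive; [lra|]. field. lra.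
Qed.

Lemma continuous_t (g : R -> R * R) u : chart (g u) -> continuous g u ->
  continuous (fun v => tcoord (fst (g v))) u.
Proof.
  intros [Hx _] C. apply (continuous_comp (fun v => fst (g v)) tcoord).
  - now apply continuous_fst_comp.
  - now apply continuous_tcoord.
Qed.

Lemma continuous_first_int k s (g : R -> R * R) u : 1 < sL s -> chart (g u) -> continuous g u ->
  continuous (fun v => first_int k s (g v)) u.
Proof.
  intros HL Hd C. assert (Ct := continuous_t g u Hd C). destruct Hd as [Hx [Ht Hy]].
  unfold first_int.
  apply (continuous_plus (fun v => - k * Phi s (tcoord (fst (g v))) / snd (g v))
           (fun v => sf s * Psi s (tcoord (fst (g v))))).
  - apply (continuous_mult (fun v => - k * Phi s (tcoord (fst (g v)))) (fun v => / snd (g v))).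
    + apply (continuous_mult (fun v => - k) (fun v => Phi s (tcoord (fst (g v))))).
      * apply continuous_const.
      * apply (continuous_comp (fun v => tcoord (fst (g v))) (Phi s)); [exact Ct|].
        eapply derive_continuous, is_derive_Phi; [exact HL|lra].
    + apply (continuous_comp (fun v => snd (g v)) Rinv).
      * now apply continuous_snd_comp.
      * apply continuous_Rinv. lra.
  - apply (continuous_mult (fun v => sf s) (fun v => Psi s (tcoord (fst (g v))))).
    + apply continuous_const.
    + apply (continuous_comp (fun v => tcoord (fst (g v))) (Psi s)); [exact Ct|].
      eapply derive_continuous, is_derive_Psi; [exact HL|lra].
Qed.

Definition chart_traj (sd : zone -> side) (g : R -> R * R) : Prop :=
  crossing_trajectory (pwsys sd) (fun _ => True) g /\ forall u, chart (g u).

Lemma traj_continuous sd g u : chart_traj sd g -> continuous g u.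
Proof. intros [T _]. now destruct (T u I). Qed.

Lemma traj_t sd g u i : chart_traj sd g -> in_zone (pwsys sd) i (g u) ->
  is_derive (fun v => tcoord (fst (g v))) u (mu (zsign i) (sd i) (tcoord (fst (g u)))).
Proof.
  intros [T D] Z. destruct (T u I) as [_ [E _]]. destruct (E i Z) as [E1 _].
  destruct i; now apply derive_tcoord.
Qed.

Lemma traj_first_int sd z g u i : folded sd z -> chart_traj sd g -> in_zone (pwsys sd) i (g u) ->
  is_derive (fun v => first_int (zsign i) (sd i) (g v)) u 0.
Proof.
  intros G [T D] Z. destruct (T u I) as [_ [E _]]. destruct (E i Z) as [E1 E2].
  destruct (G i) as [HL _]. destruct i; now apply derive_first_int.
Qed.

Lemma speed_bounds s t : 1 < sL s -> -(1/4) < t < 1/4 ->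
  1 < (2 + t) * (sL s - t) < 3 * (sL s + 1).
Proof. intros HL Ht. split; nra. Qed.

(** The speed of t in a zone is bounded from both sides: the lower bound forces
    trajectories out of each zone, the upper one bounds the duration of an arc
    from below. *)
Lemma zone_progress sd z g i a b : folded sd z -> chart_traj sd g -> a < b ->
  (forall v, a < v < b -> in_zone (pwsys sd) i (g v)) ->
  b - a < - zsign i * (tcoord (fst (g b)) - tcoord (fst (g a))) < 3 * (sL (sd i) + 1) * (b - a).
Proof.
  intros G T ab Z.
  destruct (mean_value (fun v => tcoord (fst (g v)))
    (fun v => mu (zsign i) (sd i) (tcoord (fst (g v)))) a b ab) as [c [Hc E]].
  - intros v Hv. now apply traj_t; [|apply Z].
  - intros v Hv. apply continuous_t; [apply (proj2 T)|eapply traj_continuous, T].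
  - rewrite E. unfold mu.
    destruct (proj2 T c) as [_ [Ht _]]. destruct (G i) as [HL _].
    assert (B := speed_bounds _ _ HL Ht).
    set (p := (2 + tcoord (fst (g c))) * (sL (sd i) - tcoord (fst (g c)))) in *.
    replace (- zsign i * (- zsign i * p * (b - a))) with ((zsign i * zsign i) * p * (b - a)) by ring.
    rewrite zsign_sq. split; nra.
Qed.

Lemma zone_conserved sd z g i a b u v : folded sd z -> chart_traj sd g ->
  (forall v, a < v < b -> in_zone (pwsys sd) i (g v)) -> a <= u <= b -> a <= v <= b ->
  first_int (zsign i) (sd i) (g u) = first_int (zsign i) (sd i) (g v).
Proof.
  intros G T Z. revert u v.
  assert (K : forall u v, a <= u <= b -> a <= v <= b -> u <= v ->
     first_int (zsign i) (sd i) (g u) = first_int (zsign i) (sd i) (g v)).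
  { intros u v Hu Hv uv. apply (constant_of_derive (fun v => first_int (zsign i) (sd i) (g v))); [exact uv| |].
    - intros x Hx. eapply traj_first_int; [exact G|exact T|apply Z; lra].
    - intros x Hx. apply continuous_first_int; [apply G|apply (proj2 T)|eapply traj_continuous, T]. }
  intros u v Hu Hv. destruct (Rle_or_lt u v); [now apply K|]. symmetry. apply K; try easy. lra.
Qed.

Record arc (sd : zone -> side) (g : R -> R * R) (i : zone) (a b : R) : Prop := Arc {
  arc_lt : a < b;
  arc_zone : forall v, a < v < b -> in_zone (pwsys sd) i (g v);
  arc_start : on_line (pwsys sd) (g a);
  arc_end : on_line (pwsys sd) (g b) }.

Lemma h_traj_continuous sd g i : chart_traj sd g ->
  forall u, continuous (fun v => zsign i * h (pwsys sd) (g v)) u.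
Proof.
  intros T u. apply (continuous_mult (fun v => zsign i) (fun v => h (pwsys sd) (g v))).
  - apply continuous_const.
  - eapply continuous_h, traj_continuous, T.
Qed.

Lemma zsign_nz i : zsign i <> 0.
Proof. destruct i; simpl; lra. Qed.

(** A trajectory in the chart cannot stay in one zone, since t would leave the
    strip. *)
Lemma arc_through sd z g i u : folded sd z -> chart_traj sd g -> in_zone (pwsys sd) i (g u) ->
  exists a b, a < u < b /\ arc sd g i a b.
Proof.
  intros G T Z.
  assert (Cg := h_traj_continuous sd g i T).
  assert (F : exists w, u < w /\ zsign i * h (pwsys sd) (g w) <= 0).
  { destruct (Classical_Prop.classic (exists w, u < w /\ zsign i * h (pwsys sd) (g w) <= 0))
      as [h|h]; [exact h|exfalso].
    assert (P := zone_progress sd z g i u (u + 1) G T).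
    destruct P as [P _]; [lra| |].
    - intros v Hv. unfold in_zone. destruct (Rlt_or_le 0 (zsign i * Defs.h (pwsys sd) (g v)));
        [assumption|]. exfalso. apply h. exists v. split; [lra|assumption].
    - destruct (proj2 T u) as [_ [H1 _]]. destruct (proj2 T (u + 1)) as [_ [H2 _]].
      destruct i; simpl in *; lra. }
  assert (F' : exists w, w < u /\ zsign i * h (pwsys sd) (g w) <= 0).
  { destruct (Classical_Prop.classic (exists w, w < u /\ zsign i * h (pwsys sd) (g w) <= 0))
      as [h|h]; [exact h|exfalso].
    assert (P := zone_progress sd z g i (u - 1) u G T).
    destruct P as [P _]; [lra| |].
    - intros v Hv. unfold in_zone. destruct (Rlt_or_le 0 (zsign i * Defs.h (pwsys sd) (g v)));
        [assumption|]. exfalso. apply h. exists v. split; [lra|assumption].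
    - destruct (proj2 T u) as [_ [H1 _]]. destruct (proj2 T (u - 1)) as [_ [H2 _]].
      destruct i; simpl in *; lra. }
  destruct F as [w [Hw Fw]]. destruct F' as [w' [Hw' Fw']].
  destruct (first_exit _ u w Cg Hw Z Fw) as [b [Hb [Eb Pb]]].
  destruct (last_entry _ u w' Cg Hw' Z Fw') as [a [Ha [Ea Pa]]].
  exists a, b. split; [lra|]. constructor.
  - lra.
  - intros v Hv. unfold in_zone. destruct (Rle_or_lt v u); [apply Pa|apply Pb]; lra.
  - apply Rmult_integral in Ea. destruct Ea as [Ea|Ea]; [now apply zsign_nz in Ea|exact Ea].
  - apply Rmult_integral in Eb. destruct Eb as [Eb|Eb]; [now apply zsign_nz in Eb|exact Eb].
Qed.

Lemma on_line_first_int sd q i : chart q -> on_line (pwsys sd) q ->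
  first_int (zsign i) (sd i) q = Hline (zsign i) (sd i) (tcoord (fst q)).
Proof.
  intros [Hx [_ Hy]] Hq. apply first_int_on_line; [exact Hx|]. apply on_line_iff in Hq. lra.
Qed.

Definition t_at (g : R -> R * R) (u : R) : R := tcoord (fst (g u)).

Lemma arc_level sd z g i a b : folded sd z -> chart_traj sd g -> arc sd g i a b ->
  Hline (zsign i) (sd i) (t_at g a) = Hline (zsign i) (sd i) (t_at g b).
Proof.
  intros G T [ab Z Sa Sb]. unfold t_at.
  rewrite <- (on_line_first_int sd (g a) i (proj2 T a) Sa), <- (on_line_first_int sd (g b) i (proj2 T b) Sb).
  apply (zone_conserved sd z g i a b); auto; lra.
Qed.

Lemma arc1_sides sd z g a b : folded sd z -> chart_traj sd g -> arc sd g zone1 a b ->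
  t_at g a < z zone1 < t_at g b.
Proof.
  intros G T A. assert (E := arc_level _ _ _ _ _ _ G T A).
  destruct A as [ab Z Sa Sb]. assert (P := zone_progress sd z g zone1 a b G T ab Z).
  apply (level_sides sd z zone1); auto.
  - apply (proj2 T a).
  - unfold t_at. simpl in P. lra.
  - apply (proj2 T b).
Qed.

Lemma arc2_sides sd z g a b : folded sd z -> chart_traj sd g -> arc sd g zone2 a b ->
  t_at g b < z zone2 < t_at g a.
Proof.
  intros G T A. assert (E := arc_level _ _ _ _ _ _ G T A).
  destruct A as [ab Z Sa Sb]. assert (P := zone_progress sd z g zone2 a b G T ab Z).
  apply (level_sides sd z zone2); auto.
  - apply (proj2 T b).
  - unfold t_at. simpl in P. lra.
  - apply (proj2 T a).
Qed.

(** The definition of crosses excludes that a trajectory returns to the zone it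
    comes from. *)
Lemma after_line sd z g u : folded sd z -> chart_traj sd g -> on_line (pwsys sd) (g u) ->
  (exists a b, arc sd g zone1 a u /\ arc sd g zone2 u b) \/
  (exists a b, arc sd g zone2 a u /\ arc sd g zone1 u b).
Proof.
  intros G T L. destruct (proj1 T u I) as [_ [_ Cr]]. destruct (Cr L) as [_ [Cl Cr']].
  set (l := lie (pwsys sd) zone1 (g u)) in *.
  destruct Cl as [e1 Cl]. destruct Cr' as [e2 Cr'].
  assert (Hl' : forall v, u - e1 < v < u -> h (pwsys sd) (g v) * l < 0).
  { intros v Hv. apply Cl; [|lra]. change (Rabs (v - u) < e1). apply Rabs_def1; lra. }
  assert (Hr' : forall v, u < v < u + e2 -> 0 < h (pwsys sd) (g v) * l).
  { intros v Hv. apply Cr'; [|lra]. change (Rabs (v - u) < e2). apply Rabs_def1; lra. }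
  assert (X : forall i j, (forall v, u - e1 < v < u -> in_zone (pwsys sd) i (g v)) ->
     (forall v, u < v < u + e2 -> in_zone (pwsys sd) j (g v)) ->
     exists a b, arc sd g i a u /\ arc sd g j u b).
  { assert (NZ : forall k, ~ in_zone (pwsys sd) k (g u)).
    { intros k. unfold in_zone. rewrite L. lra. }
    intros i j Hi Hj.
    assert (p1 := cond_pos e1). assert (p2 := cond_pos e2).
    destruct (arc_through sd z g i (u - e1 / 2) G T) as [a [b [Hab Ai]]]; [apply Hi; lra|].
    destruct (arc_through sd z g j (u + e2 / 2) G T) as [c [d [Hcd Aj]]]; [apply Hj; lra|].
    assert (b = u).
    { destruct Ai as [_ Z _ Sb]. destruct (Rtotal_order b u) as [h|[h|h]]; [|exact h|].
      - assert (Y := Hi b). unfold in_zone in Y. rewrite Sb in Y. lra.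
      - exfalso. apply (NZ i), Z. lra. }
    assert (c = u).
    { destruct Aj as [_ Z Sa _]. destruct (Rtotal_order c u) as [h|[h|h]]; [|exact h|].
      - exfalso. apply (NZ j), Z. lra.
      - assert (Y := Hj c). unfold in_zone in Y. rewrite Sa in Y. lra. }
    subst b c. exists a, d. now split. }
  destruct (Rtotal_order l 0) as [h|[h|h]].
  - right. apply X.
    + intros v Hv. specialize (Hl' v Hv). unfold in_zone; simpl. nra.
    + intros v Hv. specialize (Hr' v Hv). unfold in_zone; simpl. nra.
  - exfalso. assert (p := cond_pos e2). specialize (Hr' (u + e2 / 2)). rewrite h in Hr'. lra.
  - left. apply X.
    + intros v Hv. specialize (Hl' v Hv). unfold in_zone; simpl. nra.
    + intros v Hv. specialize (Hr' v Hv). unfold in_zone; simpl. nra.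
Qed.

(** * Periodic trajectories as closed curves of two arcs *)

Lemma periodic_mult {X : Type} (g : R -> X) (T : R) :
  (forall u, g (u + T) = g u) -> forall (n : Z) u, g (u + IZR n * T) = g u.
Proof.
  intros P. assert (N : forall (n : nat) u, g (u + INR n * T) = g u).
  { induction n as [|n IH]; intros u.
    - simpl. f_equal. ring.
    - rewrite S_INR. replace (u + (INR n + 1) * T) with (u + INR n * T + T) by ring.
      now rewrite P. }
  intros n u. destruct (Z_le_gt_dec 0 n) as [h|h].
  - rewrite <- (Z2Nat.id n h), <- INR_IZR_INZ. apply N.
  - rewrite <- (N (Z.to_nat (- n)) (u + IZR n * T)). f_equal.
    rewrite INR_IZR_INZ, Z2Nat.id by lia. rewrite opp_IZR. ring.
Qed.

Lemma periodic_reduce {X : Type} (g : R -> X) (T : R) :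
  0 < T -> (forall u, g (u + T) = g u) -> forall a u, exists v, a <= v < a + T /\ g v = g u.
Proof.
  intros HT P a u.
  exists (u + IZR (- Int_part ((u - a) / T)) * T). split; [|now apply periodic_mult].
  destruct (base_Int_part ((u - a) / T)) as [B1 B2]. rewrite opp_IZR.
  set (n := IZR (Int_part ((u - a) / T))) in *.
  assert (E : u - a = (u - a) / T * T) by (field; lra).
  split; nra.
Qed.

Lemma t_at_continuous sd g u : chart_traj sd g -> continuous (t_at g) u.
Proof. intros T. apply continuous_t; [apply (proj2 T)|eapply traj_continuous, T]. Qed.

Lemma zone_trichotomy S q :
  on_line S q \/ in_zone S zone1 q \/ in_zone S zone2 q.
Proof.
  unfold on_line, in_zone; simpl. destruct (Rtotal_order (h S q) 0) as [e|[e|e]].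
  - right. left. lra.
  - now left.
  - right. right. lra.
Qed.

Lemma zones_disjoint S q : in_zone S zone1 q -> in_zone S zone2 q -> False.
Proof. unfold in_zone; simpl. lra. Qed.

Lemma arcs_end_same sd g i j a b c : arc sd g i a c -> arc sd g j b c -> i = j.
Proof.
  intros [ac Za _ _] [bc Zb _ _].
  assert (M1 := Rmax_l a b). assert (M2 := Rmax_r a b).
  assert (M3 : Rmax a b < c) by now apply Rmax_lub_lt.
  specialize (Za ((Rmax a b + c) / 2)). specialize (Zb ((Rmax a b + c) / 2)).
  destruct i, j; try reflexivity; exfalso; eapply zones_disjoint; (apply Za || apply Zb); lra.
Qed.

Lemma arcs_start_same sd g i j a b c : arc sd g i c a -> arc sd g j c b -> i = j.
Proof.
  intros [ac Za _ _] [bc Zb _ _].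
  assert (M1 := Rmin_l a b). assert (M2 := Rmin_r a b).
  assert (M3 : c < Rmin a b) by now apply Rmin_glb_lt.
  specialize (Za ((Rmin a b + c) / 2)). specialize (Zb ((Rmin a b + c) / 2)).
  destruct i, j; try reflexivity; exfalso; eapply zones_disjoint; (apply Za || apply Zb); lra.
Qed.

Lemma next_arc sd z g i a b : folded sd z -> chart_traj sd g -> arc sd g i a b ->
  exists c, arc sd g (other i) b c.
Proof.
  intros G T A. destruct (after_line sd z g b G T (arc_end _ _ _ _ _ A))
    as [[x [y [A1 A2]]]|[x [y [A1 A2]]]]; rewrite (arcs_end_same _ _ _ _ _ _ _ A A1); now exists y.
Qed.

Lemma previous_arc sd z g i a b : folded sd z -> chart_traj sd g -> arc sd g i a b ->
  exists c, arc sd g (other i) c a.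
Proof.
  intros G T A. destruct (after_line sd z g a G T (arc_start _ _ _ _ _ A))
    as [[x [y [A1 A2]]]|[x [y [A1 A2]]]]; rewrite (arcs_start_same _ _ _ _ _ _ _ A A2); now exists x.
Qed.

(** Where t is largest along a periodic trajectory, an arc of zone 1 is followed
    by an arc of zone 2.  Continuing by one arc on each side, the trajectory
    meets the right half of the line no further than at this turn; since the
    half-return maps reverse the order, each of the two left end points of the
    turn is then at least the other one. *)
Lemma extremal_turn sd z g T : folded sd z -> chart_traj sd g -> 0 < T ->
  (forall u, g (u + T) = g u) ->
  exists a b c, arc sd g zone1 a b /\ arc sd g zone2 b c /\ t_at g a = t_at g c.
Proof.
  intros G Tr HT P.
  destruct (continuity_ab_maj (t_at g) 0 T) as [m [Max Hm]]; [lra| |].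
  { intros c _. apply continuity_pt_filterlim, t_at_continuous with (sd := sd), Tr. }
  assert (M : forall u, t_at g u <= t_at g m).
  { intros u. destruct (periodic_reduce g T HT P 0 u) as [v [Hv E]].
    unfold t_at at 1. rewrite <- E. apply Max. lra. }
  clear Max.
  assert (A : exists a c, arc sd g zone1 a m /\ arc sd g zone2 m c).
  { assert (Inc : forall b, m < b -> (forall v, m < v < b -> in_zone (pwsys sd) zone1 (g v)) -> False).
    { intros b Hb Z. assert (Pr := zone_progress sd z g zone1 m b G Tr Hb Z).
      specialize (M b). unfold t_at in M. simpl in Pr. lra. }
    assert (Dec : forall a, a < m -> (forall v, a < v < m -> in_zone (pwsys sd) zone2 (g v)) -> False).
    { intros a Ha Z. assert (Pr := zone_progress sd z g zone2 a m G Tr Ha Z).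
      specialize (M a). unfold t_at in M. simpl in Pr. lra. }
    destruct (zone_trichotomy (pwsys sd) (g m)) as [L|[L|L]].
    - destruct (after_line sd z g m G Tr L) as [[a [b [A1 A2]]]|[a [b [A1 A2]]]].
      + now exists a, b.
      + exfalso. destruct A2 as [l Z _ _]. now apply (Inc b).
    - exfalso. destruct (arc_through sd z g _ m G Tr L) as [a [b [Hab [_ Z _ _]]]].
      apply (Inc b); [lra|]. intros v Hv. apply Z. lra.
    - exfalso. destruct (arc_through sd z g _ m G Tr L) as [a [b [Hab [_ Z _ _]]]].
      apply (Dec a); [lra|]. intros v Hv. apply Z. lra. }
  destruct A as [a [c [A1 A2]]]. exists a, m, c. split; [exact A1|]. split; [exact A2|].
  destruct (next_arc _ _ _ _ _ _ G Tr A2) as [d A3]. simpl other in A3.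
  destruct (previous_arc _ _ _ _ _ _ G Tr A1) as [e A0]. simpl other in A0.
  assert (E1 := arc_level _ _ _ _ _ _ G Tr A1). assert (E2 := arc_level _ _ _ _ _ _ G Tr A2).
  assert (E3 := arc_level _ _ _ _ _ _ G Tr A3). assert (E0 := arc_level _ _ _ _ _ _ G Tr A0).
  assert (S1 := arc1_sides _ _ _ _ _ G Tr A1). assert (S2 := arc2_sides _ _ _ _ _ G Tr A2).
  assert (S3 := arc1_sides _ _ _ _ _ G Tr A3). assert (S0 := arc2_sides _ _ _ _ _ G Tr A0).
  assert (Dm := proj2 Tr). unfold chart in Dm. fold (t_at g) in Dm.
  assert (B : forall u, -(1/4) < t_at g u < 1/4) by (intros u; apply (Dm u)).
  apply Rle_antisym.
  - apply (Hline_inj_left sd z zone1); auto.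
    + split; [apply B|]. lra.
    + split; [apply B|]. lra.
    + rewrite E1, E3. destruct (M d) as [l|l]; [|rewrite l; lra].
      apply Rlt_le, (Hline_decreasing sd z); auto; [lra|]. apply Rlt_le, B.
  - assert (Hline (zsign zone2) (sd zone2) (t_at g c) <= Hline (zsign zone2) (sd zone2) (t_at g a)).
    { rewrite <- E2, <- E0. destruct (M e) as [l|l]; [|rewrite l; lra].
      apply Rlt_le, (Hline_decreasing sd z); auto; [lra|]. apply Rlt_le, B. }
    apply (Hline_inj_left sd z zone2); auto.
    + split; [apply B|]. lra.
    + split; [apply B|]. lra.
Qed.

(** The arc in zone i, with its end points, of the closed curve through the
    points s and r of the line. *)
Definition half_cycle (sd : zone -> side) (s r : R) (i : zone) (q : R * R) : Prop :=
  chart q /\ s <= tcoord (fst q) <= r /\ 0 <= zsign i * h (pwsys sd) q /\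
  first_int (zsign i) (sd i) q = Hline (zsign i) (sd i) s.

(** At a given t the first integral determines y. *)
Lemma first_int_inj k s q p : k <> 0 -> chart q -> chart p -> tcoord (fst q) = tcoord (fst p) ->
  first_int k s q = first_int k s p -> q = p.
Proof.
  intros Hk [Hx [_ Hy]] [Hx' [_ Hy']] Et Ei.
  assert (Ex : fst q = fst p).
  { rewrite <- (xcoord_tcoord (fst q) Hx), Et. now apply xcoord_tcoord. }
  unfold first_int in Ei. rewrite Et in Ei.
  assert (Hp := Phi_pos s (tcoord (fst p))). set (F := Phi s (tcoord (fst p))) in *.
  assert (Ey : / snd q = / snd p).
  { apply (Rmult_eq_reg_l (- k * F)); [unfold Rdiv in Ei; lra|].
    apply Rmult_integral_contrapositive; split; lra. }
  assert (snd q = snd p) by (rewrite <- (Rinv_inv (snd q)), Ey; apply Rinv_inv).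
  destruct q, p; simpl in *; congruence.
Qed.

Definition ends (i : zone) (s r : R) : R * R :=
  match i with zone1 => (s, r) | zone2 => (r, s) end.

Lemma arc_half_cycle sd z g i a b s r : folded sd z -> chart_traj sd g -> arc sd g i a b ->
  Hline (zsign i) (sd i) s = Hline (zsign i) (sd i) r ->
  (t_at g a, t_at g b) = ends i s r ->
  (forall v, a <= v <= b -> half_cycle sd s r i (g v)) /\
  (forall q, half_cycle sd s r i q -> exists v, a <= v <= b /\ g v = q).
Proof.
  intros G T A Hsr E.
  assert (Ein : Hline (zsign i) (sd i) (t_at g a) = Hline (zsign i) (sd i) s).
  { destruct i; simpl in E; injection E as E1 E2; rewrite E1; auto. }
  destruct A as [ab Z Sa Sb].
  assert (In : forall v, a <= v <= b -> half_cycle sd s r i (g v)).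
  { intros v Hv. split; [apply (proj2 T)|]. split; [|split].
    - change (s <= t_at g v <= r).
      assert (X1 : - zsign i * t_at g a <= - zsign i * t_at g v).
      { destruct (proj1 Hv) as [l|l]; [|rewrite l; lra].
        assert (Y := zone_progress sd z g i a v G T l). unfold t_at.
        destruct Y as [Y _]; [|lra]. intros w Hw. apply Z. lra. }
      assert (X2 : - zsign i * t_at g v <= - zsign i * t_at g b).
      { destruct (proj2 Hv) as [l|l]; [|rewrite l; lra].
        assert (Y := zone_progress sd z g i v b G T l). unfold t_at.
        destruct Y as [Y _]; [|lra]. intros w Hw. apply Z. lra. }
      destruct i; simpl in *; injection E as E1 E2; lra.
    - destruct (Req_dec v a) as [->|na]; [unfold on_line in Sa; rewrite Sa; lra|].
      destruct (Req_dec v b) as [->|nb]; [unfold on_line in Sb; rewrite Sb; lra|].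
      apply Rlt_le, Z. lra.
    - rewrite <- Ein. rewrite (zone_conserved sd z g i a b v a G T Z); [|lra|lra].
      apply on_line_first_int; [apply (proj2 T)|exact Sa]. }
  split; [exact In|]. intros q [Dq [Hq [_ Iq']]].
  destruct (IVT_gen (t_at g) a b (tcoord (fst q))) as [v [Hv Ev]].
  - intros x. apply continuity_pt_filterlim, t_at_continuous with (sd := sd), T.
  - unfold Rmin, Rmax.
    destruct i; simpl in E; injection E as E1 E2; rewrite E1, E2; destruct (Rle_dec _ _); lra.
  - rewrite Rmin_left, Rmax_right in Hv by lra.
    exists v. split; [exact Hv|].
    destruct (In v Hv) as [Dv [_ [_ Iv]]].
    apply (first_int_inj (zsign i) (sd i)); auto; [apply zsign_nz|]. now rewrite Iv.
Qed.

(** From the left end point the levels determine the following two arcs, which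
    lead back to it; each round lasts at least some fixed time d, so the rounds
    exhaust all later times, and periodicity gives the earlier ones. *)
Lemma cycle_orbit sd z g T a b c s r : folded sd z -> chart_traj sd g -> 0 < T ->
  (forall u, g (u + T) = g u) ->
  (forall i, Hline (zsign i) (sd i) s = Hline (zsign i) (sd i) r) ->
  arc sd g zone1 a b -> arc sd g zone2 b c -> t_at g a = s -> t_at g b = r -> t_at g c = s ->
  forall q, orbit g q <-> exists i, half_cycle sd s r i q.
Proof.
  intros G Tr HT P Hsr A1 A2 Ea Eb Ec.
  destruct (arc_half_cycle sd z g zone1 a b s r G Tr A1 (Hsr _)) as [In1 Out1];
    [simpl; congruence|].
  destruct (arc_half_cycle sd z g zone2 b c s r G Tr A2 (Hsr _)) as [In2 Out2];
    [simpl; congruence|].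
  assert (Bd : forall u, -(1/4) < t_at g u < 1/4) by (intros u; apply (proj2 Tr u)).
  assert (Sd1 := arc1_sides _ _ _ _ _ G Tr A1). assert (Sd2 := arc2_sides _ _ _ _ _ G Tr A2).
  intros q; split.
  2:{ intros [[|] Hq]; [destruct (Out1 q Hq) as [v [_ E]]|destruct (Out2 q Hq) as [v [_ E]]];
      now exists v. }
  (* Q marks the times at the left end point, where a new round starts. *)
  set (Q := fun u => t_at g u = s /\ exists a', arc sd g zone2 a' u).
  assert (HL : 1 < sL (sd zone1)) by apply G.
  assert (ex : exists d, 0 < d /\ d * (3 * (sL (sd zone1) + 1)) = r - s).
  { exists ((r - s) / (3 * (sL (sd zone1) + 1))). split; [apply Rdiv_lt_0_compat; lra|].
    field. lra. }
  destruct ex as [d [Hd Ed]].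
  assert (Step : forall u, Q u -> exists v, u + d <= v /\ Q v /\
     forall w, u <= w <= v -> exists i, half_cycle sd s r i (g w)).
  { intros u [Eu [a' A']]. destruct (next_arc _ _ _ _ _ _ G Tr A') as [v B1]. simpl other in B1.
    destruct (next_arc _ _ _ _ _ _ G Tr B1) as [w B2]. simpl other in B2.
    assert (L1 := arc_level _ _ _ _ _ _ G Tr B1). assert (L2 := arc_level _ _ _ _ _ _ G Tr B2).
    assert (S1 := arc1_sides _ _ _ _ _ G Tr B1). assert (S2 := arc2_sides _ _ _ _ _ G Tr B2).
    assert (Ev : t_at g v = r).
    { rewrite <- Eb. rewrite Eu, Hsr in L1. rewrite <- Eb in L1.
      apply Rle_antisym; apply (Hline_inj_right sd z zone1); auto; try lra;
        split; try lra; apply Bd. }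
    assert (Ew : t_at g w = s).
    { rewrite <- Ec. rewrite Ev, <- Hsr in L2. rewrite <- Ec in L2.
      apply Rle_antisym; apply (Hline_inj_left sd z zone2); auto; try lra;
        split; try lra; apply Bd. }
    destruct (arc_half_cycle sd z g zone1 u v s r G Tr B1 (Hsr _)) as [I1 _];
      [simpl; congruence|].
    destruct (arc_half_cycle sd z g zone2 v w s r G Tr B2 (Hsr _)) as [I2 _];
      [simpl; congruence|].
    exists w. split; [|split].
    - assert (Pr := zone_progress sd z g zone1 u v G Tr (arc_lt _ _ _ _ _ B1) (arc_zone _ _ _ _ _ B1)).
      assert (vw := arc_lt _ _ _ _ _ B2). fold (t_at g u) (t_at g v) in Pr. simpl in Pr.
      rewrite Eu, Ev in Pr. nra.
    - split; [exact Ew|]. now exists v.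
    - intros x Hx. destruct (Rle_or_lt x v); [exists zone1; apply I1|exists zone2; apply I2]; lra. }
  assert (It : forall n : nat, exists v, c + INR n * d <= v /\ Q v /\
     forall w, c <= w <= v -> exists i, half_cycle sd s r i (g w)).
  { induction n as [|n [v [Hv [Qv Cv]]]].
    - exists c. split; [simpl; lra|]. split; [split; [exact Ec|now exists b]|].
      intros w Hw. exists zone2. apply In2. assert (bc := arc_lt _ _ _ _ _ A2). lra.
    - destruct (Step v Qv) as [v' [Hv' [Qv' Cv']]]. exists v'.
      split; [rewrite S_INR; lra|]. split; [exact Qv'|].
      intros w Hw. destruct (Rle_or_lt w v); [apply Cv|apply Cv']; lra. }
  intros [u Eu]. destruct (periodic_reduce g T HT P c u) as [v [Hv Ev]].
  rewrite <- Eu, <- Ev.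
  destruct (INR_archimed d T Hd) as [n Hn].
  destruct (It n) as [w [Hw [_ Cw]]]. apply Cw. lra.
Qed.

Lemma locally_chart (q : R * R) : chart q -> locally q chart.
Proof.
  intros [Hx [Ht Hy]].
  assert (L1 : locally q (fun p : R * R => 1 < fst p)).
  { apply (continuous_fst (fst q) (snd q)). now apply (open_gt 1). }
  assert (L2 : locally q (fun p : R * R => 0 < snd p)).
  { apply (continuous_snd (fst q) (snd q)). now apply (open_gt 0). }
  assert (C : continuous (fun p : R * R => tcoord (fst p)) q).
  { apply (continuous_comp fst tcoord); [apply continuous_fst|now apply continuous_tcoord]. }
  assert (L3 : locally q (fun p : R * R => -(1/4) < tcoord (fst p))).
  { apply C. now apply (open_gt (-(1/4))). }
  assert (L4 : locally q (fun p : R * R => tcoord (fst p) < 1/4)).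
  { apply (C (fun y => y < 1/4)). now apply (open_lt (1/4)). }
  generalize (filter_and _ _ (filter_and _ _ L1 L2) (filter_and _ _ L3 L4)).
  apply filter_imp. unfold chart. tauto.
Qed.

(** Compactness of a period. *)
Lemma tube (g : R -> R * R) (T : R) (W : R * R -> Prop) :
  0 < T -> (forall u, g (u + T) = g u) -> (forall u, continuous g u) ->
  (forall u, locally (g u) W) ->
  exists eps : posreal, forall u q, ball (g u) eps q -> W q.
Proof.
  intros HT P C L.
  assert (X : forall u, exists e : posreal, forall v q, Rabs (v - u) < e ->
     ball (g v) e q -> W q).
  { intros u. destruct (L u) as [e He].
    assert (e2 : 0 < e / 2) by (destruct e; simpl; lra).
    destruct (C u (ball (g u) (mkposreal _ e2))) as [e' He'].
    { now exists (mkposreal _ e2). }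
    assert (Hm : 0 < Rmin e' (e / 2)) by (apply Rmin_glb_lt; [apply cond_pos|exact e2]).
    exists (mkposreal _ Hm). simpl. intros v q Hv Hq. apply He.
    replace (pos e) with (e / 2 + e / 2) by field.
    apply ball_triangle with (g v).
    - apply He'. change (Rabs (v - u) < e'). eapply Rlt_le_trans; [exact Hv|apply Rmin_l].
    - eapply ball_le; [|exact Hq]. apply Rmin_r. }
  destruct (ClassicalChoice.choice _ X) as [f Hf].
  destruct (compactness_value_1d 0 T f) as [d Hd].
  exists d. intros u q Hq. destruct (periodic_reduce g T HT P 0 u) as [v [Hv Ev]].
  rewrite <- Ev in Hq. apply Classical_Prop.NNPP. intros N.
  apply (Hd v); [lra|]. intros [t [_ [Ht Hdt]]]. apply N.
  apply (Hf t v q); [exact Ht|]. eapply ball_le; [exact Hdt|exact Hq].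
Qed.

(** * Isolation, and the flow along a level *)

(** In a thin tube the extremal turn of a competitor meets the line close to r,
    so the hypothesis on the pairs (s', r') identifies this turn with (s, r),
    and cycle_orbit identifies the orbits. *)
Lemma isolated_by_return sd z g T a b c s r eta :
  folded sd z -> chart_traj sd g -> 0 < T -> (forall u, g (u + T) = g u) ->
  (forall i, Hline (zsign i) (sd i) s = Hline (zsign i) (sd i) r) ->
  arc sd g zone1 a b -> arc sd g zone2 b c -> t_at g a = s -> t_at g b = r -> t_at g c = s ->
  0 < eta ->
  (forall s' r', -(1/4) < s' -> s' < r' -> r' < 1/4 -> Rabs (r' - r) < eta ->
     (forall i, Hline (zsign i) (sd i) s' = Hline (zsign i) (sd i) r') -> r' = r) ->
  isolated_orbit (pwsys sd) g.
Proof.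
  intros G Tr HT P Hsr A1 A2 Ea Eb Ec He Iso.
  assert (Orb := cycle_orbit sd z g T a b c s r G Tr HT P Hsr A1 A2 Ea Eb Ec).
  assert (Sd1 := arc1_sides _ _ _ _ _ G Tr A1). rewrite Ea, Eb in Sd1.
  assert (Bd : forall u, -(1/4) < t_at g u < 1/4) by (intros u; apply (proj2 Tr u)).
  assert (Bs : -(1/4) < s < 1/4) by (rewrite <- Ea; apply Bd).
  assert (Br : -(1/4) < r < 1/4) by (rewrite <- Eb; apply Bd).
  destruct (tube g T (fun q => chart q /\ (on_line (pwsys sd) q -> z zone1 < tcoord (fst q) ->
     Rabs (tcoord (fst q) - r) < eta)) HT P) as [eps Heps].
  - intros u. eapply traj_continuous, Tr.
  - intros u. apply filter_and; [apply locally_chart, Tr|].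
    destruct (proj1 (Orb (g u))) as [i Hi]; [now exists u|].
    destruct (Req_dec (h (pwsys sd) (g u)) 0) as [L|L].
    + destruct Hi as [Dq [Hq [_ Iq']]].
      rewrite on_line_first_int in Iq' by assumption. fold (t_at g u) in Hq, Iq'.
      assert (Cont : continuous (fun q : R * R => tcoord (fst q)) (g u)).
      { apply (continuous_comp fst tcoord); [apply continuous_fst|apply continuous_tcoord, Dq]. }
      destruct (Rle_lt_or_eq_dec s (t_at g u) (proj1 Hq)) as [l|e].
      * assert (t_at g u = r).
        { assert (S1 := level_sides sd z i s (t_at g u) G (proj1 Bs) l (proj2 (Bd u)) (eq_sym Iq')).
          assert (S2 := level_sides sd z i s r G (proj1 Bs)).
          rewrite (Hsr i) in Iq'.
          apply Rle_antisym; [lra|].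
          apply (Hline_inj_right sd z i); auto; try lra; split; try lra; apply Bd. }
        assert (Lc : locally (g u) (fun q : R * R => Rabs (tcoord (fst q) - r) < eta)).
        { apply (Cont (fun t => Rabs (t - r) < eta)). fold (t_at g u). rewrite H.
          exists (mkposreal eta He). intros y Hy. exact Hy. }
        generalize Lc. apply filter_imp. tauto.
      * assert (Lc : locally (g u) (fun q : R * R => tcoord (fst q) < z zone1)).
        { apply (Cont (fun t => t < z zone1)). fold (t_at g u). rewrite <- e.
          apply open_lt. lra. }
        generalize Lc. apply filter_imp. intros q Hq' _ Hq''. lra.
    + assert (Lc : locally (g u) (fun q : R * R => h (pwsys sd) q <> 0)).
      { apply (continuous_h_plane (pwsys sd) (g u) (fun y => y <> 0)).
        now apply open_neq. }
      generalize Lc. apply filter_imp. intros q Hq' Hq''. now elim Hq'.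
  - exists eps. intros dl [Td [[T' [HT' P']] _]] Tube.
    assert (W : forall u, chart (dl u) /\ (on_line (pwsys sd) (dl u) -> z zone1 < t_at dl u ->
       Rabs (t_at dl u - r) < eta)).
    { intros u. destruct (Tube u) as [v Hv]. apply (Heps v (dl u) Hv). }
    assert (Td' : chart_traj sd dl) by (split; [exact Td|apply W]).
    destruct (extremal_turn sd z dl T' G Td' HT' P') as [a' [b' [c' [B1 [B2 E']]]]].
    assert (S1 := arc1_sides _ _ _ _ _ G Td' B1).
    assert (L1 := arc_level _ _ _ _ _ _ G Td' B1). assert (L2 := arc_level _ _ _ _ _ _ G Td' B2).
    assert (Bd' : forall u, -(1/4) < t_at dl u < 1/4) by (intros u; apply (proj2 Td' u)).
    assert (Er : t_at dl b' = r).
    { apply (Iso (t_at dl a')).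
      - apply Bd'.
      - lra.
      - apply Bd'.
      - apply W; [apply (arc_end _ _ _ _ _ B1)|lra].
      - intros [|]; [exact L1|]. now rewrite E', L2. }
    assert (Es : t_at dl a' = s).
    { rewrite Er, <- Hsr in L1. apply Rle_antisym; apply (Hline_inj_left sd z zone1); auto;
      try lra; split; try lra; apply Bd'. }
    assert (Orb' := cycle_orbit sd z dl T' a' b' c' s r G Td' HT' P' Hsr B1 B2 Es Er).
    intros q. rewrite Orb. symmetry. apply Orb'. now rewrite <- E'.
Qed.

(** The solution of t' = mu(t): the quantity (2 + t)/(sL - t) is multiplied by
    an exponential of the time. *)
Definition flow (k : R) (s : side) (t0 u : R) : R :=
  (sL s * ((2 + t0) / (sL s - t0) * exp (- k * (sL s + 2) * u)) - 2)
  / (1 + (2 + t0) / (sL s - t0) * exp (- k * (sL s + 2) * u)).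

Lemma flow_den k s t0 u : 1 < sL s -> -1 < t0 < 1 ->
  0 < (2 + t0) / (sL s - t0) * exp (- k * (sL s + 2) * u).
Proof.
  intros HL Ht. apply Rmult_lt_0_compat; [|apply exp_pos]. apply Rdiv_lt_0_compat; lra.
Qed.

Lemma flow_0 k s t0 : 1 < sL s -> -1 < t0 < 1 -> flow k s t0 0 = t0.
Proof.
  intros HL Ht. unfold flow. rewrite Rmult_0_r, exp_0. field. split; lra.
Qed.

Lemma flow_derive k s t0 u : 1 < sL s -> -1 < t0 < 1 ->
  is_derive (flow k s t0) u (mu k s (flow k s t0 u)).
Proof.
  intros HL Ht. assert (P := flow_den k s t0 u HL Ht). unfold flow, mu.
  auto_derive.
  - apply Rgt_not_eq. lra.
  - set (e := exp (- k * (sL s + 2) * u)) in *.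
    replace (exp (- (1) * k * (sL s + 2) * u)) with e by (unfold e; f_equal; ring).
    set (q := (2 + t0) / (sL s - t0)) in *.
    replace ((2 + t0) * / (sL s + - t0)) with q by reflexivity.
    field. lra.
Qed.

Lemma flow_time k s t0 t1 : k * k = 1 -> 1 < sL s -> -1 < t0 < 1 -> -1 < t1 < 1 ->
  0 < - k * (t1 - t0) -> exists T, 0 < T /\ flow k s t0 T = t1.
Proof.
  intros Hk HL H0 H1 Hd.
  set (k0 := (2 + t0) / (sL s - t0)). set (k1 := (2 + t1) / (sL s - t1)).
  assert (P0 : 0 < k0) by (apply Rdiv_lt_0_compat; lra).
  assert (P1 : 0 < k1) by (apply Rdiv_lt_0_compat; lra).
  assert (E : k1 - k0 = (t1 - t0) * ((sL s + 2) / ((sL s - t0) * (sL s - t1)))).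
  { unfold k0, k1. field. split; lra. }
  assert (Pq : 0 < (sL s + 2) / ((sL s - t0) * (sL s - t1))).
  { apply Rdiv_lt_0_compat; [lra|]. apply Rmult_lt_0_compat; lra. }
  assert (Hln : 0 < - k * (ln k1 - ln k0)).
  { assert (K : k = 1 \/ k = -1) by (assert ((k - 1) * (k + 1) = 0) by lra;
      apply Rmult_integral in H; lra).
    destruct K as [-> | ->].
    - assert (ln k1 < ln k0); [|lra]. apply ln_increasing; [exact P1|]. nra.
    - assert (ln k0 < ln k1); [|lra]. apply ln_increasing; [exact P0|]. nra. }
  exists (- k * (ln k1 - ln k0) / (sL s + 2)). split.
  - apply Rdiv_lt_0_compat; lra.
  - unfold flow. fold k0.
    replace (- k * (sL s + 2) * (- k * (ln k1 - ln k0) / (sL s + 2)))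
      with (ln k1 - ln k0) by (field_simplify; [|lra]; replace (k ^ 2) with 1 by lra; ring).
    assert (Ex : k0 * exp (ln k1 - ln k0) = k1).
    { unfold Rminus. rewrite exp_plus, exp_Ropp, !exp_ln by assumption. field. lra. }
    rewrite Ex.
    unfold k1. field. split; lra.
Qed.

Lemma flow_between k s t0 t1 T u : k * k = 1 -> 1 < sL s -> -1 < t0 < 1 -> -1 < t1 < 1 ->
  flow k s t0 T = t1 -> 0 < u < T ->
  0 < - k * (flow k s t0 u - t0) /\ 0 < - k * (t1 - flow k s t0 u).
Proof.
  intros Hk HL H0 H1 E Hu.
  assert (M : forall a b, a < b -> - k * flow k s t0 a < - k * flow k s t0 b).
  { intros a b ab. apply (increasing_of_derive (fun u => - k * flow k s t0 u)
      (fun u => - k * mu k s (flow k s t0 u))); [exact ab| | |].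
    - intros x _. apply (is_derive_scal (flow k s t0) x (- k)). now apply flow_derive.
    - intros x _. eapply derive_continuous.
      apply (is_derive_scal (flow k s t0) x (- k)). now apply flow_derive.
    - intros x _. unfold mu. assert (P := flow_den k s t0 x HL H0). unfold flow.
      set (q := (2 + t0) / (sL s - t0) * exp (- k * (sL s + 2) * x)) in *. clearbody q.
      replace (- k * (- k * ((2 + (sL s * q - 2) / (1 + q)) * (sL s - (sL s * q - 2) / (1 + q)))))
        with ((k * k) * ((sL s + 2) * (sL s + 2) * q / ((1 + q) * (1 + q)))) by (field; lra).
      rewrite Hk, Rmult_1_l. apply Rdiv_lt_0_compat; repeat apply Rmult_lt_0_compat; lra. }
  assert (X1 := M 0 u (proj1 Hu)). assert (X2 := M u T (proj2 Hu)).
  rewrite flow_0 in X1 by assumption. rewrite E in X2. lra.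
Qed.

(** The value of 1/y at the coordinate t on the level C. *)
Definition inv_y (k : R) (s : side) (C t : R) : R := - k * (C - sf s * Psi s t) / Phi s t.
Definition level_pt (k : R) (s : side) (C t : R) : R * R := (xcoord t, / inv_y k s C t).

Lemma is_derive_inv_y k s C t : k * k = 1 -> 1 < sL s -> -1 < t < 1 ->
  is_derive (inv_y k s C) t
    (- inv_y k s C t * (sal s / (2 + t) + (sal s + sga s) / (sL s - t) + sga s / (1 + t))
     + k * sf s / ((2 + t) * (sL s - t))).
Proof.
  intros Hk HL Ht. assert (D1 := is_derive_Phi s t HL Ht). assert (D2 := is_derive_Psi s t HL Ht).
  assert (P := Phi_pos s t). unfold inv_y. auto_derive.
  - split; [eexists; exact D2|]. split; [eexists; exact D1|]. split; [lra|exact I].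
  - use_derive D1. use_derive D2.
    unfold psi. field. repeat split; lra.
Qed.

Lemma level_pt_first_int k s C t : k * k = 1 -> -1 < t -> first_int k s (level_pt k s C t) = C.
Proof.
  intros Hk Ht. unfold first_int, level_pt, inv_y; simpl. rewrite tcoord_xcoord by exact Ht.
  assert (P := Phi_pos s t).
  unfold Rdiv at 1. rewrite Rinv_inv.
  replace (- k * Phi s t * (- k * (C - sf s * Psi s t) / Phi s t))
    with ((k * k) * (C - sf s * Psi s t)) by (field; lra).
  rewrite Hk. ring.
Qed.

Lemma level_pt_chart k s C t : -(1/4) < t < 1/4 -> 0 < inv_y k s C t -> chart (level_pt k s C t).
Proof.
  intros Ht Hw. unfold chart, level_pt; simpl. rewrite tcoord_xcoord by lra.
  split; [apply xcoord_gt; lra|]. split; [exact Ht|]. now apply Rinv_0_lt_compat.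
Qed.

Lemma level_pt_line k s t : k * k = 1 -> -(1/4) < t < 1/4 ->
  level_pt k s (Hline k s t) t = (xcoord t, / (1 + t)).
Proof.
  intros Hk Ht. unfold level_pt. f_equal. f_equal. unfold inv_y, Hline.
  assert (P := Phi_pos s t).
  replace (- k * (- k * (1 + t) * Phi s t + sf s * Psi s t - sf s * Psi s t) / Phi s t)
    with (k * k * (1 + t)) by (field; lra). rewrite Hk. ring.
Qed.

Lemma arc_derive_x k s C f u : 1 < sL s -> -1 < f u < 1 ->
  is_derive f u (mu k s (f u)) ->
  is_derive (fun v : R => fst (level_pt k s C (f v))) u (xdot (lv_field k s) (level_pt k s C (f u))).
Proof.
  intros HL Hf D. unfold level_pt; simpl. unfold xcoord.
  auto_derive; [split; [eexists; exact D|]; split; [eexists; exact D|]; split; [lra|exact I]|].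
  use_derive D.
  unfold xdot, mu, lv_field; simpl. rewrite Rmult_0_l. field. lra.
Qed.

Lemma arc_derive_y k s C f u : k * k = 1 -> 1 < sL s -> -1 < f u < 1 -> 0 < inv_y k s C (f u) ->
  is_derive f u (mu k s (f u)) ->
  is_derive (fun v : R => snd (level_pt k s C (f v))) u (ydot (lv_field k s) (level_pt k s C (f u))).
Proof.
  intros Hk HL Hf Hw D. unfold level_pt; simpl.
  assert (D1 := is_derive_comp (inv_y k s C) f u _ _ (is_derive_inv_y k s C (f u) Hk HL Hf) D).
  evar_last; [apply is_derive_inv; [exact D1|lra]|].
  unfold ydot, lv_field, xcoord, mu, scal; simpl. unfold mult; simpl.
  set (w := inv_y k s C (f u)) in *.
  match goal with |- ?a = ?b =>
    replace a with (b + sf s * (k * k - 1) / (w * w)); [rewrite Hk; field; lra|] end.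
  field. repeat split; lra.
Qed.

Lemma continuous_level_pt k s C t : k * k = 1 -> 1 < sL s -> -1 < t < 1 -> 0 < inv_y k s C t ->
  continuous (level_pt k s C) t.
Proof.
  intros Hk HL Ht Hw. unfold level_pt.
  apply (continuous_comp_2 xcoord (fun t => / inv_y k s C t) (fun x y : R => (x, y))).
  - unfold xcoord. apply derive_continuous with (l := - / (1 + t) ^ 2).
    auto_derive; [lra|]. field. lra.
  - eapply derive_continuous, is_derive_inv; [now apply is_derive_inv_y|lra].
  - apply continuous_ext with (f := fun x : R * R => x); [now intros [x y]|apply continuous_id].
Qed.

Lemma glue {X : Type} (A1 A2 : R -> X) (T1 T2 : R) :
  0 < T1 -> 0 < T2 -> A1 T1 = A2 0 -> A2 T2 = A1 0 ->
  exists g : R -> X, (forall u, g (u + (T1 + T2)) = g u) /\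
    (forall u, 0 <= u <= T1 -> g u = A1 u) /\
    (forall u, 0 <= u <= T2 -> g (T1 + u) = A2 u).
Proof.
  intros H1 H2 E1 E2. set (T := T1 + T2).
  set (g0 := fun u => if Rle_dec u T1 then A1 u else A2 (u - T1)).
  set (red := fun u => u - T * IZR (Int_part (u / T))).
  assert (Red : forall u (n : Z), 0 <= u - IZR n * T < T -> red u = u - IZR n * T).
  { intros u n Hn. unfold red.
    assert (E : Int_part (u / T) = n); [|rewrite E; ring].
    symmetry. apply Int_part_spec.
    assert (Eu : u = u / T * T) by (unfold T; field; lra).
    assert (0 < T) by (unfold T; lra). split; nra. }
  assert (Rng : forall u, 0 <= red u < T).
  { intros u. unfold red. destruct (base_Int_part (u / T)) as [B1 B2].
    assert (Eu : u = u / T * T) by (unfold T; field; lra).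
    assert (0 < T) by (unfold T; lra). split; nra. }
  exists (fun u => g0 (red u)). split; [|split].
  - intros u. f_equal.
    rewrite (Red (u + T) (Int_part (u / T) + 1)%Z).
    + unfold red. rewrite plus_IZR. ring.
    + assert (Y := Rng u). unfold red in Y. rewrite plus_IZR. lra.
  - intros u Hu. rewrite (Red u 0%Z) by (unfold T; simpl; lra).
    replace (u - 0 * T) with u by ring. unfold g0. destruct (Rle_dec u T1); [reflexivity|lra].
  - intros u Hu. destruct (Req_dec u T2) as [->|ne].
    + rewrite (Red _ 1%Z) by (unfold T; simpl; lra).
      replace (T1 + T2 - 1 * T) with 0 by (unfold T; ring).
      unfold g0. destruct (Rle_dec 0 T1); [now symmetry|lra].
    + rewrite (Red _ 0%Z) by (unfold T; simpl; lra).
      replace (T1 + u - 0 * T) with (T1 + u) by ring.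
      unfold g0. destruct (Rle_dec (T1 + u) T1) as [l|l].
      * replace u with 0 by lra. now rewrite Rplus_0_r.
      * f_equal. ring.
Qed.

Lemma continuous_paste {U : UniformSpace} (g f1 f2 : R -> U) (u a b : R) :
  0 < a -> 0 < b -> continuous f1 u -> continuous f2 u ->
  (forall y, u - a <= y <= u -> g y = f1 y) -> (forall y, u <= y <= u + b -> g y = f2 y) ->
  continuous g u.
Proof.
  intros Ha Hb C1 C2 E1 E2 P HP.
  assert (L1 : locally u (fun y => P (f1 y))) by (apply C1; rewrite <- E1; [exact HP|lra]).
  assert (L2 : locally u (fun y => P (f2 y))) by (apply C2; rewrite <- E2; [exact HP|lra]).
  assert (Hm : 0 < Rmin a b) by now apply Rmin_glb_lt.
  assert (L3 : locally u (fun y => u - a < y < u + b)).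
  { exists (mkposreal _ Hm). intros y Hy. change (Rabs (y - u) < Rmin a b) in Hy.
    pose proof (Rmin_l a b). pose proof (Rmin_r a b). apply Rabs_def2 in Hy. lra. }
  change (locally u (fun y => P (g y))).
  generalize (filter_and _ _ (filter_and _ _ L1 L2) L3). apply filter_imp.
  intros y [[P1 P2] Hy]. destruct (Rle_or_lt y u) as [l|l].
  - rewrite E1 by lra. exact P1.
  - rewrite E2 by lra. exact P2.
Qed.

Lemma is_derive_shift (f g : R -> R) (c T u l : R) :
  c < u < c + T -> (forall y, c <= y <= c + T -> g y = f (y - c)) ->
  is_derive f (u - c) l -> is_derive g u l.
Proof.
  intros Hu E D.
  apply (is_derive_ext_loc (fun y => f (y - c))).
  - assert (Hm : 0 < Rmin (u - c) (c + T - u)) by (apply Rmin_glb_lt; lra).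
    exists (mkposreal _ Hm). intros y Hy. change (Rabs (y - u) < Rmin (u - c) (c + T - u)) in Hy.
    pose proof (Rmin_l (u - c) (c + T - u)). pose proof (Rmin_r (u - c) (c + T - u)).
    apply Rabs_def2 in Hy. symmetry. apply E. lra.
  - evar_last.
    + apply (is_derive_comp f (fun y => y - c)); [exact D|].
      auto_derive; [exact I|reflexivity].
    + unfold scal; simpl; unfold mult; simpl. ring.
Qed.

Lemma continuous_shift {U : UniformSpace} (f : R -> U) (c u : R) :
  continuous f (u - c) -> continuous (fun y => f (y - c)) u.
Proof.
  intros C. apply (continuous_comp (fun y => y - c) f); [|exact C].
  apply (continuous_minus (fun y : R => y) (fun _ => c)); [apply continuous_id|apply continuous_const].
Qed.

(** * Existence of closed trajectories *)

Lemma Hline_above sd z i s r t : folded sd z -> -(1/4) < s -> r < 1/4 -> s < t < r ->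
  Hline (zsign i) (sd i) s = Hline (zsign i) (sd i) r ->
  Hline (zsign i) (sd i) s < Hline (zsign i) (sd i) t.
Proof.
  intros G Hs Hr Ht E. destruct (Rle_or_lt t (z i)) as [l|l].
  - apply (Hline_increasing sd z); auto; lra.
  - rewrite E. apply (Hline_decreasing sd z); auto; lra.
Qed.

Lemma N_sign_right sd z i t : folded sd z -> z i < t <= 1/4 -> fold_poly (zsign i) (sd i) t < 0.
Proof. intros G Ht. destruct (G i) as [_ [Hz [<- Nd]]]. apply Nd; lra. Qed.

Lemma N_sign_left sd z i t : folded sd z -> -(1/4) <= t < z i -> 0 < fold_poly (zsign i) (sd i) t.
Proof. intros G Ht. destruct (G i) as [_ [Hz [<- Nd]]]. apply Nd; lra. Qed.

Lemma line_pt_on sd t : -(1/4) < t < 1/4 ->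
  chart (xcoord t, / (1 + t)) /\ on_line (pwsys sd) (xcoord t, / (1 + t)).
Proof.
  intros Ht. split.
  - unfold chart; simpl. rewrite tcoord_xcoord by lra. split; [apply xcoord_gt; lra|]. split; [exact Ht|].
    apply Rinv_0_lt_compat. lra.
  - apply on_line_iff; simpl. unfold xcoord. field. lra.
Qed.

(** The requirements on a crossing trajectory at the time u, inside the chart. *)
Definition regular_at (sd : zone -> side) (g : R -> R * R) (u : R) : Prop :=
  chart (g u) /\ continuous g u /\
  (forall j, in_zone (pwsys sd) j (g u) ->
    is_derive (fun s => fst (g s)) u (xdot (field (pwsys sd) j) (g u)) /\
    is_derive (fun s => snd (g s)) u (ydot (field (pwsys sd) j) (g u))) /\
  (on_line (pwsys sd) (g u) -> crossing_point (pwsys sd) (g u) /\ crosses (pwsys sd) g u).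

(** Between s and r the levels through these points are graphs over t that stay
    on their side of the line, because Hline exceeds its value at s and r
    there.  The flow runs over the first graph from s to r and over the second
    one back. *)
Lemma periodic_orbit sd z s r :
  folded sd z -> -(1/4) < s -> r < 1/4 -> (forall i, s < z i < r) ->
  (forall i, Hline (zsign i) (sd i) s = Hline (zsign i) (sd i) r) ->
  (forall i t, s <= t <= r -> 0 < inv_y (zsign i) (sd i) (Hline (zsign i) (sd i) s) t) ->
  exists g T1 T2, 0 < T1 /\ 0 < T2 /\ (forall u, g (u + (T1 + T2)) = g u) /\
    chart_traj sd g /\ arc sd g zone1 0 T1 /\ arc sd g zone2 T1 (T1 + T2) /\
    g 0 = (xcoord s, / (1 + s)) /\ g T1 = (xcoord r, / (1 + r)).
Proof.
  intros G Hs Hr Hz Hsr Hw.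
  set (P := fun i t => level_pt (zsign i) (sd i) (Hline (zsign i) (sd i) s) t).
  assert (HL : forall i, 1 < sL (sd i)) by apply G.
  assert (sr : s < r) by (specialize (Hz zone1); lra).
  assert (Ps : forall i, P i s = (xcoord s, / (1 + s))).
  { intros i. apply level_pt_line; [apply zsign_sq|lra]. }
  assert (Pr : forall i, P i r = (xcoord r, / (1 + r))).
  { intros i. unfold P. rewrite Hsr. apply level_pt_line; [apply zsign_sq|lra]. }
  assert (Pd : forall i t, s <= t <= r -> chart (P i t)).
  { intros i t Ht. apply level_pt_chart; [lra|now apply Hw]. }
  assert (Pz : forall i t, s < t < r -> in_zone (pwsys sd) i (P i t)).
  { intros i t Ht. apply zone_pos; [apply Pd; lra|]. unfold P at 1.
    rewrite level_pt_first_int; [|apply zsign_sq|lra]. unfold P, level_pt; simpl.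
    rewrite tcoord_xcoord by lra. now apply (Hline_above sd z i s r). }
  set (f := fun i => flow (zsign i) (sd i) (match i with zone1 => s | zone2 => r end)).
  assert (F0 : f zone1 0 = s /\ f zone2 0 = r) by (split; apply flow_0; try apply HL; lra).
  destruct (flow_time (zsign zone1) (sd zone1) s r (zsign_sq _) (HL _)) as [T1 [HT1 F1]];
    [lra|lra|simpl; lra|].
  destruct (flow_time (zsign zone2) (sd zone2) r s (zsign_sq _) (HL _)) as [T2 [HT2 F2]];
    [lra|lra|simpl; lra|].
  set (T := fun i : zone => match i with zone1 => T1 | zone2 => T2 end).
  change (f zone1 T1 = r) in F1. change (f zone2 T2 = s) in F2.
  assert (Fr : forall i u, 0 < u < T i -> s < f i u < r).
  { intros [|] u Hu; simpl in Hu.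
    - destruct (flow_between (zsign zone1) (sd zone1) s r T1 u (zsign_sq _) (HL _)) as [X1 X2];
        try lra; [exact F1|]. simpl in X1, X2. change (s < flow (-1) (sd zone1) s u < r). lra.
    - destruct (flow_between (zsign zone2) (sd zone2) r s T2 u (zsign_sq _) (HL _)) as [X1 X2];
        try lra; [exact F2|]. simpl in X1, X2. change (s < flow 1 (sd zone2) r u < r). lra. }
  assert (Fc : forall i u, 0 <= u <= T i -> s <= f i u <= r).
  { intros i u [[l|e] [l'|e']].
    - specialize (Fr i u). lra.
    - subst u. destruct i; simpl; lra.
    - subst u. destruct i; lra.
    - subst u. destruct i; lra. }
  assert (Fd : forall i u, is_derive (f i) u (mu (zsign i) (sd i) (f i u))).
  { intros i u. apply flow_derive; [apply HL|destruct i; lra]. }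
  assert (Ac : forall i u, 0 <= u <= T i -> continuous (fun u => P i (f i u)) u).
  { intros i u Hu. apply (continuous_comp (f i) (P i)).
    - eapply derive_continuous, Fd.
    - specialize (Fc i u Hu). apply continuous_level_pt; [apply zsign_sq|apply HL|lra|].
      apply Hw. lra. }
  destruct (glue (fun u => P zone1 (f zone1 u)) (fun u => P zone2 (f zone2 u)) T1 T2 HT1 HT2)
    as [g [Pg [G1 G2]]].
  { rewrite F1, (proj2 F0). now rewrite !Pr. }
  { rewrite F2, (proj1 F0). now rewrite !Ps. }
  assert (G1' : forall (n : Z) y, IZR n * (T1 + T2) <= y <= IZR n * (T1 + T2) + T1 ->
     g y = P zone1 (f zone1 (y - IZR n * (T1 + T2)))).
  { intros n y Hy. rewrite <- G1 by lra.
    rewrite <- (periodic_mult g _ Pg n (y - _)). f_equal. ring. }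
  assert (G2' : forall (n : Z) y, IZR n * (T1 + T2) + T1 <= y <= IZR n * (T1 + T2) + T1 + T2 ->
     g y = P zone2 (f zone2 (y - (IZR n * (T1 + T2) + T1)))).
  { intros n y Hy. rewrite <- G2 by lra.
    rewrite <- (periodic_mult g _ Pg n (T1 + _)). f_equal. ring. }
  assert (Inn : forall i u c, c < u < c + T i ->
     (forall y, c <= y <= c + T i -> g y = P i (f i (y - c))) ->
     s < f i (u - c) < r /\ g u = P i (f i (u - c)) /\ in_zone (pwsys sd) i (g u)).
  { intros i u c Hu E. assert (Y : s < f i (u - c) < r) by (apply Fr; lra).
    split; [exact Y|]. rewrite E by lra. split; [reflexivity|]. now apply Pz. }
  assert (Int : forall i u c, c < u < c + T i ->
     (forall y, c <= y <= c + T i -> g y = P i (f i (y - c))) ->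
     regular_at sd g u).
  { intros i u c Hu E. destruct (Inn i u c Hu E) as [Y [Eg Z]].
    assert (W := Hw i (f i (u - c))).
    unfold regular_at. split; [rewrite Eg; apply Pd; lra|]. split; [|split].
    - apply (continuous_paste g (fun y => P i (f i (y - c))) (fun y => P i (f i (y - c))) u (u - c) (c + T i - u)).
      + lra.
      + lra.
      + apply (continuous_shift (fun y => P i (f i y))). apply Ac. lra.
      + apply (continuous_shift (fun y => P i (f i y))). apply Ac. lra.
      + intros y Hy. apply E. lra.
      + intros y Hy. apply E. lra.
    - intros j Zj. assert (j = i).
      { destruct i, j; try reflexivity; exfalso; eapply zones_disjoint; eassumption. }
      subst j. replace (field (pwsys sd) i) with (lv_field (zsign i) (sd i)) by reflexivity.
      rewrite Eg. split.
      + apply (is_derive_shift (fun v => fst (P i (f i v))) _ c (T i)); [exact Hu| |].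
        * intros y Hy. now rewrite E.
        * apply arc_derive_x; [apply HL|lra|apply Fd].
      + apply (is_derive_shift (fun v => snd (P i (f i v))) _ c (T i)); [exact Hu| |].
        * intros y Hy. now rewrite E.
        * apply arc_derive_y; [apply zsign_sq|apply HL|lra|apply W; lra|apply Fd].
    - intros L. exfalso. unfold in_zone in Z. rewrite L in Z. lra. }
  assert (Jun : forall i j u t, i <> j ->
     -(1/4) < t < 1/4 -> g u = (xcoord t, / (1 + t)) ->
     (forall k, 0 < - zsign i * lie (pwsys sd) k (g u)) ->
     (forall y, u - T i <= y <= u -> g y = P i (f i (y - (u - T i)))) ->
     (forall y, u <= y <= u + T j -> g y = P j (f j (y - u))) ->
     regular_at sd g u).
  { intros i j u t ij Ht Eg Lie Ei Ej.
    assert (Ti : 0 < T i) by (destruct i; simpl; lra).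
    assert (Tj : 0 < T j) by (destruct j; simpl; lra).
    destruct (line_pt_on sd t Ht) as [Dt Lt].
    unfold regular_at. split; [now rewrite Eg|]. split; [|split].
    - apply (continuous_paste g (fun y => P i (f i (y - (u - T i)))) (fun y => P j (f j (y - u))) u (T i) (T j) Ti Tj).
      + apply (continuous_shift (fun y => P i (f i y))). apply Ac. lra.
      + apply (continuous_shift (fun y => P j (f j y))). apply Ac. lra.
      + exact Ei.
      + exact Ej.
    - intros k Zk. exfalso. rewrite Eg in Zk. unfold in_zone in Zk. rewrite Lt in Zk. lra.
    - intros _. assert (Sij : zsign j = - zsign i) by (destruct i, j; simpl; try lra; now elim ij).
      split; [split|split].
      + now rewrite Eg.
      + assert (L1 := Lie zone1). assert (L2 := Lie zone2). destruct i; simpl in L1, L2; nra.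
      + exists (mkposreal _ Ti). intros y Hy yu. change (Rabs (y - u) < T i) in Hy.
        apply Rabs_def2 in Hy.
        assert (Z : in_zone (pwsys sd) i (g y)).
        { apply (Inn i y (u - T i)); [lra|]. intros v Hv. apply Ei. lra. }
        unfold in_zone in Z. specialize (Lie zone1). set (l := lie (pwsys sd) zone1 (g u)) in *.
        destruct i; simpl in *; nra.
      + exists (mkposreal _ Tj). intros y Hy yu. change (Rabs (y - u) < T j) in Hy.
        apply Rabs_def2 in Hy.
        assert (Z : in_zone (pwsys sd) j (g y)).
        { apply (Inn j y u); [lra|]. exact Ej. }
        unfold in_zone in Z. rewrite Sij in Z. specialize (Lie zone1).
        set (l := lie (pwsys sd) zone1 (g u)) in *.
        destruct i; simpl in *; nra. }
  assert (LieR : forall k, 0 < lie (pwsys sd) k (xcoord r, / (1 + r))).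
  { intros k. destruct (line_pt_on sd r) as [Dt Lt]; [lra|].
    rewrite lie_pwsys by assumption. simpl. rewrite tcoord_xcoord by lra.
    specialize (Hz k). assert (N : fold_poly (zsign k) (sd k) r < 0)
      by (apply (N_sign_right sd z); [exact G|lra]).
    assert (Q : 0 < / (1 + r) * / (1 + r)) by (apply Rmult_lt_0_compat; apply Rinv_0_lt_compat; lra).
    nra. }
  assert (LieL : forall k, lie (pwsys sd) k (xcoord s, / (1 + s)) < 0).
  { intros k. destruct (line_pt_on sd s) as [Dt Lt]; [lra|].
    rewrite lie_pwsys by assumption. simpl. rewrite tcoord_xcoord by lra.
    specialize (Hz k). assert (N : 0 < fold_poly (zsign k) (sd k) s)
      by (apply (N_sign_left sd z); [exact G|lra]).
    assert (Q : 0 < / (1 + s) * / (1 + s)) by (apply Rmult_lt_0_compat; apply Rinv_0_lt_compat; lra).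
    nra. }
  assert (Tr : chart_traj sd g).
  { assert (All : forall u, regular_at sd g u).
    { intros u. set (n := Int_part (u / (T1 + T2))).
      assert (Hn : IZR n * (T1 + T2) <= u < IZR n * (T1 + T2) + (T1 + T2)).
      { destruct (base_Int_part (u / (T1 + T2))) as [B1 B2]. fold n in B1, B2.
        assert (Eu : u = u / (T1 + T2) * (T1 + T2)) by (field; lra). split; nra. }
      destruct (Req_dec u (IZR n * (T1 + T2))) as [e|ne].
      - apply (Jun zone2 zone1 u s); [discriminate|lra| | | |].
        + rewrite (G1' n) by lra. rewrite <- e. replace (u - u) with 0 by ring.
          rewrite (proj1 F0). apply Ps.
        + intros k. replace (g u) with (xcoord s, / (1 + s)).
          * specialize (LieL k). simpl zsign. lra.
          * symmetry. rewrite (G1' n) by lra. rewrite <- e. replace (u - u) with 0 by ring.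
            rewrite (proj1 F0). apply Ps.
        + simpl. intros y Hy. rewrite (G2' (n - 1)%Z) by (rewrite minus_IZR; lra).
          apply (f_equal (fun v => P zone2 (f zone2 v))). rewrite minus_IZR. lra.
        + simpl. intros y Hy. rewrite (G1' n) by lra. apply (f_equal (fun v => P zone1 (f zone1 v))). lra.
      - destruct (Req_dec u (IZR n * (T1 + T2) + T1)) as [e|ne'].
        + apply (Jun zone1 zone2 u r); [discriminate|lra| | | |].
          * rewrite (G2' n) by lra. rewrite <- e. replace (u - u) with 0 by ring.
            rewrite (proj2 F0). apply Pr.
          * intros k. replace (g u) with (xcoord r, / (1 + r)).
            -- specialize (LieR k). simpl zsign. lra.
            -- symmetry. rewrite (G2' n) by lra. rewrite <- e. replace (u - u) with 0 by ring.
               rewrite (proj2 F0). apply Pr.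
          * simpl. intros y Hy. rewrite (G1' n) by lra. apply (f_equal (fun v => P zone1 (f zone1 v))). lra.
          * simpl. intros y Hy. rewrite (G2' n) by lra. apply (f_equal (fun v => P zone2 (f zone2 v))). lra.
        + destruct (Rlt_or_le u (IZR n * (T1 + T2) + T1)) as [l|l].
          * apply (Int zone1 u (IZR n * (T1 + T2))); simpl; [lra|]. intros y Hy. apply G1'. lra.
          * apply (Int zone2 u (IZR n * (T1 + T2) + T1)); simpl; [lra|].
            intros y Hy. apply G2'. lra. }
    split; [intros u _|intros u]; apply All. }
  assert (E0 : g 0 = (xcoord s, / (1 + s))) by (rewrite G1, (proj1 F0) by lra; apply Ps).
  assert (E1 : g T1 = (xcoord r, / (1 + r))) by (rewrite G1, F1 by lra; apply Pr).
  assert (E2 : g (T1 + T2) = (xcoord s, / (1 + s))) by (rewrite G2, F2 by lra; apply Ps).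
  exists g, T1, T2. split; [exact HT1|]. split; [exact HT2|]. split; [exact Pg|].
  split; [exact Tr|].
  assert (Ls : on_line (pwsys sd) (xcoord s, / (1 + s))) by (apply line_pt_on; lra).
  assert (Lr : on_line (pwsys sd) (xcoord r, / (1 + r))) by (apply line_pt_on; lra).
  split; [|split; [|split; [exact E0|exact E1]]].
  - constructor; [exact HT1| |now rewrite E0|now rewrite E1].
    intros v Hv. apply (Inn zone1 v 0); simpl; [lra|].
    intros y Hy. rewrite G1 by lra. apply (f_equal (fun v => P zone1 (f zone1 v))). ring.
  - constructor; [lra| |now rewrite E1|now rewrite E2].
    intros v Hv. apply (Inn zone2 v T1); simpl; [lra|].
    intros y Hy. rewrite <- G2 by lra. f_equal. ring.
Qed.

(** * Uniform bounds near the unperturbed system *)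

Lemma limit_cycle sd z s r eta :
  folded sd z -> -(1/4) < s -> r < 1/4 -> (forall i, s < z i < r) ->
  (forall i, Hline (zsign i) (sd i) s = Hline (zsign i) (sd i) r) ->
  (forall i t, s <= t <= r -> 0 < inv_y (zsign i) (sd i) (Hline (zsign i) (sd i) s) t) ->
  0 < eta ->
  (forall s' r', -(1/4) < s' -> s' < r' -> r' < 1/4 -> Rabs (r' - r) < eta ->
     (forall i, Hline (zsign i) (sd i) s' = Hline (zsign i) (sd i) r') -> r' = r) ->
  exists g, crossing_limit_cycle (pwsys sd) g /\
    forall q, orbit g q <-> exists i, half_cycle sd s r i q.
Proof.
  intros G Hs Hr Hz Hsr Hw He Iso.
  destruct (periodic_orbit sd z s r G Hs Hr Hz Hsr Hw)
    as [g [T1 [T2 [H1 [H2 [P [Tr [A1 [A2 [E0 E1]]]]]]]]]].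
  assert (HT : 0 < T1 + T2) by lra.
  assert (Es : t_at g 0 = s) by (unfold t_at; rewrite E0; apply tcoord_xcoord; lra).
  assert (sr : s < r) by (specialize (Hz zone1); lra).
  assert (Er : t_at g T1 = r) by (unfold t_at; rewrite E1; apply tcoord_xcoord; lra).
  assert (Ec : t_at g (T1 + T2) = s).
  { rewrite <- Es. unfold t_at. do 2 f_equal. rewrite <- (P 0). f_equal. ring. }
  exists g. split; [split; [|split]|].
  - split; [apply Tr|]. split; [now exists (T1 + T2)|]. exists T1.
    intros E. assert (t_at g T1 = t_at g 0) by (unfold t_at; now rewrite E). lra.
  - intros [|].
    + exists (T1 / 2). apply A1. lra.
    + exists (T1 + T2 / 2). apply A2. lra.
  - eapply (isolated_by_return sd z g (T1 + T2) 0 T1 (T1 + T2) s r eta); eassumption.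
  - eapply (cycle_orbit sd z g (T1 + T2) 0 T1 (T1 + T2) s r); eassumption.
Qed.

Lemma half_cycle_point sd s r i q : half_cycle sd s r i q ->
  / snd q = inv_y (zsign i) (sd i) (Hline (zsign i) (sd i) s) (tcoord (fst q)).
Proof.
  intros [[Hx [Ht Hy]] [_ [_ E]]]. rewrite <- E. unfold inv_y, first_int.
  assert (P := Phi_pos (sd i) (tcoord (fst q))).
  replace (- zsign i * (- zsign i * Phi (sd i) (tcoord (fst q)) / snd q
     + sf (sd i) * Psi (sd i) (tcoord (fst q)) - sf (sd i) * Psi (sd i) (tcoord (fst q)))
     / Phi (sd i) (tcoord (fst q))) with ((zsign i * zsign i) * / snd q) by (field; lra).
  rewrite zsign_sq. ring.
Qed.

Lemma inv_y_gap k s C t : k * k = 1 ->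
  inv_y k s C t - (1 + t) = - k * (C - Hline k s t) / Phi s t.
Proof.
  intros Hk. unfold inv_y, Hline. assert (P := Phi_pos s t).
  replace (1 + t) with ((k * k) * (1 + t)) at 1 by (rewrite Hk; ring).
  field. lra.
Qed.

(** The exponents are chosen such that H_1 = S and H_2 = S + 3/S - 4 with
    S = sqrt (4 - t^2). *)
Definition base_sides (i : zone) : side :=
  match i with zone1 => Side 2 (1/2) (-1) 0 | zone2 => Side 2 (-1/2) 1 8 end.

Definition box (sd : zone -> side) : Prop := forall i,
  Rabs (sL (sd i) - sL (base_sides i)) <= 1/50 /\ Rabs (sal (sd i) - sal (base_sides i)) <= 1/50 /\
  Rabs (sga (sd i) - sga (base_sides i)) <= 1/50 /\ Rabs (sf (sd i) - sf (base_sides i)) <= 1/50.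

Lemma box_base_sides : box base_sides.
Proof. intros i. rewrite !Rminus_diag, !Rabs_R0. lra. Qed.

Lemma Rabs_le_inv x a : Rabs x <= a -> - a <= x <= a.
Proof. intros H. apply Rabs_le_between. exact H. Qed.

Lemma box_N sd i t u : box sd -> -(1/4) <= t -> t < u -> u <= 1/4 ->
  fold_poly (zsign i) (sd i) u < fold_poly (zsign i) (sd i) t.
Proof.
  intros B Ht tu Hu. destruct (B i) as [B1 [B2 [B3 _]]].
  apply Rabs_le_inv in B1, B2, B3.
  set (L := sL (sd i)) in *. set (a := sal (sd i)) in *. set (c := sga (sd i)) in *.
  assert (E : fold_poly (zsign i) (sd i) t - fold_poly (zsign i) (sd i) u
    = (u - t) * (zsign i * (L - 2 - (t + u) + a * (L + 2) + c * (1 + L)))).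
  { unfold fold_poly. fold L a c. ring. }
  assert (0 < zsign i * (L - 2 - (t + u) + a * (L + 2) + c * (1 + L))); [|nra].
  destruct i; simpl in *.
  - assert (a * (L + 2) <= (26/50) * (201/50)) by (apply Rmult_le_compat; lra).
    assert ((49/50) * (149/50) <= (- c) * (1 + L)) by (apply Rmult_le_compat; lra). lra.
  - assert ((- a) * (L + 2) <= (26/50) * (201/50)) by (apply Rmult_le_compat; lra).
    assert ((49/50) * (149/50) <= c * (1 + L)) by (apply Rmult_le_compat; lra). lra.
Qed.

Lemma folded_of_box sd tau : box sd -> 0 < tau < 1/4 ->
  (forall i, fold_poly (zsign i) (sd i) tau < 0 < fold_poly (zsign i) (sd i) (- tau)) ->
  exists z, folded sd z /\ forall i, - tau < z i < tau.
Proof.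
  intros B Ht HN.
  assert (X : forall i, exists z, - tau < z < tau /\ fold_poly (zsign i) (sd i) z = 0).
  { intros i. destruct (HN i) as [N1 N2].
    destruct (IVT_interv (fun t => - fold_poly (zsign i) (sd i) t) (- tau) tau) as [z [Hz E]];
      [|lra|lra|lra|].
    - intros a _. apply continuity_pt_filterlim.
      apply (ex_derive_continuous (fun t => - fold_poly (zsign i) (sd i) t)).
      unfold fold_poly. auto_derive. exact I.
    - exists z. split; [|lra]. split.
      + destruct (Req_dec z (- tau)) as [->|]; lra.
      + destruct (Req_dec z tau) as [->|]; lra. }
  destruct (X zone1) as [z1 [Hz1 E1]]. destruct (X zone2) as [z2 [Hz2 E2]].
  exists (fun i => match i with zone1 => z1 | zone2 => z2 end). split; [|now intros [|]].
  intros i. split; [|split; [|split]].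
  - destruct (B i) as [B1 _]. apply Rabs_le_inv in B1. destruct i; simpl in *; lra.
  - destruct i; lra.
  - now destruct i.
  - intros t u. now apply box_N.
Qed.

Lemma ln_bounds x : 1/2 <= x -> Rabs (ln x) <= x + 1.
Proof.
  intros Hx. assert (U : ln x <= x - 1).
  { assert (Y := exp_ineq1_le (x - 1)). rewrite <- (ln_exp (x - 1)).
    destruct (Rle_lt_or_eq_dec x (exp (x - 1))) as [l|e]; [lra| |rewrite <- e; lra].
    apply Rlt_le, ln_increasing; lra. }
  assert (V : ln (/ x) <= / x - 1).
  { assert (P : 0 < / x) by (apply Rinv_0_lt_compat; lra).
    assert (Y := exp_ineq1_le (/ x - 1)). rewrite <- (ln_exp (/ x - 1)).
    destruct (Rle_lt_or_eq_dec (/ x) (exp (/ x - 1))) as [l|e]; [lra| |rewrite <- e; lra].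
    apply Rlt_le, ln_increasing; lra. }
  rewrite ln_Rinv in V by lra.
  assert (/ x <= 2). { replace 2 with (/ (1/2)) by field. apply Rinv_le_contravar; lra. }
  apply Rabs_le. lra.
Qed.

Lemma Phi_bounds sd i t : box sd -> Rabs t <= 1/4 ->
  exp (-10) <= Phi (sd i) t <= exp 10.
Proof.
  intros B Ht. apply Rabs_le_inv in Ht. destruct (B i) as [B1 [B2 [B3 _]]].
  assert (Ha : Rabs (sal (sd i)) <= 1).
  { apply Rabs_le_inv in B2. apply Rabs_le. destruct i; simpl in B2; lra. }
  assert (Hc : Rabs (sga (sd i)) <= 51/50).
  { apply Rabs_le_inv in B3. apply Rabs_le. destruct i; simpl in B3; lra. }
  assert (Hac : Rabs (sal (sd i) + sga (sd i)) <= 1).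
  { apply Rabs_le_inv in B2, B3. apply Rabs_le. destruct i; simpl in B2, B3; lra. }
  apply Rabs_le_inv in B1.
  assert (HL : sL (base_sides i) = 2) by now destruct i. rewrite HL in B1.
  unfold Phi.
  assert (X : Rabs (sal (sd i) * ln (2 + t) - (sal (sd i) + sga (sd i)) * ln (sL (sd i) - t)
     + sga (sd i) * ln (1 + t)) <= 10).
  { eapply Rle_trans; [apply Rabs_triang|].
    assert (T1 : Rabs (sal (sd i) * ln (2 + t)) <= 1 * (13/4)).
    { rewrite Rabs_mult. apply Rmult_le_compat; try apply Rabs_pos; [exact Ha|].
      eapply Rle_trans; [apply ln_bounds; lra|lra]. }
    assert (T2 : Rabs ((sal (sd i) + sga (sd i)) * ln (sL (sd i) - t)) <= 1 * (164/50)).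
    { rewrite Rabs_mult. apply Rmult_le_compat; try apply Rabs_pos; [exact Hac|].
      eapply Rle_trans; [apply ln_bounds; lra|lra]. }
    assert (T3 : Rabs (sga (sd i) * ln (1 + t)) <= (51/50) * (9/4)).
    { rewrite Rabs_mult. apply Rmult_le_compat; try apply Rabs_pos; [exact Hc|].
      eapply Rle_trans; [apply ln_bounds; lra|lra]. }
    assert (T4 := Rabs_triang (sal (sd i) * ln (2 + t))
                    (- ((sal (sd i) + sga (sd i)) * ln (sL (sd i) - t)))).
    rewrite Rabs_Ropp in T4. unfold Rminus in *. lra. }
  apply Rabs_le_inv in X.
  set (e := sal (sd i) * _ - _ + _) in *. clearbody e.
  split; (destruct (Req_dec e 10) as [->|n1]; [|destruct (Req_dec e (-10)) as [->|n2]]);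
    try lra; try (apply Rlt_le, exp_increasing; lra).
Qed.

Lemma fold_poly_bound sd i t : box sd -> Rabs t <= 1/4 -> Rabs (fold_poly (zsign i) (sd i) t) <= 40.
Proof.
  intros B Ht. apply Rabs_le_inv in Ht. destruct (B i) as [B1 [B2 [B3 B4]]].
  apply Rabs_le_inv in B1, B2, B3, B4. unfold fold_poly.
  set (L := sL (sd i)) in *. set (a := sal (sd i)) in *. set (c := sga (sd i)) in *.
  set (f := sf (sd i)) in *.
  assert (X1 : 0 <= (2 + t) * (L - t) <= 3 * 3) by (destruct i; simpl in *; split; nra).
  assert (X2 : 0 <= (L + 2) * (1 + t) <= 5 * (5/4)) by (destruct i; simpl in *; split; nra).
  assert (X3 : 0 <= (1 + L) * (2 + t) <= 4 * (9/4)) by (destruct i; simpl in *; split; nra).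
  set (p := (2 + t) * (L - t)) in *.
  replace (a * (L + 2) * (1 + t)) with (a * ((L + 2) * (1 + t))) by ring.
  replace (c * (1 + L) * (2 + t)) with (c * ((1 + L) * (2 + t))) by ring.
  set (u := (L + 2) * (1 + t)) in *. set (v := (1 + L) * (2 + t)) in *.
  apply Rabs_le. destruct i; simpl in *; split; nra.
Qed.

Lemma Hline_lipschitz sd i t u : box sd -> Rabs t <= 1/4 -> Rabs u <= 1/4 ->
  Rabs (Hline (zsign i) (sd i) t - Hline (zsign i) (sd i) u) <= 40 * exp 10 * Rabs (t - u).
Proof.
  intros B. revert t u.
  assert (HL : 149/50 <= sL (sd i) + 1).
  { destruct (B i) as [B1 _]. apply Rabs_le_inv in B1. destruct i; simpl in *; lra. }
  assert (K : forall t u, Rabs t <= 1/4 -> Rabs u <= 1/4 -> t < u ->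
    Rabs (Hline (zsign i) (sd i) u - Hline (zsign i) (sd i) t) <= 40 * exp 10 * (u - t)).
  { intros t u Ht Hu tu. assert (Ht' := Rabs_le_inv _ _ Ht). assert (Hu' := Rabs_le_inv _ _ Hu).
    destruct (mean_value (Hline (zsign i) (sd i))
      (fun t => psi (sd i) t * fold_poly (zsign i) (sd i) t) t u tu) as [c [Hc E]].
    - intros x Hx. apply is_derive_Hline; [apply zsign_sq|lra|lra].
    - intros x Hx. eapply derive_continuous, is_derive_Hline; [apply zsign_sq|lra|lra].
    - rewrite E, Rabs_mult, (Rabs_pos_eq (u - t)) by lra.
      apply Rmult_le_compat_r; [lra|].
      assert (Hc' : Rabs c <= 1/4) by (apply Rabs_le; lra).
      rewrite Rabs_mult, Rmult_comm. apply Rmult_le_compat; try apply Rabs_pos.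
      + now apply fold_poly_bound.
      + destruct (Phi_bounds sd i c B Hc') as [_ P]. assert (P0 := Phi_pos (sd i) c).
        unfold psi. rewrite Rabs_pos_eq.
        * eapply Rle_trans; [|exact P].
          assert (D : 1 <= (2 + c) * (sL (sd i) - c)) by nra.
          apply (Rmult_le_reg_r ((2 + c) * (sL (sd i) - c))); [lra|].
          unfold Rdiv. rewrite Rmult_assoc, Rinv_l by lra. nra.
        * apply Rlt_le, Rdiv_lt_0_compat; [exact P0|]. nra. }
  intros t u Ht Hu. destruct (Rtotal_order t u) as [l|[->|l]].
  - rewrite Rabs_minus_sym. rewrite (Rabs_minus_sym t u), (Rabs_pos_eq (u - t)) by lra. now apply K.
  - rewrite !Rminus_diag, Rabs_R0. lra.
  - rewrite (Rabs_pos_eq (t - u)) by lra. now apply K.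
Qed.

(** The constant does not depend on the parameters: it keeps y positive and the
    cycles close to (2, 1) after the perturbation has been chosen. *)
Lemma inv_y_near sd i s t : box sd -> Rabs s <= 1/4 -> Rabs t <= 1/4 ->
  Rabs (inv_y (zsign i) (sd i) (Hline (zsign i) (sd i) s) t - (1 + t)) <= 40 * exp 20 * Rabs (s - t).
Proof.
  intros B Hs Ht. rewrite inv_y_gap by apply zsign_sq.
  unfold Rdiv. rewrite !Rabs_mult.
  assert (E : Rabs (- zsign i) = 1).
  { destruct i; simpl.
    - rewrite Rabs_pos_eq; lra.
    - rewrite Rabs_Ropp. apply Rabs_R1. }
  rewrite E, Rmult_1_l.
  assert (X := Hline_lipschitz sd i s t B Hs Ht).
  destruct (Phi_bounds sd i t B Ht) as [P _].
  assert (I1 : / Phi (sd i) t <= exp 10).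
  { replace (exp 10) with (/ exp (-10)) by (rewrite <- exp_Ropp; f_equal; ring).
    apply Rinv_le_contravar; [apply exp_pos|exact P]. }
  assert (I0 : 0 < / Phi (sd i) t) by apply Rinv_0_lt_compat, Phi_pos.
  rewrite (Rabs_pos_eq (/ _)) by lra.
  replace (40 * exp 20 * Rabs (s - t)) with ((40 * exp 10 * Rabs (s - t)) * exp 10).
  - apply Rmult_le_compat; try lra. apply Rabs_pos.
  - replace (exp 20) with (exp 10 * exp 10) by (rewrite <- exp_plus; f_equal; ring). ring.
Qed.

(** * Dependence of the levels on the parameters *)

Definition perturb (s d : side) (e : R) : side :=
  Side (sL s + e * sL d) (sal s + e * sal d) (sga s + e * sga d) (sf s + e * sf d).

(** Derivative of ln Phi in the direction d. *)
Definition dlnphi (s d : side) (e t : R) : R :=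
  sal d * ln (2 + t) - (sal d + sga d) * ln (sL s + e * sL d - t)
  - (sal s + e * sal d + (sga s + e * sga d)) * sL d / (sL s + e * sL d - t) + sga d * ln (1 + t).

Definition dlnpsi (s d : side) (e t : R) : R :=
  dlnphi s d e t - sL d / (sL s + e * sL d - t).

Lemma derive_Phi_perturb s d e t : 1 < sL s + e * sL d -> -1 < t < 1 ->
  is_derive (fun e => Phi (perturb s d e) t) e (Phi (perturb s d e) t * dlnphi s d e t).
Proof.
  intros HL Ht. unfold Phi, dlnphi; simpl. auto_derive; [repeat split; lra|].
  rewrite Rmult_comm. unfold Rminus. f_equal. field. lra.
Qed.

Lemma derive_psi_perturb s d e t : 1 < sL s + e * sL d -> -1 < t < 1 ->
  is_derive (fun e => psi (perturb s d e) t) e (psi (perturb s d e) t * dlnpsi s d e t).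
Proof.
  intros HL Ht. unfold psi. simpl.
  assert (D := derive_Phi_perturb s d e t HL Ht).
  set (F := fun e => Phi (perturb s d e) t) in *.
  apply (is_derive_ext (fun e => F e / ((2 + t) * (sL s + e * sL d - t)))); [reflexivity|].
  auto_derive.
  - split; [eexists; exact D|]. split; [|exact I]. apply Rgt_not_eq, Rmult_lt_0_compat; lra.
  - change (is_derive F e (F e * dlnphi s d e t)) in D. use_derive D.
    unfold dlnpsi. change (Phi (perturb s d e) t) with (F e). field. split; lra.
Qed.

Ltac cont2d :=
  unfold Rminus, Rdiv;
  repeat first
    [ apply continuity_2d_pt_const | apply continuity_2d_pt_id1 | apply continuity_2d_pt_id2
    | apply continuity_2d_pt_plus | apply continuity_2d_pt_opp | apply continuity_2d_pt_mult
    | apply continuity_2d_pt_inv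
    | apply (continuity_1d_2d_pt_comp exp); [apply derivable_continuous_pt, derivable_pt_exp|]
    | apply (continuity_1d_2d_pt_comp ln) ].

Lemma continuity_pt_ln x : 0 < x -> continuity_pt ln x.
Proof. intros Hx. apply derivable_continuous_pt. exists (/ x). now apply derivable_pt_lim_ln. Qed.

Lemma continuous2_Phi s d t : 1 < sL s -> -1 < t < 1 ->
  continuity_2d_pt (fun e t => Phi (perturb s d e) t) 0 t.
Proof.
  intros HL Ht. unfold Phi; simpl. cont2d; apply continuity_pt_ln; lra.
Qed.

Lemma continuous2_psi s d t : 1 < sL s -> -1 < t < 1 ->
  continuity_2d_pt (fun e t => psi (perturb s d e) t) 0 t.
Proof.
  intros HL Ht. unfold psi; simpl. apply continuity_2d_pt_mult; [now apply continuous2_Phi|].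
  cont2d. apply Rgt_not_eq, Rmult_lt_0_compat; lra.
Qed.

Lemma continuous2_dlnpsi s d t : 1 < sL s -> -1 < t < 1 ->
  continuity_2d_pt (dlnpsi s d) 0 t.
Proof.
  intros HL Ht. unfold dlnpsi, dlnphi.
  cont2d; try (apply continuity_pt_ln; lra); lra.
Qed.

Lemma near_L s d : 1 < sL s -> exists e0 : posreal, forall e, Rabs e < e0 -> 1 < sL s + e * sL d.
Proof.
  intros HL. assert (C : continuous (fun e => sL s + e * sL d) 0).
  { apply (ex_derive_continuous (fun e => sL s + e * sL d)). auto_derive. exact I. }
  destruct (C (fun y => 1 < y)) as [e0 He]; [apply open_gt; lra|].
  exists e0. intros e Hb. apply He. change (Rabs (e - 0) < e0). now rewrite Rminus_0_r.
Qed.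

Lemma derive_Psi_perturb s d t : 1 < sL s -> -1 < t < 1 ->
  is_derive (fun e => Psi (perturb s d e) t) 0 (RInt (fun u => psi s u * dlnpsi s d 0 u) 0 t).
Proof.
  intros HL Ht. destruct (near_L s d HL) as [e0 He0].
  assert (P0 : perturb s d 0 = s) by (unfold perturb; destruct s; simpl; f_equal; ring).
  assert (Bt : forall u, Rmin 0 t <= u <= Rmax 0 t -> -1 < u < 1).
  { intros u. unfold Rmin, Rmax. destruct (Rle_dec 0 t); lra. }
  evar_last.
  - apply (is_derive_RInt_param (fun e u => psi (perturb s d e) u) 0 t 0).
    + exists e0. intros e Hb u Hu. change (Rabs (e - 0) < e0) in Hb. rewrite Rminus_0_r in Hb.
      eexists. apply derive_psi_perturb; [now apply He0|now apply Bt].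
    + intros u Hu. assert (Hu1 := Bt u Hu).
      apply (continuity_2d_pt_ext_loc (fun e u => psi (perturb s d e) u * dlnpsi s d e u)).
      * assert (Hm : 0 < Rmin e0 (Rmin (u + 1) (1 - u))).
        { apply Rmin_glb_lt; [apply cond_pos|apply Rmin_glb_lt; lra]. }
        exists (mkposreal _ Hm). simpl. intros e v He Hv. symmetry.
        pose proof (Rmin_l e0 (Rmin (u + 1) (1 - u))).
        pose proof (Rmin_r e0 (Rmin (u + 1) (1 - u))).
        pose proof (Rmin_l (u + 1) (1 - u)). pose proof (Rmin_r (u + 1) (1 - u)).
        rewrite Rminus_0_r in He. apply Rabs_def2 in Hv.
        apply is_derive_unique, derive_psi_perturb; [apply He0; lra|lra].
      * apply continuity_2d_pt_mult; [now apply continuous2_psi|now apply continuous2_dlnpsi].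
    + exists e0. intros e Hb. change (Rabs (e - 0) < e0) in Hb. rewrite Rminus_0_r in Hb.
      apply ex_RInt_psi; [now apply He0|lra|exact Ht].
  - apply RInt_ext. intros u Hu. assert (D : is_derive (fun e => psi (perturb s d e) u) 0
      (psi (perturb s d 0) u * dlnpsi s d 0 u)).
    { apply derive_psi_perturb; [now rewrite Rmult_0_l, Rplus_0_r|]. apply Bt. lra. }
    rewrite P0 in D. now apply is_derive_unique.
Qed.

Definition first_var (k : R) (s d : side) (t : R) : R :=
  - k * (1 + t) * Phi s t * dlnphi s d 0 t + sf d * Psi s t
  + sf s * RInt (fun u => psi s u * dlnpsi s d 0 u) 0 t.

Lemma perturb_0 s d : perturb s d 0 = s.
Proof. unfold perturb; destruct s; simpl; f_equal; ring. Qed.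

Lemma derive_Hline_perturb k s d t : 1 < sL s -> -1 < t < 1 ->
  is_derive (fun e => Hline k (perturb s d e) t) 0 (first_var k s d t).
Proof.
  intros HL Ht. unfold Hline; simpl.
  assert (D1 : is_derive (fun e => Phi (perturb s d e) t) 0 (Phi s t * dlnphi s d 0 t)).
  { assert (D := derive_Phi_perturb s d 0 t). rewrite perturb_0 in D. apply D; [lra|exact Ht]. }
  assert (D2 := derive_Psi_perturb s d t HL Ht).
  assert (E1 : Phi (perturb s d 0) t = Phi s t) by now rewrite perturb_0.
  assert (E2 : Psi (perturb s d 0) t = Psi s t) by now rewrite perturb_0.
  set (F := fun e => Phi (perturb s d e) t) in *. set (G := fun e => Psi (perturb s d e) t) in *.
  apply (is_derive_ext (fun e => - k * (1 + t) * F e + (sf s + e * sf d) * G e)); [reflexivity|].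
  auto_derive.
  - split; [eexists; exact D1|]. split; [eexists; exact D2|exact I].
  - replace (Derive (fun x : R => F x) 0) with (Phi s t * dlnphi s d 0 t)
      by (symmetry; apply is_derive_unique, D1).
    replace (Derive (fun x : R => G x) 0) with (RInt (fun u => psi s u * dlnpsi s d 0 u) 0 t)
      by (symmetry; apply is_derive_unique, D2).
    change (G 0) with (Psi (perturb s d 0) t). rewrite E2. unfold first_var. ring.
Qed.

(** The displaced argument serves to compare levels at a point of the line that
    moves together with the parameters. *)
Lemma derive_Hline_moving k s d t v : k * k = 1 -> 1 < sL s -> -1 < t < 1 ->
  is_derive (fun e => Hline k (perturb s d e) (t + e * v)) 0 (first_var k s d t + v * (psi s t * fold_poly k s t)).
Proof.
  intros Hk HL Ht. destruct (near_L s d HL) as [e0 He0].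
  set (G := fun u e => Hline k (perturb s d e) u).
  assert (Hm : 0 < Rmin e0 (Rmin (t + 1) (1 - t))).
  { apply Rmin_glb_lt; [apply cond_pos|apply Rmin_glb_lt; lra]. }
  assert (Dt : forall u e, Rabs (u - t) < mkposreal _ Hm -> Rabs (e - 0) < mkposreal _ Hm ->
     is_derive (fun z => G z e) u (psi (perturb s d e) u * fold_poly k (perturb s d e) u)).
  { simpl. intros u e Hu He.
    pose proof (Rmin_l e0 (Rmin (t + 1) (1 - t))). pose proof (Rmin_r e0 (Rmin (t + 1) (1 - t))).
    pose proof (Rmin_l (t + 1) (1 - t)). pose proof (Rmin_r (t + 1) (1 - t)).
    rewrite Rminus_0_r in He. apply Rabs_def2 in Hu.
    apply is_derive_Hline; [exact Hk|apply He0; lra|lra]. }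
  assert (DL : differentiable_pt_lim G t 0 (psi s t * fold_poly k s t) (first_var k s d t)).
  { apply filterdiff_differentiable_pt_lim.
    apply (filterdiff_ext_lin _ (fun u : R * R => plus
      (scal (fst u) (psi (perturb s d 0) t * fold_poly k (perturb s d 0) t)) (scal (snd u) (first_var k s d t)))).
    2:{ intros u. now rewrite perturb_0. }
    apply (is_derive_filterdiff G t 0 (fun u e => psi (perturb s d e) u * fold_poly k (perturb s d e) u)).
    - apply (locally_2d_locally (fun u e =>
        is_derive (fun z => G z e) u (psi (perturb s d e) u * fold_poly k (perturb s d e) u))).
      exists (mkposreal _ Hm). intros u e Hu He. now apply Dt.
    - now apply derive_Hline_perturb.
    - apply (continuity_2d_pt_filterlim (fun u e => psi (perturb s d e) u * fold_poly k (perturb s d e) u)),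
        continuity_2d_pt_mult.
      + assert (X := continuous2_psi s d t HL Ht).
        intros eps. destruct (X eps) as [dl Hdl]. exists dl. intros u e Hu He. now apply Hdl.
      + unfold fold_poly; simpl. cont2d. }
  assert (Z : t + 0 * v = t) by ring.
  apply is_derive_Reals.
  replace (first_var k s d t + v * (psi s t * fold_poly k s t))
    with (psi s t * fold_poly k s t * v + first_var k s d t * 1) by ring.
  apply (derivable_pt_lim_comp_2d G (fun e => t + e * v) (fun e => e)).
  - now rewrite Z.
  - apply is_derive_Reals. auto_derive; [exact I|ring].
  - apply derivable_pt_lim_id.
Qed.

(** * The unperturbed center and its first variation *)

Definition root4 (t : R) : R := sqrt (4 - t * t).

Lemma root4_pos t : -1 < t < 1 -> 0 < root4 t.
Proof. intros Ht. apply sqrt_lt_R0. nra. Qed.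

Lemma root4_sq t : -1 < t < 1 -> root4 t * root4 t = 4 - t * t.
Proof. intros Ht. apply sqrt_sqrt. nra. Qed.

Lemma root4_opp t : root4 (- t) = root4 t.
Proof. unfold root4. f_equal. ring. Qed.

Lemma root4_ge1 t : -1 < t < 1 -> 1 <= root4 t <= 2.
Proof.
  intros Ht. assert (P := root4_pos t Ht). assert (Q := root4_sq t Ht). split; nra.
Qed.

Lemma derive_root4 t : -1 < t < 1 -> is_derive root4 t (- t / root4 t).
Proof.
  intros Ht. unfold root4. auto_derive; [nra|].
  assert (P := root4_pos t Ht). unfold root4 in P.
  replace (4 + - (t * t)) with (4 - t * t) by ring. field. lra.
Qed.

Lemma sqrt_exp x : 0 < x -> sqrt x = exp (1/2 * ln x).
Proof.
  intros Hx. rewrite <- (Rpower_sqrt x Hx). unfold Rpower. f_equal. field.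
Qed.

Lemma root4_exp t : -1 < t < 1 -> root4 t = exp (1/2 * ln (2 + t) + 1/2 * ln (2 - t)).
Proof.
  intros Ht. unfold root4. replace (4 - t * t) with ((2 + t) * (2 - t)) by ring.
  rewrite sqrt_mult by lra. rewrite !sqrt_exp by lra. now rewrite exp_plus.
Qed.

Lemma exp_sub a b : exp (a - b) = exp a / exp b.
Proof. unfold Rminus. rewrite exp_plus, exp_Ropp. reflexivity. Qed.

Lemma Phi_base_1 t : -1 < t < 1 -> Phi (base_sides zone1) t = root4 t / (1 + t).
Proof.
  intros Ht. rewrite root4_exp by exact Ht. unfold Phi, base_sides; simpl.
  replace (1 + t) with (exp (ln (1 + t))) at 2 by (apply exp_ln; lra).
  rewrite <- exp_sub. f_equal. field.
Qed.

Lemma Phi_base_2 t : -1 < t < 1 -> Phi (base_sides zone2) t = (1 + t) / root4 t.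
Proof.
  intros Ht. rewrite root4_exp by exact Ht. unfold Phi, base_sides; simpl.
  replace (1 + t) with (exp (ln (1 + t))) at 2 by (apply exp_ln; lra).
  rewrite <- exp_sub. f_equal. field.
Qed.

Lemma psi_base_1 t : -1 < t < 1 -> psi (base_sides zone1) t = / ((1 + t) * root4 t).
Proof.
  intros Ht. assert (P := root4_pos t Ht). unfold psi. rewrite Phi_base_1 by exact Ht. simpl.
  replace ((2 + t) * (2 - t)) with (root4 t * root4 t) by (rewrite root4_sq by exact Ht; ring).
  field. split; lra.
Qed.

Lemma psi_base_2 t : -1 < t < 1 -> psi (base_sides zone2) t = (1 + t) / (root4 t * root4 t * root4 t).
Proof.
  intros Ht. assert (P := root4_pos t Ht). unfold psi. rewrite Phi_base_2 by exact Ht. simpl.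
  replace ((2 + t) * (2 - t)) with (root4 t * root4 t) by (rewrite root4_sq by exact Ht; ring).
  field. lra.
Qed.

Lemma Hline_base_derivative_1 t : -1 < t < 1 ->
  psi (base_sides zone1) t * fold_poly (zsign zone1) (base_sides zone1) t = - t / root4 t.
Proof.
  intros Ht. assert (P := root4_pos t Ht). rewrite psi_base_1 by exact Ht. unfold fold_poly; simpl.
  field. lra.
Qed.

Lemma Hline_base_derivative_2 t : -1 < t < 1 ->
  psi (base_sides zone2) t * fold_poly (zsign zone2) (base_sides zone2) t
  = - (t * (1 - t * t)) / (root4 t * root4 t * root4 t).
Proof.
  intros Ht. assert (P := root4_pos t Ht). rewrite psi_base_2 by exact Ht. unfold fold_poly; simpl.
  field. lra.
Qed.

(** The derivatives of both functions are odd. *)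
Lemma Hline_base_even i t : -1 < t < 1 ->
  Hline (zsign i) (base_sides i) (- t) = Hline (zsign i) (base_sides i) t.
Proof.
  intros Ht.
  assert (Odd : forall x, -1 < x < 1 -> psi (base_sides i) (- x) * fold_poly (zsign i) (base_sides i) (- x)
     = - (psi (base_sides i) x * fold_poly (zsign i) (base_sides i) x)).
  { intros x Hx. assert (P := root4_pos x Hx).
    destruct i; rewrite ?Hline_base_derivative_1, ?Hline_base_derivative_2, !root4_opp by lra; field; lra. }
  assert (HL : 1 < sL (base_sides i)) by (destruct i; simpl; lra).
  set (f := fun x => Hline (zsign i) (base_sides i) x - Hline (zsign i) (base_sides i) (- x)).
  assert (D : forall x, -1 < x < 1 -> is_derive f x 0).
  { intros x Hx. unfold f.
    assert (D1 := is_derive_Hline (zsign i) (base_sides i) x (zsign_sq i) HL Hx).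
    assert (Hx' : -1 < - x < 1) by lra.
    assert (D2 := is_derive_Hline (zsign i) (base_sides i) (- x) (zsign_sq i) HL Hx').
    evar_last.
    - apply (is_derive_minus (Hline (zsign i) (base_sides i)) (fun x => Hline (zsign i) (base_sides i) (- x))); [exact D1|].
      apply (is_derive_comp (Hline (zsign i) (base_sides i)) (fun x => - x)); [exact D2|].
      auto_derive; [exact I|reflexivity].
    - unfold scal, minus, plus, opp; simpl; unfold mult; simpl. rewrite (Odd x Hx). ring. }
  assert (E := constant_near_0 f D t Ht).
  unfold f in E. rewrite Ropp_0 in E. lra.
Qed.

Definition direction (c : nat -> R) (i : zone) : side :=
  match i with
  | zone1 => Side (c 0%nat) (c 1%nat) (c 2%nat) (c 3%nat)
  | zone2 => Side 0 (c 4%nat) (c 5%nat) (c 6%nat)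
  end.

Definition lnq2 (t : R) : R := ln (2 + t) - ln (2 - t).
Definition lnq1 (t : R) : R := ln (1 + t) - ln (1 - t).
(** The integral of 1/((1 - u^2) root4 u) from 0 to t. *)
Definition arcI (t : R) : R := (Psi (base_sides zone1) t - Psi (base_sides zone1) (- t)) / 2.
(** Divided by the derivative of Hline at - t, this is the first variation of
    the half-return map at t. *)
Definition level_var (c : nat -> R) (i : zone) (t : R) : R :=
  first_var (zsign i) (base_sides i) (direction c i) t - first_var (zsign i) (base_sides i) (direction c i) (- t).

Lemma derive_lnq2 t : -1 < t < 1 -> is_derive lnq2 t (4 / (4 - t * t)).
Proof. intros Ht. unfold lnq2. auto_derive; [split; [lra|split; [lra|exact I]]|].
  field. repeat split; nra. Qed.

Lemma derive_lnq1 t : -1 < t < 1 -> is_derive lnq1 t (2 / (1 - t * t)).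
Proof. intros Ht. unfold lnq1. auto_derive; [split; [lra|split; [lra|exact I]]|].
  field. repeat split; nra. Qed.

Lemma derive_odd_part (f : R -> R) t a b : is_derive f t a -> is_derive f (- t) b ->
  is_derive (fun t => f t - f (- t)) t (a + b).
Proof.
  intros D1 D2. evar_last.
  - apply (is_derive_minus f (fun x => f (- x))); [exact D1|].
    apply (is_derive_comp f (fun x => - x)); [exact D2|].
    auto_derive; [exact I|reflexivity].
  - unfold scal, minus, plus, opp; simpl; unfold mult; simpl. ring.
Qed.

Lemma derive_arcI t : -1 < t < 1 -> is_derive arcI t (/ ((1 - t * t) * root4 t)).
Proof.
  intros Ht. assert (P := root4_pos t Ht).
  assert (D : is_derive (fun t => Psi (base_sides zone1) t - Psi (base_sides zone1) (- t)) t
     (psi (base_sides zone1) t + psi (base_sides zone1) (- t))).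
  { apply derive_odd_part; apply is_derive_Psi; simpl; lra. }
  unfold arcI. apply (is_derive_ext (fun t => / 2 * (Psi (base_sides zone1) t - Psi (base_sides zone1) (- t)))).
  { intros x. apply Rmult_comm. }
  evar_last; [apply is_derive_scal, D|].
  rewrite !psi_base_1, root4_opp by lra. field. repeat split; nra.
Qed.

Lemma level_var_1 c t : -1 < t < 1 ->
  level_var c zone1 t = root4 t * ((2 * c 1%nat + c 2%nat) * lnq2 t + c 2%nat * lnq1 t)
    + c 0%nat * t / root4 t + 2 * c 3%nat * arcI t.
Proof.
  intros Ht. assert (P := root4_pos t Ht). unfold level_var, first_var. rewrite !Phi_base_1, root4_opp by lra.
  unfold dlnphi; simpl. unfold lnq2, lnq1, arcI.
  replace (2 + 0 * c 0%nat - t) with (2 - t) by ring.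
  replace (2 + 0 * c 0%nat - - t) with (2 + t) by ring.
  replace (2 + - t) with (2 - t) by ring. replace (1 + - t) with (1 - t) by ring.
  replace (c 0%nat * t / root4 t) with (root4 t * (c 0%nat * t / (root4 t * root4 t))) by (field; lra).
  rewrite root4_sq by exact Ht. simpl.
  field. repeat split; nra.
Qed.

Lemma Psi0_2_odd t : -1 < t < 1 ->
  Psi (base_sides zone2) t - Psi (base_sides zone2) (- t) = t / (2 * root4 t).
Proof.
  intros Ht.
  set (f := fun t => (Psi (base_sides zone2) t - Psi (base_sides zone2) (- t)) - t / (2 * root4 t)).
  assert (D : forall x, -1 < x < 1 -> is_derive f x 0).
  { intros x Hx. assert (P := root4_pos x Hx).
    assert (D : is_derive (fun t => Psi (base_sides zone2) t - Psi (base_sides zone2) (- t)) x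
       (psi (base_sides zone2) x + psi (base_sides zone2) (- x))).
    { apply derive_odd_part; apply is_derive_Psi; simpl; lra. }
    assert (D2 : is_derive (fun t => t / (2 * root4 t)) x (2 / (root4 x * root4 x * root4 x))).
    { assert (DS := derive_root4 x Hx). auto_derive.
      - split; [eexists; exact DS|]. split; [lra|exact I].
      - use_derive DS.
        assert (Q := root4_sq x Hx).
        apply (Rmult_eq_reg_r (root4 x * root4 x * root4 x)); [|nra].
        field_simplify; lra. }
    unfold f. evar_last; [apply (is_derive_minus _ _ _ _ _ D D2)|].
    rewrite !psi_base_2, root4_opp by lra. unfold minus, plus, opp; simpl. field. lra. }
  assert (E := constant_near_0 f D t Ht).
  unfold f in E. rewrite Ropp_0 in E. lra.
Qed.

(** The integral of psi times the logarithms in dlnpsi reduces, by parts, to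
    logarithms and to arcI; the identity is checked on derivatives. *)
Lemma level_var_2 c t : -1 < t < 1 ->
  level_var c zone2 t = c 6%nat * t / (2 * root4 t)
    - 2 * c 4%nat * ((t * t - 7) * lnq2 t + 8 * t) / root4 t
    - c 5%nat * (((t * t - 7) * (lnq1 t + lnq2 t) + 12 * t) / root4 t + 12 * arcI t).
Proof.
  intros Ht.
  set (p := fun t => c 4%nat * ln (2 + t) - (c 4%nat + c 5%nat) * ln (2 - t) + c 5%nat * ln (1 + t)).
  set (W := fun t => RInt (fun u => psi (base_sides zone2) u * p u) 0 t).
  assert (Wc : forall x, -1 < x < 1 -> continuous (fun u => psi (base_sides zone2) u * p u) x).
  { intros x Hx. apply (continuous_mult (psi (base_sides zone2)) p).
    - apply continuous_psi; simpl; lra.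
    - apply (ex_derive_continuous p). unfold p. auto_derive. repeat split; lra. }
  assert (WD : forall x, -1 < x < 1 -> is_derive W x (psi (base_sides zone2) x * p x)).
  { intros x Hx. apply (is_derive_RInt (fun u => psi (base_sides zone2) u * p u) W 0); [|now apply Wc].
    assert (Hm : 0 < Rmin (x + 1) (1 - x)) by (apply Rmin_glb_lt; lra).
    exists (mkposreal _ Hm). intros y Hy. apply (RInt_correct (fun u => psi (base_sides zone2) u * p u)).
    change (Rabs (y - x) < Rmin (x + 1) (1 - x)) in Hy.
    pose proof (Rmin_l (x + 1) (1 - x)). pose proof (Rmin_r (x + 1) (1 - x)).
    apply Rabs_def2 in Hy.
    apply (ex_RInt_continuous (V := R_CompleteNormedModule)). intros v Hv. apply Wc.
    revert Hv. unfold Rmin, Rmax. destruct (Rle_dec 0 y); lra. }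
  assert (V : forall x, -1 < x < 1 -> first_var (zsign zone2) (base_sides zone2) (direction c zone2) x
     = - (1 + x) * (1 + x) / root4 x * p x + c 6%nat * Psi (base_sides zone2) x + 8 * W x).
  { intros x Hx. unfold first_var. rewrite Phi_base_2 by exact Hx.
    assert (Ep : forall u, dlnphi (base_sides zone2) (direction c zone2) 0 u = p u).
    { intros u. unfold dlnphi, p; simpl.
      replace (2 + 0 * 0 - u) with (2 - u) by ring. unfold Rdiv. ring. }
    assert (Eq : RInt (fun u => psi (base_sides zone2) u * dlnpsi (base_sides zone2) (direction c zone2) 0 u) 0 x = W x).
    { apply RInt_ext. intros u _. unfold dlnpsi. rewrite Ep. simpl. unfold Rdiv. ring. }
    rewrite Ep, Eq. simpl. unfold Rdiv. ring. }
  assert (DV : forall x, -1 < x < 1 -> is_derive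
     (fun x => - (1 + x) * (1 + x) / root4 x * p x + 8 * W x) x
     ((- 2 * (1 + x) / root4 x - (1 + x) * (1 + x) * x / (root4 x * root4 x * root4 x)) * p x
       - (1 + x) * (1 + x) / root4 x * (c 4%nat / (2 + x) + (c 4%nat + c 5%nat) / (2 - x) + c 5%nat / (1 + x))
       + 8 * (psi (base_sides zone2) x * p x))).
  { intros x Hx. assert (P := root4_pos x Hx). assert (DS := derive_root4 x Hx). assert (DW := WD x Hx).
    assert (Dp : is_derive p x (c 4%nat / (2 + x) + (c 4%nat + c 5%nat) / (2 - x) + c 5%nat / (1 + x))).
    { unfold p. auto_derive; [repeat split; lra|]. field. repeat split; lra. }
    auto_derive.
    - split; [eexists; exact DS|]. split; [lra|]. split; [eexists; exact Dp|].
      split; [eexists; exact DW|exact I].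
    - use_derive DS. use_derive Dp. use_derive DW.
      field. repeat split; lra. }
  set (f := fun t => (- (1 + t) * (1 + t) / root4 t * p t + 8 * W t)).
  set (k := fun t => - 2 * c 4%nat * ((t * t - 7) * lnq2 t + 8 * t) / root4 t
    - c 5%nat * (((t * t - 7) * (lnq1 t + lnq2 t) + 12 * t) / root4 t + 12 * arcI t)).
  assert (D : forall x, -1 < x < 1 -> is_derive (fun t => (f t - f (- t)) - k t) x 0).
  { intros x Hx. assert (P := root4_pos x Hx). assert (Q := root4_sq x Hx).
    assert (Hx' : -1 < - x < 1) by lra.
    assert (D1 := derive_odd_part f x _ _ (DV x Hx) (DV (- x) Hx')).
    assert (Ep : p x - p (- x) = (2 * c 4%nat + c 5%nat) * lnq2 x + c 5%nat * lnq1 x).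
    { unfold p, lnq2, lnq1. replace (2 - - x) with (2 + x) by ring.
      replace (2 + - x) with (2 - x) by ring. replace (1 + - x) with (1 - x) by ring. ring. }
    assert (D2 : is_derive k x (
       - 2 * c 4%nat * ((2 * x * lnq2 x + (x * x - 7) * (4 / (4 - x * x)) + 8) / root4 x
            + ((x * x - 7) * lnq2 x + 8 * x) * x / (root4 x * root4 x * root4 x))
       - c 5%nat * ((2 * x * (lnq1 x + lnq2 x) + (x * x - 7) * (2 / (1 - x * x) + 4 / (4 - x * x)) + 12) / root4 x
            + ((x * x - 7) * (lnq1 x + lnq2 x) + 12 * x) * x / (root4 x * root4 x * root4 x)
            + 12 / ((1 - x * x) * root4 x)))).
    { assert (DS := derive_root4 x Hx). assert (DA := derive_arcI x Hx).
      assert (DLa := derive_lnq2 x Hx). assert (DL1 := derive_lnq1 x Hx).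
      unfold k. auto_derive.
      - repeat match goal with |- _ /\ _ => split | |- True => exact I end;
          try lra; eexists; eassumption.
      - use_derive DS. use_derive DA. use_derive DLa. use_derive DL1.
        field. repeat split; nra. }
    evar_last; [apply (is_derive_minus _ _ _ _ _ D1 D2)|].
    unfold minus, plus, opp; simpl. rewrite !psi_base_2, root4_opp by lra.
    replace (p x) with (p (- x) + ((2 * c 4%nat + c 5%nat) * lnq2 x + c 5%nat * lnq1 x)) by lra.
    set (y := p (- x)). clearbody y.
    apply (Rmult_eq_reg_r (root4 x * root4 x * root4 x)); [|nra].
    rewrite Rmult_0_l.
    match goal with |- ?a = 0 =>
      replace a with
       (let q := root4 x * root4 x in
        (- 2 * (1 + x) * q - (1 + x) * (1 + x) * x) * (y + ((2 * c 4%nat + c 5%nat) * lnq2 x + c 5%nat * lnq1 x))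
       - (1 + x) * (1 + x) * q * (c 4%nat / (2 + x) + (c 4%nat + c 5%nat) / (2 - x) + c 5%nat / (1 + x))
       + 8 * ((1 + x) * (y + ((2 * c 4%nat + c 5%nat) * lnq2 x + c 5%nat * lnq1 x)))
       + ((- 2 * (1 - x) * q + (1 - x) * (1 - x) * x) * y
       - (1 - x) * (1 - x) * q * (c 4%nat / (2 - x) + (c 4%nat + c 5%nat) / (2 + x) + c 5%nat / (1 - x))
       + 8 * ((1 - x) * y))
       - (- 2 * c 4%nat * ((2 * x * lnq2 x + (x * x - 7) * (4 / (4 - x * x)) + 8) * q
            + ((x * x - 7) * lnq2 x + 8 * x) * x)
       - c 5%nat * ((2 * x * (lnq1 x + lnq2 x) + (x * x - 7) * (2 / (1 - x * x) + 4 / (4 - x * x)) + 12) * q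
            + ((x * x - 7) * (lnq1 x + lnq2 x) + 12 * x) * x
            + 12 * q / (1 - x * x)))) end.
    - cbv zeta. rewrite Q. field. repeat split; nra.
    - cbv zeta. field. repeat split; nra. }
  set (m := fun t => (f t - f (- t)) - k t).
  assert (E := constant_near_0 m D t Ht).
  unfold m in E. rewrite Ropp_0 in E.
  assert (k0 : k 0 = 0).
  { unfold k, lnq2, lnq1, arcI. rewrite Ropp_0.
    replace (2 + 0) with (2 - 0) by ring. replace (1 + 0) with (1 - 0) by ring.
    rewrite !Rminus_diag. unfold Rdiv. ring. }
  unfold level_var. rewrite !V by lra.
  assert (PO := Psi0_2_odd t Ht).
  assert (F : f t - f (- t) = k t) by lra. unfold f, k in F.
  replace (c 6%nat * t / (2 * root4 t)) with (c 6%nat * (t / (2 * root4 t)))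
    by (field; apply Rgt_not_eq, root4_pos, Ht).
  rewrite <- PO. lra.
Qed.

(** * Linear independence of the first variations *)

Definition splitting_form (c : nat -> R) (t x y u : R) : R :=
  c 6%nat * t * (4 - t * t) / 2 - 2 * c 4%nat * (4 - t * t) * ((t * t - 7) * x + 8 * t)
  - c 5%nat * ((4 - t * t) * ((t * t - 7) * (y + x) + 12 * t) + 12 * (4 - t * t) * u)
  - (1 - t * t) * (c 0%nat * t + (4 - t * t) * ((2 * c 1%nat + c 2%nat) * x + c 2%nat * y)
                   + 2 * c 3%nat * u).

(** A positive multiple of the difference between the first variations of the
    half-return maps of zone 2 and of zone 1. *)
Definition splitting (c : nat -> R) (t : R) : R := splitting_form c t (lnq2 t) (lnq1 t) (root4 t * arcI t).

Lemma splitting_level_var c t : -1 < t < 1 ->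
  splitting c t = root4 t * root4 t * root4 t * level_var c zone2 t - root4 t * (1 - t * t) * level_var c zone1 t.
Proof.
  intros Ht. assert (P := root4_pos t Ht). assert (Q := root4_sq t Ht).
  rewrite level_var_1, level_var_2 by exact Ht. unfold splitting, splitting_form. rewrite <- !Q. field. lra.
Qed.

Lemma splitting_linear c d a b t : splitting (fun j => a * c j + b * d j) t = a * splitting c t + b * splitting d t.
Proof. unfold splitting, splitting_form. field. Qed.

Definition taylor_lnq2 (t : R) : R := t * ((1) + (t*t) * ((1/12) + (t*t) * ((1/80) + (t*t) * ((1/448) + (t*t) * ((1/2304) + (t*t) * ((1/11264) + (t*t) * ((1/53248)))))))).
Definition taylor_lnq1 (t : R) : R := t * ((2) + (t*t) * ((2/3) + (t*t) * ((2/5) + (t*t) * ((2/7) + (t*t) * ((2/9) + (t*t) * ((2/11) + (t*t) * ((2/13)))))))).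
(** For U = root4 * arcI, obtained from U' = 1/(1 - t^2) - t U/(4 - t^2). *)
Definition taylor_U (t : R) : R := t * ((1) + (t*t) * ((1/4) + (t*t) * ((7/40) + (t*t) * ((37/280) + (t*t) * ((59/560) + (t*t) * ((269/3080) + (t*t) * ((1193/16016)))))))).
(** The coefficients of t, t^3, ..., t^13 in splitting c, followed by the two
    terms of higher order of the truncated product. *)
Definition q0 (c : nat -> R) : R := (-1) * c 0%nat + (-8) * c 1%nat + (-12) * c 2%nat + (-2) * c 3%nat + (-8) * c 4%nat + (-12) * c 5%nat + (2) * c 6%nat.
Definition q1 (c : nat -> R) : R := (1) * c 0%nat + (28/3) * c 1%nat + (12) * c 2%nat + (3/2) * c 3%nat + (-4/3) * c 4%nat + (-1/2) * c 6%nat.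
Definition q2 (c : nat -> R) : R := (-19/15) * c 1%nat + (-9/10) * c 2%nat + (3/20) * c 3%nat + (13/15) * c 4%nat + (9/10) * c 5%nat.
Definition q3 (c : nat -> R) : R := (-5/84) * c 1%nat + (9/56) * c 2%nat + (3/35) * c 3%nat + (1/60) * c 4%nat + (9/280) * c 5%nat.
Definition q4 (c : nat -> R) : R := (-31/5040) * c 1%nat + (153/1120) * c 2%nat + (3/56) * c 3%nat + (1/5040) * c 4%nat + (9/1120) * c 5%nat.
Definition q5 (c : nat -> R) : R := (-37/44352) * c 1%nat + (963/9856) * c 2%nat + (111/3080) * c 3%nat + (-5/44352) * c 4%nat + (207/49280) * c 5%nat.
Definition q6 (c : nat -> R) : R := (-43/329472) * c 1%nat + (5229/73216) * c 2%nat + (147/5720) * c 3%nat + (-1/29952) * c 4%nat + (6471/2562560) * c 5%nat.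
Definition r7 (c : nat -> R) : R := (3/292864) * c 1%nat + (344067/585728) * c 2%nat + (1193/8008) * c 3%nat + (-69/292864) * c 4%nat + (-2528739/4100096) * c 5%nat.
Definition r8 (c : nat -> R) : R := (-1/26624) * c 1%nat + (-8193/53248) * c 2%nat + (1/26624) * c 4%nat + (8193/53248) * c 5%nat.

Lemma splitting_form_taylor c t : splitting_form c t (taylor_lnq2 t) (taylor_lnq1 t) (taylor_U t)
  = t * (q0 c + t*t * (q1 c + t*t * (q2 c + t*t * (q3 c + t*t * (q4 c + t*t * (q5 c + t*t * q6 c))))))
    + t ^ 15 * (r7 c + t * t * r8 c).
Proof. unfold splitting_form, taylor_lnq2, taylor_lnq1, taylor_U, q0, q1, q2, q3, q4, q5, q6, r7, r8. field. Qed.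

Lemma remainder_bound (e e' : R -> R) (C : R) :
  (forall x, 0 <= x < 1/2 -> is_derive e x (e' x)) -> e 0 = 0 ->
  (forall x, 0 < x < 1/2 -> Rabs (e' x) <= C * x ^ 14) ->
  forall t, 0 < t < 1/2 -> Rabs (e t) <= C * t ^ 15.
Proof.
  intros D E0 B t Ht.
  destruct (mean_value e e' 0 t) as [c [Hc E]]; [lra| | |].
  - intros x Hx. apply D. lra.
  - intros x Hx. eapply derive_continuous, D. lra.
  - rewrite E0, !Rminus_0_r in E. rewrite E, Rabs_mult, (Rabs_pos_eq t) by lra.
    assert (Bc := B c ltac:(lra)). assert (P := Rabs_pos (e' c)).
    assert (C0 : 0 <= C).
    { assert (0 < c ^ 14) by (apply pow_lt; lra). destruct (Rle_or_lt 0 C); [assumption|]. nra. }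
    replace (C * t ^ 15) with ((C * t ^ 14) * t) by ring.
    apply Rmult_le_compat_r; [lra|]. eapply Rle_trans; [exact Bc|].
    apply Rmult_le_compat_l; [exact C0|]. apply pow_incr. lra.
Qed.

Lemma bound_frac n d (m C : R) : 0 < m -> m <= d -> Rabs n <= C -> Rabs (n / d) <= C / m.
Proof.
  intros Hm Hd Hn. unfold Rdiv. rewrite Rabs_mult, Rabs_inv, (Rabs_pos_eq d) by lra.
  apply Rmult_le_compat; [apply Rabs_pos| |exact Hn|].
  - apply Rlt_le, Rinv_0_lt_compat; lra.
  - apply Rinv_le_contravar; assumption.
Qed.

Lemma lnq2_taylor t : 0 < t < 1/2 -> Rabs (lnq2 t - taylor_lnq2 t) <= 1 * t ^ 15.
Proof.
  apply (remainder_bound (fun t => lnq2 t - taylor_lnq2 t) (fun t => (t ^ 14 / 4096) / (4 - t * t))).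
  - intros x Hx. assert (D := derive_lnq2 x ltac:(lra)). unfold taylor_lnq2.
    auto_derive; [eexists; exact D|].
    use_derive D.
    field. nra.
  - unfold lnq2, taylor_lnq2. rewrite Rplus_0_r, Rminus_0_r, Rminus_diag. ring.
  - intros x Hx. assert (P : 0 < x ^ 14) by (apply pow_lt; lra).
    eapply Rle_trans; [apply (bound_frac _ _ 1 (x ^ 14 / 4096)); [lra|nra|]|].
    + rewrite Rabs_pos_eq; lra.
    + lra.
Qed.

Lemma lnq1_taylor t : 0 < t < 1/2 -> Rabs (lnq1 t - taylor_lnq1 t) <= 4 * t ^ 15.
Proof.
  apply (remainder_bound (fun t => lnq1 t - taylor_lnq1 t) (fun t => (2 * t ^ 14) / (1 - t * t))).
  - intros x Hx. assert (D := derive_lnq1 x ltac:(lra)). unfold taylor_lnq1.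
    auto_derive; [eexists; exact D|].
    use_derive D.
    field. nra.
  - unfold lnq1, taylor_lnq1. rewrite Rplus_0_r, Rminus_0_r, Rminus_diag. ring.
  - intros x Hx. assert (P : 0 < x ^ 14) by (apply pow_lt; lra).
    eapply Rle_trans; [apply (bound_frac _ _ (1/2) (2 * x ^ 14)); [lra|nra|]|].
    + rewrite Rabs_pos_eq; lra.
    + lra.
Qed.

(** The polynomial taylor_U solves the equation of U up to order 14, and the
    homogeneous solution root4 divides out. *)
Lemma U_taylor t : 0 < t < 1/2 -> Rabs (root4 t * arcI t - taylor_U t) <= 8 * t ^ 15.
Proof.
  intros Ht.
  assert (B : Rabs (arcI t - taylor_U t / root4 t) <= 4 * t ^ 15).
  { revert t Ht. apply (remainder_bound (fun t => arcI t - taylor_U t / root4 t)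
      (fun t => (t ^ 14 * (15591/4004 - 3579/4004 * (t * t))) / ((1 - t * t) * (4 - t * t) * root4 t))).
    - intros x Hx. assert (P := root4_pos x ltac:(lra)). assert (Q := root4_sq x ltac:(lra)).
      assert (DA := derive_arcI x ltac:(lra)). assert (DS := derive_root4 x ltac:(lra)).
      unfold taylor_U. auto_derive.
      + split; [eexists; exact DA|]. split; [eexists; exact DS|]. split; [lra|exact I].
      + use_derive DS. use_derive DA.
        rewrite <- Q. apply (Rmult_eq_reg_r (root4 x * root4 x * root4 x)); [|nra].
        match goal with |- ?a * _ = ?b * _ => set (l := a); set (r := b) end.
        assert (El : l * (root4 x * root4 x * root4 x) = (root4 x * root4 x) / (1 - x * x)
          - ((root4 x * root4 x) * (1 + x*x * (3/4 + x*x * (7/8 + x*x * (37/40 + x*x * (531/560 + x*x * (269/280 + x*x * (1193/1232)))))))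
             + x * taylor_U x)).
        { unfold l, taylor_U. field. split; nra. }
        assert (Er : r * (root4 x * root4 x * root4 x) = (x ^ 14 * (15591/4004 - 3579/4004 * (x * x))) / (1 - x * x)).
        { unfold r. field. split; nra. }
        rewrite El, Er, Q. unfold taylor_U. field. nra.
    - unfold arcI, taylor_U. rewrite Ropp_0. unfold Rdiv. ring.
    - intros x Hx. assert (P : 0 < x ^ 14) by (apply pow_lt; lra).
      assert (Sg := root4_ge1 x ltac:(lra)).
      assert (Dn : 1 <= (1 - x * x) * (4 - x * x) * root4 x).
      { assert (1 <= (1 - x * x) * (4 - x * x)) by nra. nra. }
      eapply Rle_trans; [apply (bound_frac _ _ 1 (4 * x ^ 14)); [lra|exact Dn|]|lra].
      rewrite Rabs_mult, (Rabs_pos_eq (x ^ 14)), Rmult_comm by lra.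
      apply Rmult_le_compat_r; [lra|]. apply Rabs_le. nra. }
  assert (P := root4_ge1 t ltac:(lra)).
  replace (root4 t * arcI t - taylor_U t) with (root4 t * (arcI t - taylor_U t / root4 t)) by (field; lra).
  rewrite Rabs_mult, (Rabs_pos_eq (root4 t)) by lra.
  assert (R0 := Rabs_pos (arcI t - taylor_U t / root4 t)).
  replace (8 * t ^ 15) with (2 * (4 * t ^ 15)) by ring.
  apply Rmult_le_compat; lra.
Qed.

Fixpoint peval (l : list R) (x : R) : R :=
  match l with [] => 0 | a :: l' => a + x * peval l' x end.

Lemma peval_bounded l : exists M, 0 <= M /\ forall x, 0 <= x <= 1 -> Rabs (peval l x) <= M.
Proof.
  induction l as [|a l [M [HM IH]]].
  - exists 0. split; [lra|]. intros x _. simpl. rewrite Rabs_R0. lra.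
  - exists (Rabs a + M). split; [assert (X := Rabs_pos a); lra|]. intros x Hx. simpl.
    eapply Rle_trans; [apply Rabs_triang|]. apply Rplus_le_compat_l.
    rewrite Rabs_mult, (Rabs_pos_eq x) by lra. specialize (IH x Hx).
    assert (P := Rabs_pos (peval l x)). nra.
Qed.

(** The lowest coefficient is the limit at 0, and the others follow after
    division by x. *)
Lemma peval_vanish l : forall (K d : R), 0 <= K -> 0 < d ->
  (forall x, 0 < x < d -> Rabs (peval l x) <= K * x ^ length l) -> List.Forall (fun a => a = 0) l.
Proof.
  induction l as [|a l IH]; intros K d HK Hd H; [constructor|].
  destruct (peval_bounded l) as [M [HM BM]].
  assert (Ha : a = 0).
  { destruct (Req_dec a 0) as [e|ne]; [exact e|exfalso].
    assert (Pa : 0 < Rabs a) by now apply Rabs_pos_lt.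
    set (x := Rmin (Rmin (d / 2) 1) (Rabs a / (2 * (K + M + 1)))).
    assert (X1 : x <= d / 2) by (eapply Rle_trans; [apply Rmin_l|apply Rmin_l]).
    assert (X2 : x <= 1) by (eapply Rle_trans; [apply Rmin_l|apply Rmin_r]).
    assert (X3 : x <= Rabs a / (2 * (K + M + 1))) by apply Rmin_r.
    assert (X0 : 0 < x).
    { apply Rmin_glb_lt; [apply Rmin_glb_lt; lra|]. apply Rdiv_lt_0_compat; lra. }
    specialize (H x ltac:(lra)). simpl in H.
    assert (B := BM x ltac:(lra)).
    assert (P : 0 <= x ^ length l <= 1).
    { split; [apply pow_le; lra|]. rewrite <- (pow1 (length l)). apply pow_incr. lra. }
    assert (T : Rabs a <= Rabs (a + x * peval l x) + Rabs (x * peval l x)).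
    { replace a with ((a + x * peval l x) - x * peval l x) at 1 by ring.
      eapply Rle_trans; [apply Rabs_triang|]. rewrite Rabs_Ropp. lra. }
    rewrite (Rabs_mult x), (Rabs_pos_eq x) in T by lra.
    assert (Y1 : x * Rabs (peval l x) <= x * M) by (apply Rmult_le_compat_l; lra).
    assert (Y2 : K * (x * x ^ length l) <= x * K).
    { replace (K * (x * x ^ length l)) with ((x * K) * x ^ length l) by ring.
      rewrite <- (Rmult_1_r (x * K)) at 2. apply Rmult_le_compat_l; [|lra].
      apply Rmult_le_pos; lra. }
    assert (Y3 : x * (K + M + 1) <= Rabs a / 2).
    { replace (Rabs a / 2) with (Rabs a / (2 * (K + M + 1)) * (K + M + 1)) by (field; lra).
      apply Rmult_le_compat_r; lra. }
    nra. }
  constructor; [exact Ha|]. apply (IH K d HK Hd).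
  intros x Hx. specialize (H x Hx). simpl in H. rewrite Ha, Rplus_0_l in H.
  rewrite Rabs_mult, (Rabs_pos_eq x) in H by lra. nra.
Qed.

Lemma Rabs_mul_le a b A B : Rabs a <= A -> Rabs b <= B -> Rabs (a * b) <= A * B.
Proof.
  intros Ha Hb. rewrite Rabs_mult. apply Rmult_le_compat; auto using Rabs_pos.
Qed.

(** The seven lowest odd Taylor coefficients of splitting c vanish, and as linear
    forms in c they are independent. *)
Lemma splitting_independent c d : 0 < d -> (forall t, 0 < t < d -> splitting c t = 0) ->
  forall j, (j < 7)%nat -> c j = 0.
Proof.
  intros Hd H.
  assert (F : List.Forall (fun a => a = 0) [q0 c; q1 c; q2 c; q3 c; q4 c; q5 c; q6 c]).
  { set (K1 := 2 * Rabs (c 4%nat) * 4 * 7 + Rabs (c 5%nat) * 4 * 7 + 4 * (2 * Rabs (c 1%nat) + Rabs (c 2%nat))).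
    set (K2 := Rabs (c 5%nat) * 4 * 7 + 4 * Rabs (c 2%nat)).
    set (K3 := 48 * Rabs (c 5%nat) + 2 * Rabs (c 3%nat)).
    assert (R1 := Rabs_pos (c 1%nat)). assert (R2 := Rabs_pos (c 2%nat)).
    assert (R3 := Rabs_pos (c 3%nat)). assert (R4 := Rabs_pos (c 4%nat)).
    assert (R5 := Rabs_pos (c 5%nat)).
    assert (R7 := Rabs_pos (r7 c)). assert (R8 := Rabs_pos (r8 c)).
    set (m := Rmin d (1/2)).
    assert (M1 : m <= d) by apply Rmin_l. assert (M2 : m <= 1/2) by apply Rmin_r.
    assert (M0 : 0 < m) by (apply Rmin_glb_lt; lra).
    apply (peval_vanish _ (Rabs (r7 c) + Rabs (r8 c) + K1 * 1 + K2 * 4 + K3 * 8) (m * m)).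
    - unfold K1, K2, K3. lra.
    - nra.
    - intros x Hx. set (t := sqrt x).
      assert (Et : x = t * t) by (symmetry; apply sqrt_sqrt; lra).
      assert (T0 : 0 < t) by (apply sqrt_lt_R0; lra).
      assert (Tm : t < m) by nra.
      assert (HJ := H t ltac:(lra)).
      assert (B1 := lnq2_taylor t ltac:(lra)). assert (B2 := lnq1_taylor t ltac:(lra)).
      assert (B3 := U_taylor t ltac:(lra)).
      set (e1 := lnq2 t - taylor_lnq2 t) in *. set (e2 := lnq1 t - taylor_lnq1 t) in *.
      set (e3 := root4 t * arcI t - taylor_U t) in *.
      (* Coefficients of the three remainders in splitting c. *)
      set (k1 := - 2 * c 4%nat * (4 - t * t) * (t * t - 7) - c 5%nat * (4 - t * t) * (t * t - 7)
                 - (1 - t * t) * (4 - t * t) * (2 * c 1%nat + c 2%nat)).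
      set (k2 := - c 5%nat * (4 - t * t) * (t * t - 7) - (1 - t * t) * (4 - t * t) * c 2%nat).
      set (k3 := - (12 * c 5%nat * (4 - t * t)) - (1 - t * t) * 2 * c 3%nat).
      assert (E : splitting c t = splitting_form c t (taylor_lnq2 t) (taylor_lnq1 t) (taylor_U t) + k1 * e1 + k2 * e2 + k3 * e3).
      { unfold splitting, splitting_form, k1, k2, k3, e1, e2, e3. field. }
      rewrite HJ, splitting_form_taylor in E.
      set (p := peval [q0 c; q1 c; q2 c; q3 c; q4 c; q5 c; q6 c] x).
      assert (Ep : t * p = - (t ^ 15 * (r7 c + t * t * r8 c) + k1 * e1 + k2 * e2 + k3 * e3)).
      { unfold p; simpl. rewrite Et. lra. }
      assert (P4 : Rabs (4 - t * t) <= 4) by (apply Rabs_le; nra).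
      assert (P7 : Rabs (t * t - 7) <= 7) by (apply Rabs_le; nra).
      assert (P1 : Rabs (1 - t * t) <= 1) by (apply Rabs_le; nra).
      assert (X2 : Rabs 2 = 2) by (apply Rabs_pos_eq; lra).
      assert (X12 : Rabs 12 = 12) by (apply Rabs_pos_eq; lra).
      assert (C1 : Rabs k1 <= K1).
      { unfold k1, K1.
        assert (Z1 : Rabs (2 * c 4%nat * (4 - t * t) * (t * t - 7)) <= 2 * Rabs (c 4%nat) * 4 * 7).
        { repeat (lra || apply Rabs_mul_le). }
        assert (Z2 : Rabs (c 5%nat * (4 - t * t) * (t * t - 7)) <= Rabs (c 5%nat) * 4 * 7).
        { repeat (lra || apply Rabs_mul_le). }
        assert (Z3 : Rabs ((1 - t * t) * (4 - t * t) * (2 * c 1%nat + c 2%nat))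
          <= 1 * 4 * (2 * Rabs (c 1%nat) + Rabs (c 2%nat))).
        { do 2 (try apply Rabs_mul_le); try lra. eapply Rle_trans; [apply Rabs_triang|].
          rewrite Rabs_mult, X2. lra. }
        apply Rabs_le_inv in Z1, Z2, Z3. apply Rabs_le. lra. }
      assert (C2 : Rabs k2 <= K2).
      { unfold k2, K2.
        assert (Z2 : Rabs (c 5%nat * (4 - t * t) * (t * t - 7)) <= Rabs (c 5%nat) * 4 * 7).
        { repeat (lra || apply Rabs_mul_le). }
        assert (Z3 : Rabs ((1 - t * t) * (4 - t * t) * c 2%nat) <= 1 * 4 * Rabs (c 2%nat)).
        { repeat (lra || apply Rabs_mul_le). }
        apply Rabs_le_inv in Z2, Z3. apply Rabs_le. lra. }
      assert (C3 : Rabs k3 <= K3).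
      { unfold k3, K3.
        assert (Z2 : Rabs (12 * c 5%nat * (4 - t * t)) <= 12 * Rabs (c 5%nat) * 4).
        { repeat (lra || apply Rabs_mul_le). }
        assert (Z3 : Rabs ((1 - t * t) * 2 * c 3%nat) <= 1 * 2 * Rabs (c 3%nat)).
        { repeat (lra || apply Rabs_mul_le). }
        apply Rabs_le_inv in Z2, Z3. apply Rabs_le. lra. }
      assert (D1 := Rabs_mul_le _ _ _ _ C1 B1). assert (D2 := Rabs_mul_le _ _ _ _ C2 B2).
      assert (D3 := Rabs_mul_le _ _ _ _ C3 B3).
      assert (Pt : 0 < t ^ 15) by (apply pow_lt; lra).
      assert (D0 : Rabs (t ^ 15 * (r7 c + t * t * r8 c)) <= t ^ 15 * (Rabs (r7 c) + Rabs (r8 c))).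
      { apply Rabs_mul_le; [rewrite Rabs_pos_eq; lra|].
        eapply Rle_trans; [apply Rabs_triang|]. apply Rplus_le_compat_l.
        rewrite Rabs_mult, (Rabs_pos_eq (t * t)) by (apply Rmult_le_pos; lra).
        rewrite <- (Rmult_1_l (Rabs (r8 c))) at 2. apply Rmult_le_compat_r; [lra|].
        rewrite <- (Rmult_1_r 1). apply Rmult_le_compat; lra. }
      assert (Fin : Rabs (t * p) <= (Rabs (r7 c) + Rabs (r8 c) + K1 * 1 + K2 * 4 + K3 * 8) * t ^ 15).
      { rewrite Ep, Rabs_Ropp. apply Rabs_le_inv in D0, D1, D2, D3. apply Rabs_le. lra. }
      rewrite Rabs_mult, (Rabs_pos_eq t) in Fin by lra.
      simpl length. rewrite Et.
      replace ((t * t) ^ 7) with (t ^ 14) by ring.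
      apply (Rmult_le_reg_l t); [exact T0|].
      replace (t * ((Rabs (r7 c) + Rabs (r8 c) + K1 * 1 + K2 * 4 + K3 * 8) * t ^ 14))
        with ((Rabs (r7 c) + Rabs (r8 c) + K1 * 1 + K2 * 4 + K3 * 8) * t ^ 15) by ring.
      exact Fin. }
  repeat match goal with H : List.Forall _ (_ :: _) |- _ => inversion_clear H end.
  unfold q0, q1, q2, q3, q4, q5, q6 in *.
  intros j Hj. do 7 (destruct j as [|j]; [lra|]). lia.
Qed.

(** Functions that are independent on each interval (0, d') admit interpolation
    points chosen one after the other, each closer to 0 than the previous
    ones: the new function, minus its interpolation at the old points, does
    not vanish identically near 0. *)
Lemma interpolation (d : R) : 0 < d -> forall n, (n <= 7)%nat ->
  exists x : nat -> R, (forall j, (j < n)%nat -> 0 < x j < d) /\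
    (forall i j, (i < j)%nat -> (j < n)%nat -> x j < x i) /\
    forall v : nat -> R, exists c : nat -> R, (forall j, (n <= j)%nat -> c j = 0) /\
      forall j, (j < n)%nat -> splitting c (x j) = v j.
Proof.
  intros Hd. induction n as [|n IH]; intros Hn.
  - exists (fun _ => 0). split; [intros; lia|]. split; [intros; lia|].
    intros v. exists (fun _ => 0). split; [reflexivity|intros; lia].
  - destruct (IH ltac:(lia)) as [x [Hx [Hs Hv]]].
    set (e := fun j => if Nat.eq_dec j n then 1 else 0).
    destruct (Hv (fun j => splitting e (x j))) as [c0 [C0 C0v]].
    (* The last basis vector, corrected to vanish at the points found so far. *)
  set (g := fun j => 1 * e j + (-1) * c0 j).
    assert (Gx : forall j, (j < n)%nat -> splitting g (x j) = 0).
    { intros j Hj. unfold g. rewrite splitting_linear, C0v by exact Hj. ring. }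
    assert (Gn : g n = 1).
    { unfold g, e. rewrite C0 by lia. destruct (Nat.eq_dec n n); [ring|lia]. }
    assert (Gs : forall j, (S n <= j)%nat -> g j = 0).
    { intros j Hj. unfold g, e. rewrite C0 by lia. destruct (Nat.eq_dec j n); [lia|ring]. }
    assert (Dl : exists d', 0 < d' <= d /\ forall j, (j < n)%nat -> d' <= x j).
    { destruct n as [|m].
      - exists d. split; [lra|intros; lia].
      - exists (x m). split; [assert (Y := Hx m ltac:(lia)); lra|].
        intros j Hj. destruct (Nat.eq_dec j m) as [->|ne]; [lra|].
        apply Rlt_le, Hs; lia. }
    destruct Dl as [d' [Hd' Dx]].
    assert (Ex : exists t, 0 < t < d' /\ splitting g t <> 0).
    { apply Classical_Prop.NNPP. intros N.
      assert (Z : g n = 0); [|lra].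
      apply (splitting_independent g d'); [lra| |lia].
      intros t Ht. apply Classical_Prop.NNPP. intros Nz. apply N. now exists t. }
    destruct Ex as [t [Ht Jt]].
    exists (fun j => if Nat.eq_dec j n then t else x j).
    split; [|split].
    + intros j Hj. destruct (Nat.eq_dec j n); [lra|]. apply Hx. lia.
    + intros i j Hij Hj. destruct (Nat.eq_dec j n); destruct (Nat.eq_dec i n); try lia.
      * assert (Y := Dx i ltac:(lia)). lra.
      * apply Hs; lia.
    + intros v. destruct (Hv v) as [c1 [C1 C1v]].
      exists (fun j => 1 * c1 j + ((v n - splitting c1 t) / splitting g t) * g j). split.
      * intros j Hj. rewrite C1, Gs by lia. ring.
      * intros j Hj. rewrite splitting_linear. destruct (Nat.eq_dec j n) as [->|ne].
        -- field. exact Jt.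
        -- rewrite C1v, Gx by lia. ring.
Qed.

(** * Regular values and implicit functions *)

Lemma pigeonhole : forall (n : nat) (f : nat -> nat), (forall j, (j <= n)%nat -> (f j < n)%nat) ->
  exists i j, (i < j <= n)%nat /\ f i = f j.
Proof.
  induction n as [|n IH]; intros f Hf.
  - specialize (Hf 0%nat). lia.
  - destruct (Classical_Prop.classic (exists i, (i <= n)%nat /\ f i = f (S n))) as [[i [Hi E]]|N].
    + exists i, (S n). split; [lia|exact E].
    + destruct (IH (fun j => if Nat.ltb (f j) (f (S n)) then f j else pred (f j))) as [i [j [Hij E]]].
      * intros j Hj. assert (Y1 := Hf j ltac:(lia)). assert (Y2 := Hf (S n) ltac:(lia)).
        assert (Y3 : f j <> f (S n)) by (intros e; apply N; now exists j).
        destruct (Nat.ltb_spec (f j) (f (S n))); lia.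
      * exists i, j. split; [lia|].
        assert (Y3 : f j <> f (S n)) by (intros e; apply N; exists j; split; [lia|exact e]).
        assert (Y4 : f i <> f (S n)) by (intros e; apply N; exists i; split; [lia|exact e]).
        destruct (Nat.ltb_spec (f i) (f (S n))); destruct (Nat.ltb_spec (f j) (f (S n))); lia.
Qed.

(** Sard's theorem on a segment.  Near a critical point K varies little, so the
    pieces of a fine subdivision are too few to contain critical points for
    many equidistant values. *)
Lemma regular_value (K K' : R -> R) (a b lo hi : R) : a < b -> lo < hi ->
  (forall x, a <= x <= b -> is_derive K x (K' x)) ->
  (forall x, a <= x <= b -> continuous K' x) ->
  exists f, lo < f < hi /\ forall x, a <= x <= b -> K x = f -> K' x <> 0.
Proof.
  intros ab lh D C. apply Classical_Prop.NNPP. intros N.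
  assert (Cr : forall f, exists x, lo < f < hi -> a <= x <= b /\ K x = f /\ K' x = 0).
  { intros f. destruct (Classical_Prop.classic (exists x, a <= x <= b /\ K x = f /\ K' x = 0))
      as [[x Hx]|N']; [now exists x|].
    exists 0. intros Hf. exfalso. apply N. exists f. split; [exact Hf|].
    intros x Hx E E'. apply N'. now exists x. }
  destruct (ClassicalChoice.choice _ Cr) as [X HX].
  (* A piece of length (b - a)/n with a critical point has an image of length
     below (hi - lo)/(4 n), less than the distance (hi - lo)/(n + 3) of two
     consecutive values v. *)
  set (eta := (hi - lo) / (4 * (b - a))).
  assert (He : 0 < eta) by (apply Rdiv_lt_0_compat; lra).
  assert (Ct : forall x, a <= x <= b -> continuity_pt K' x).
  { intros x Hx. apply continuity_pt_filterlim, C, Hx. }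
  destruct (@Heine_cor2 K' a b Ct (mkposreal eta He)) as [dl Hdl].
  destruct (INR_archimed dl (b - a)) as [n0 Hn0]; [apply cond_pos|].
  set (n := S (S n0)).
  assert (Hn : b - a < INR n * dl).
  { unfold n. rewrite !S_INR. assert (Y := cond_pos dl). lra. }
  assert (n2 : 2 <= INR n). { unfold n. rewrite !S_INR. assert (Y := pos_INR n0). lra. }
  set (v := fun j : nat => lo + (hi - lo) * (INR j + 1) / (INR n + 3)).
  assert (Hv : forall j, (j <= S n)%nat -> lo < v j < hi).
  { intros j Hj. apply le_INR in Hj. rewrite S_INR in Hj. assert (Y := pos_INR j). unfold v.
    assert (0 < (hi - lo) * (INR j + 1) / (INR n + 3)).
    { apply Rdiv_lt_0_compat; [apply Rmult_lt_0_compat|]; lra. }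
    assert ((hi - lo) * (INR j + 1) / (INR n + 3) < hi - lo); [|lra].
    apply (Rmult_lt_reg_r (INR n + 3)); [lra|].
    replace ((hi - lo) * (INR j + 1) / (INR n + 3) * (INR n + 3)) with ((hi - lo) * (INR j + 1))
      by (field; lra).
    apply Rmult_lt_compat_l; lra. }
  set (y := fun j => X (v j)).
  set (u := fun j => (y j - a) * INR n / (b - a)).
  assert (Hu : forall j, (j <= S n)%nat -> 0 <= u j <= INR n).
  { intros j Hj. destruct (HX (v j) (Hv j Hj)) as [Y _]. fold (y j) in Y.
    assert (Eu : u j * (b - a) = (y j - a) * INR n) by (unfold u; field; lra). split; nra. }
  destruct (pigeonhole (S n) (fun j => Z.to_nat (Int_part (u j)))) as [i [j [Hij E]]].
  { intros j Hj. specialize (Hu j Hj). destruct (base_Int_part (u j)) as [B1 B2].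
    assert (Int_part (u j) <= Z.of_nat n)%Z; [|lia].
    apply le_IZR. rewrite <- INR_IZR_INZ. lra. }
  assert (Hj : (j <= S n)%nat) by lia. assert (Hi : (i <= S n)%nat) by lia.
  assert (Hui := Hu i Hi). assert (Huj := Hu j Hj).
  assert (Ei : Int_part (u i) = Int_part (u j)).
  { destruct (base_Int_part (u i)) as [B1 B2]. destruct (base_Int_part (u j)) as [B3 B4].
    assert (-1 < Int_part (u i))%Z by (apply lt_IZR; lra).
    assert (-1 < Int_part (u j))%Z by (apply lt_IZR; lra). lia. }
  assert (Du : Rabs (u i - u j) <= 1).
  { destruct (base_Int_part (u i)) as [B1 B2]. destruct (base_Int_part (u j)) as [B3 B4].
    rewrite Ei in B1, B2. apply Rabs_le. lra. }
  destruct (HX (v i) (Hv i Hi)) as [Yi [Ki Ci]]. destruct (HX (v j) (Hv j Hj)) as [Yj [Kj Cj]].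
  fold (y i) in Yi, Ki, Ci. fold (y j) in Yj, Kj, Cj.
  assert (Dy : Rabs (y i - y j) * INR n <= b - a).
  { assert (Ey : (y i - y j) * INR n = (u i - u j) * (b - a)) by (unfold u; field; lra).
    apply (f_equal Rabs) in Ey. rewrite !Rabs_mult, (Rabs_pos_eq (INR n)), (Rabs_pos_eq (b - a)) in Ey by lra.
    rewrite Ey. rewrite <- (Rmult_1_l (b - a)) at 2. apply Rmult_le_compat_r; lra. }
  destruct (MVT_gen K (y i) (y j) K') as [c [Hc Ec]].
  { intros x Hx. apply D. unfold Rmin, Rmax in Hx. destruct (Rle_dec (y i) (y j)); lra. }
  { intros x Hx. apply continuity_pt_filterlim. eapply derive_continuous, D.
    unfold Rmin, Rmax in Hx. destruct (Rle_dec (y i) (y j)); lra. }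
  assert (Hc' : a <= c <= b /\ Rabs (c - y i) <= Rabs (y i - y j)).
  { unfold Rmin, Rmax in Hc. destruct (Rle_dec (y i) (y j)).
    - split; [lra|]. rewrite (Rabs_left1 (y i - y j)), Rabs_pos_eq; lra.
    - split; [lra|]. rewrite (Rabs_pos_eq (y i - y j)), Rabs_left1; lra. }
  assert (Kc : Rabs (K' c) < eta).
  { replace (K' c) with (K' c - K' (y i)) by (rewrite Ci; ring).
    apply (Hdl c (y i)); [apply Hc'|exact Yi|].
    eapply Rle_lt_trans; [apply Hc'|].
    apply (Rmult_lt_reg_r (INR n)); [lra|]. lra. }
  rewrite Ki, Kj in Ec.
  assert (Ev : v j - v i = (hi - lo) * (INR j - INR i) / (INR n + 3)) by (unfold v; field; lra).
  assert (ji : 1 <= INR j - INR i).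
  { assert (Y : (S i <= j)%nat) by lia. apply le_INR in Y. rewrite S_INR in Y. lra. }
  rewrite Ev in Ec.
  assert (L1 : (hi - lo) / (INR n + 3) <= Rabs ((hi - lo) * (INR j - INR i) / (INR n + 3))).
  { rewrite Rabs_pos_eq.
    - unfold Rdiv. apply Rmult_le_compat_r; [apply Rlt_le, Rinv_0_lt_compat; lra|]. nra.
    - apply Rmult_le_pos; [nra|apply Rlt_le, Rinv_0_lt_compat; lra]. }
  rewrite Ec, Rabs_mult, Rabs_minus_sym in L1.
  assert (L2 : (Rabs (K' c) * Rabs (y i - y j)) * INR n <= eta * (b - a)).
  { rewrite Rmult_assoc. apply Rmult_le_compat; try apply Rabs_pos; try lra.
    apply Rmult_le_pos; [apply Rabs_pos|lra]. }
  assert (E4 : eta * (b - a) = (hi - lo) / 4) by (unfold eta; field; lra).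
  assert (L3 : (hi - lo) / (INR n + 3) * INR n <= (hi - lo) / 4).
  { eapply Rle_trans; [apply Rmult_le_compat_r; [lra|exact L1]|]. lra. }
  apply (Rmult_le_compat_r (INR n + 3)) in L3; [|lra].
  replace ((hi - lo) / (INR n + 3) * INR n * (INR n + 3)) with ((hi - lo) * INR n) in L3 by (field; lra).
  nra.
Qed.

(** By the mean value theorem, difference quotients of sg are quotients of values
    of h at points near r and near sg r. *)
Lemma implicit_derive (H h sg : R -> R) (r e : R) : 0 < e ->
  (forall x, Rabs (x - r) < e -> is_derive H x (h x)) ->
  (forall x, Rabs (x - sg r) < e -> is_derive H x (h x)) ->
  continuous h r -> continuous h (sg r) -> h (sg r) <> 0 -> continuous sg r ->
  (forall x, Rabs (x - r) < e -> H (sg x) = H x) ->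
  is_derive sg r (h r / h (sg r)).
Proof.
  intros He D1 D2 C1 C2 Nz Cs E. apply is_derive_Reals. intros eps Heps.
  assert (C : continuity_2d_pt (fun u v => h u / h v) r (sg r)).
  { unfold Rdiv. apply continuity_2d_pt_mult.
    - apply continuity_1d_2d_pt_comp; [now apply continuity_pt_filterlim|apply continuity_2d_pt_id1].
    - apply continuity_2d_pt_inv; [|exact Nz].
      apply continuity_1d_2d_pt_comp; [now apply continuity_pt_filterlim|apply continuity_2d_pt_id2]. }
  destruct (C (mkposreal _ Heps)) as [d1 Hd1].
  assert (C2' : locally (sg r) (fun x => h x <> 0))
    by (apply (C2 (fun y => y <> 0)); now apply open_neq).
  destruct C2' as [d2 Hd2].
  assert (Hm : 0 < Rmin (Rmin e d1) d2).
  { apply Rmin_glb_lt; [apply Rmin_glb_lt; [exact He|apply cond_pos]|apply cond_pos]. }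
  set (m := Rmin (Rmin e d1) d2) in *.
  assert (m1 : m <= e) by (eapply Rle_trans; [apply Rmin_l|apply Rmin_l]).
  assert (m2 : m <= d1) by (eapply Rle_trans; [apply Rmin_l|apply Rmin_r]).
  assert (m3 : m <= d2) by apply Rmin_r.
  destruct (Cs (ball (sg r) (mkposreal _ Hm))) as [d3 Hd3]; [now exists (mkposreal _ Hm)|].
  assert (Hm' : 0 < Rmin m d3) by (apply Rmin_glb_lt; [exact Hm|apply cond_pos]).
  exists (mkposreal _ Hm'). intros k Hk Hkm. simpl in Hkm.
  assert (k1 : Rabs k < m) by (eapply Rlt_le_trans; [exact Hkm|apply Rmin_l]).
  assert (k2 : Rabs k < d3) by (eapply Rlt_le_trans; [exact Hkm|apply Rmin_r]).
  assert (Sk : Rabs (sg (r + k) - sg r) < m).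
  { apply (Hd3 (r + k)). change (Rabs (r + k - r) < d3). now replace (r + k - r) with k by ring. }
  assert (Btw : forall p q c, Rmin p q <= c <= Rmax p q -> Rabs (c - p) <= Rabs (q - p)).
  { intros p q c Hc. unfold Rmin, Rmax in Hc. destruct (Rle_dec p q).
    - rewrite !Rabs_pos_eq; lra.
    - rewrite !Rabs_left1; lra. }
  assert (Btw' : forall p q c, Rmin p q < c < Rmax p q -> Rabs (c - p) <= Rabs (q - p)).
  { intros p q c Hc. apply Btw. lra. }
  destruct (MVT_gen H r (r + k) h) as [c [Hc Ec]].
  { intros x Hx. apply D1. apply Btw' in Hx. replace (r + k - r) with k in Hx by ring. lra. }
  { intros x Hx. apply continuity_pt_filterlim. eapply derive_continuous, D1.
    apply Btw in Hx. replace (r + k - r) with k in Hx by ring. lra. }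
  destruct (MVT_gen H (sg r) (sg (r + k)) h) as [c' [Hc' Ec']].
  { intros x Hx. apply D2. apply Btw' in Hx. lra. }
  { intros x Hx. apply continuity_pt_filterlim. eapply derive_continuous, D2.
    apply Btw in Hx. lra. }
  apply Btw in Hc, Hc'. replace (r + k - r) with k in Hc, Ec by ring.
  rewrite !E in Ec'.
  2:{ rewrite Rminus_diag, Rabs_R0. exact He. }
  2:{ replace (r + k - r) with k by ring. lra. }
  rewrite Ec in Ec'.
  assert (Nc : h c' <> 0) by (apply Hd2; change (Rabs (c' - sg r) < d2); lra).
  replace ((sg (r + k) - sg r) / k) with (h c / h c').
  - apply Hd1; lra.
  - apply (Rmult_eq_reg_r (h c' * k)); [|now apply Rmult_integral_contrapositive].
    field_simplify; [lra|exact Hk|exact Nc].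
Qed.

Lemma continuous_mult_R (f g : R -> R) x : continuous f x -> continuous g x ->
  continuous (fun y => f y * g y) x.
Proof. apply (continuous_mult f g). Qed.
Lemma continuous_minus_R (f g : R -> R) x : continuous f x -> continuous g x ->
  continuous (fun y => f y - g y) x.
Proof. apply (continuous_minus f g). Qed.
Lemma continuous_div_R (f g : R -> R) x : continuous f x -> continuous g x -> g x <> 0 ->
  continuous (fun y => f y / g y) x.
Proof.
  intros Cf Cg N. apply continuous_mult_R; [exact Cf|].
  apply (continuous_comp g Rinv); [exact Cg|now apply continuous_Rinv].
Qed.

(** Derivative of the ratio of the increments of B and P from sg r to r. *)
Definition chord_slope (B P b p sg sg' : R -> R) (r : R) : R :=
  ((b r - b (sg r) * sg' r) * (P r - P (sg r)) - (B r - B (sg r)) * (p r - p (sg r) * sg' r))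
  / ((P r - P (sg r)) * (P r - P (sg r))).

Lemma chord_slope_derive (B P b p sg sg' : R -> R) (r : R) :
  is_derive B r (b r) -> is_derive P r (p r) ->
  is_derive B (sg r) (b (sg r)) -> is_derive P (sg r) (p (sg r)) ->
  is_derive sg r (sg' r) -> P r - P (sg r) <> 0 ->
  is_derive (fun r => (B r - B (sg r)) / (P r - P (sg r))) r (chord_slope B P b p sg sg' r).
Proof.
  intros D1 D2 D3 D4 Ds N.
  set (Bs := fun x => B (sg x)). set (Ps := fun x => P (sg x)).
  assert (C3 : is_derive Bs r (sg' r * b (sg r))) by exact (is_derive_comp B sg r _ _ D3 Ds).
  assert (C4 : is_derive Ps r (sg' r * p (sg r))) by exact (is_derive_comp P sg r _ _ D4 Ds).
  apply (is_derive_ext (fun r => (B r - Bs r) / (P r - Ps r))); [reflexivity|].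
  change (P r - Ps r <> 0) in N.
  auto_derive.
  - repeat match goal with |- _ /\ _ => split | |- True => exact I end;
      try exact N; eexists; eassumption.
  - use_derive D1. use_derive D2. use_derive C3. use_derive C4.
    unfold chord_slope. change (P (sg r)) with (Ps r). change (B (sg r)) with (Bs r).
    field. exact N.
Qed.

Lemma chord_slope_continuous (B P b p sg sg' : R -> R) (r : R) :
  continuous B r -> continuous P r -> continuous b r -> continuous p r ->
  continuous B (sg r) -> continuous P (sg r) -> continuous b (sg r) -> continuous p (sg r) ->
  continuous sg r -> continuous sg' r -> P r - P (sg r) <> 0 ->
  continuous (chord_slope B P b p sg sg') r.
Proof.
  intros C1 C2 C3 C4 C5 C6 C7 C8 Cs Cs' N. unfold chord_slope.
  assert (X1 : continuous (fun r => B (sg r)) r) by now apply (continuous_comp sg B).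
  assert (X2 : continuous (fun r => P (sg r)) r) by now apply (continuous_comp sg P).
  assert (X3 : continuous (fun r => b (sg r)) r) by now apply (continuous_comp sg b).
  assert (X4 : continuous (fun r => p (sg r)) r) by now apply (continuous_comp sg p).
  apply continuous_div_R.
  - repeat first [assumption | apply continuous_minus_R | apply continuous_mult_R].
  - repeat first [assumption | apply continuous_minus_R | apply continuous_mult_R].
  - now apply Rmult_integral_contrapositive.
Qed.

Lemma isolated_root (K : R -> R) (x l : R) : is_derive K x l -> l <> 0 ->
  exists e, 0 < e /\ forall y, Rabs (y - x) < e -> K y = K x -> y = x.
Proof.
  intros D N. apply is_derive_Reals in D.
  destruct (D (Rabs l)) as [d Hd]; [now apply Rabs_pos_lt|].
  exists d. split; [apply cond_pos|]. intros y Hy E.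
  destruct (Req_dec y x) as [e|ne]; [exact e|exfalso].
  specialize (Hd (y - x)). replace (x + (y - x)) with y in Hd by ring.
  rewrite E, Rminus_diag in Hd. unfold Rdiv in Hd. rewrite Rmult_0_l, Rminus_0_l, Rabs_Ropp in Hd.
  specialize (Hd ltac:(lra) Hy). lra.
Qed.

Lemma positive_after (F : R -> R) (l : R) : is_derive F 0 l -> F 0 = 0 -> 0 < l ->
  at_right 0 (fun e => 0 < F e).
Proof.
  intros D E P. apply is_derive_Reals in D.
  destruct (D l P) as [d Hd]. exists d. intros e He ep.
  change (Rabs (e - 0) < d) in He. rewrite Rminus_0_r in He.
  specialize (Hd e ltac:(lra) He). rewrite Rplus_0_l, E, Rminus_0_r in Hd.
  apply Rabs_def2 in Hd. assert (Q : 0 < F e / e) by lra.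
  replace (F e) with (F e / e * e) by (field; lra). now apply Rmult_lt_0_compat.
Qed.

Lemma eventually_forall (n : nat) (P : nat -> R -> Prop) :
  (forall j, (j < n)%nat -> at_right 0 (P j)) ->
  at_right 0 (fun e => forall j, (j < n)%nat -> P j e).
Proof.
  induction n as [|n IH]; intros H.
  - exists (mkposreal 1 Rlt_0_1). intros; lia.
  - assert (X := filter_and (F := at_right 0) _ _ (H n ltac:(lia)) (IH ltac:(intros; apply H; lia))).
    revert X. apply (filter_imp (F := at_right 0)). intros e [X1 X2] j Hj.
    destruct (Nat.eq_dec j n) as [->|ne]; [exact X1|apply X2; lia].
Qed.

(** * Half-return maps and isolated cycles *)

(** Twice the Lipschitz constant of inv_y_near, plus 1 for t itself. *)
Definition size_cst : R := 80 * exp 20 + 1.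

Lemma cst_pos : 1 < size_cst.
Proof. unfold size_cst. assert (X := exp_pos 20). lra. Qed.

Lemma inv_y_close sd i s t d : box sd -> 0 < d <= 1/4 -> - d <= s <= d -> - d <= t <= d ->
  Rabs (inv_y (zsign i) (sd i) (Hline (zsign i) (sd i) s) t - 1) <= size_cst * d.
Proof.
  intros B Hd Hs Ht.
  assert (W := inv_y_near sd i s t B ltac:(apply Rabs_le; lra) ltac:(apply Rabs_le; lra)).
  assert (E := exp_pos 20).
  assert (St : Rabs (s - t) <= 2 * d) by (apply Rabs_le; lra).
  assert (W' : 40 * exp 20 * Rabs (s - t) <= 40 * exp 20 * (2 * d)).
  { apply Rmult_le_compat_l; lra. }
  set (w := inv_y (zsign i) (sd i) (Hline (zsign i) (sd i) s) t) in *.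
  apply Rabs_le_inv in W. apply Rabs_le. unfold size_cst. lra.
Qed.

Lemma half_cycle_near sd s r i q d : box sd -> 0 < d <= 1/4 -> size_cst * d <= 1/2 ->
  - d <= s -> r <= d -> half_cycle sd s r i q ->
  Rabs (fst q - 2) <= 2 * d /\ Rabs (snd q - 1) <= 2 * (size_cst * d).
Proof.
  intros B Hd Hc Hs Hr Hq. assert (W := half_cycle_point _ _ _ _ _ Hq).
  destruct Hq as [[Hx [Ht Hy]] [Hsr _]].
  assert (C := inv_y_close sd i s (tcoord (fst q)) d B Hd ltac:(lra) ltac:(lra)).
  rewrite <- W in C. set (t := tcoord (fst q)) in *.
  assert (Ex : fst q - 2 = - t / (1 + t)).
  { rewrite <- (xcoord_tcoord (fst q) Hx) at 1. fold t. unfold xcoord. field. lra. }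
  split.
  - rewrite Ex. eapply Rle_trans; [apply (bound_frac _ _ (1/2) d); [lra|lra|]|lra].
    apply Rabs_le. lra.
  - apply Rabs_le_inv in C. set (w := / snd q) in *.
    assert (Ey : snd q - 1 = (1 - w) / w) by (unfold w; field; lra).
    rewrite Ey. eapply Rle_trans; [apply (bound_frac _ _ (1/2) (size_cst * d)); [lra|lra|]|lra].
    apply Rabs_le. lra.
Qed.

Lemma folded_base_sides : folded base_sides (fun _ => 0).
Proof.
  intros i. split; [destruct i; simpl; lra|]. split; [lra|]. split.
  - destruct i; unfold fold_poly; simpl; field.
  - intros t u. apply box_N, box_base_sides.
Qed.

(** Since both functions Hline are even, each pair (- s, s) spans a closed
    trajectory, and the return map is the identity. *)
Lemma monodromic_base : monodromic_pseudo_equilibrium (pwsys base_sides) (2, 1).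
Proof.
  split; [apply on_line_iff; simpl; ring|]. exists zone1. intros eps.
  assert (C := cst_pos). assert (Pe := cond_pos eps).
  set (dl := Rmin (1/4) (Rmin (/ (2 * size_cst)) (eps / (4 * size_cst)))).
  assert (I1 : 0 < / (2 * size_cst)) by (apply Rinv_0_lt_compat; lra).
  assert (I2 : 0 < eps / (4 * size_cst)) by (apply Rdiv_lt_0_compat; lra).
  assert (Hdl : 0 < dl) by (repeat apply Rmin_glb_lt; lra).
  exists (mkposreal _ Hdl). intros r [r0 rd]. simpl in rd.
  assert (d1 : r < 1/4) by (eapply Rlt_le_trans; [exact rd|apply Rmin_l]).
  assert (d2 : r < / (2 * size_cst)).
  { eapply Rlt_le_trans; [exact rd|]. eapply Rle_trans; [apply Rmin_r|apply Rmin_l]. }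
  assert (d3 : r < eps / (4 * size_cst)).
  { eapply Rlt_le_trans; [exact rd|]. eapply Rle_trans; [apply Rmin_r|apply Rmin_r]. }
  assert (c2 : size_cst * r <= 1/2).
  { apply Rlt_le, (Rmult_lt_reg_r (/ size_cst)); [apply Rinv_0_lt_compat; lra|].
    replace (size_cst * r * / size_cst) with r by (field; lra).
    replace (1/2 * / size_cst) with (/ (2 * size_cst)) by (field; lra). exact d2. }
  assert (c3 : 4 * (size_cst * r) < eps).
  { apply (Rmult_lt_reg_r (/ (4 * size_cst))); [apply Rinv_0_lt_compat; lra|].
    replace (4 * (size_cst * r) * / (4 * size_cst)) with r by (field; lra). exact d3. }
  set (s := r / (1 + r)).
  assert (Hs : 0 < s <= r).
  { unfold s. split; [apply Rdiv_lt_0_compat; lra|].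
    apply (Rmult_le_reg_r (1 + r)); [lra|]. unfold Rdiv. rewrite Rmult_assoc, Rinv_l by lra. nra. }
  assert (Ev : forall i, Hline (zsign i) (base_sides i) (- s) = Hline (zsign i) (base_sides i) s).
  { intros i. apply Hline_base_even. lra. }
  destruct (periodic_orbit base_sides (fun _ => 0) (- s) s folded_base_sides) as [g [T1 [T2 [H1 [H2 [P [Tr [A1 [A2 [E0 E1]]]]]]]]]].
  - lra.
  - lra.
  - intros _. lra.
  - exact Ev.
  - intros i t Ht.
    assert (W := inv_y_close base_sides i (- s) t r box_base_sides ltac:(lra) ltac:(lra) ltac:(lra)).
    apply Rabs_le_inv in W. lra.
  - assert (Es : t_at g 0 = - s) by (unfold t_at; rewrite E0; apply tcoord_xcoord; lra).
    assert (Er : t_at g T1 = s) by (unfold t_at; rewrite E1; apply tcoord_xcoord; lra).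
    assert (E2 : g (T1 + T2) = g 0) by (rewrite <- (P 0); f_equal; ring).
    assert (Ec : t_at g (T1 + T2) = - s) by (unfold t_at; rewrite E2; exact Es).
    assert (Orb := cycle_orbit base_sides _ g (T1 + T2) 0 T1 (T1 + T2) (- s) s folded_base_sides Tr
      ltac:(lra) P Ev A1 A2 Es Er Ec).
    assert (Pl : g 0 = line_point (pwsys base_sides) (2, 1) r).
    { rewrite E0. unfold line_point, xcoord, s; simpl. f_equal; field; lra. }
    exists g, (-1), T1, (T1 + T2), (T1 + T2 + 1), (s / (1 + s)), r.
    split; [lra|]. split; [lra|]. split; [lra|]. split; [lra|].
    split; [apply Rdiv_lt_0_compat; lra|]. split; [exact r0|].
    split; [intros u _; apply (proj1 Tr u I)|]. split; [exact Pl|].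
    split; [|split; [now rewrite E2|split; [|split]]].
    + rewrite E1. unfold line_point, xcoord; simpl. f_equal; field; lra.
    + intros u Hu. now apply A1.
    + intros u Hu. now apply A2.
    + intros u _. destruct (proj1 (Orb (g u))) as [i Hi]; [now exists u|].
      destruct (half_cycle_near base_sides (- s) s i (g u) r box_base_sides) as [N1 N2]; try lra; [exact Hi|].
      split.
      * change (Rabs (fst (g u) - 2) < eps). nra.
      * change (Rabs (snd (g u) - 1) < eps). lra.
Qed.

Definition perturbed (c : nat -> R) (e : R) (i : zone) : side := perturb (base_sides i) (direction c i) e.

(** To first order the images of t under the two half-return maps differ by a
    positive multiple of splitting c t; the point - t + e v is midway. *)
Lemma separating_point c t w : 0 < t < 1/4 -> 0 < w * splitting c t ->
  exists v, at_right 0 (fun e =>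
    0 < w * (Hline (-1) (perturbed c e zone1) (- t + e * v) - Hline (-1) (perturbed c e zone1) t) /\
    0 < w * (Hline 1 (perturbed c e zone2) t - Hline 1 (perturbed c e zone2) (- t + e * v))).
Proof.
  intros Ht HJ.
  assert (P := root4_pos t ltac:(lra)).
  set (h1 := t / root4 t). set (h2 := t * (1 - t * t) / (root4 t * root4 t * root4 t)).
  assert (P3 : 0 < root4 t * root4 t * root4 t) by (repeat apply Rmult_lt_0_compat; exact P).
  assert (Q1 : 0 < h1) by (apply Rdiv_lt_0_compat; lra).
  assert (Q2 : 0 < h2).
  { apply Rdiv_lt_0_compat; [|exact P3]. apply Rmult_lt_0_compat; nra. }
  set (v1 := level_var c zone1 t / h1). set (v2 := level_var c zone2 t / h2).
  assert (E : splitting c t = (v2 - v1) * (t * (1 - t * t))).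
  { rewrite splitting_level_var by lra. unfold v1, v2, h1, h2. field. repeat split; nra. }
  assert (Hv : 0 < w * (v2 - v1)).
  { rewrite E in HJ. replace (w * ((v2 - v1) * (t * (1 - t * t))))
      with (w * (v2 - v1) * (t * (1 - t * t))) in HJ by ring.
    assert (0 < t * (1 - t * t)) by (apply Rmult_lt_0_compat; nra).
    destruct (Rlt_or_le 0 (w * (v2 - v1))) as [l|l]; [exact l|]. nra. }
  set (v := (v1 + v2) / 2). exists v.
  assert (D1 : psi (base_sides zone1) (- t) * fold_poly (zsign zone1) (base_sides zone1) (- t) = h1).
  { rewrite Hline_base_derivative_1, root4_opp by lra. unfold h1. field. lra. }
  assert (D2 : psi (base_sides zone2) (- t) * fold_poly (zsign zone2) (base_sides zone2) (- t) = h2).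
  { rewrite Hline_base_derivative_2, root4_opp by lra. unfold h2. field. lra. }
  assert (F1 : is_derive (fun e => w * (Hline (-1) (perturbed c e zone1) (- t + e * v) - Hline (-1) (perturbed c e zone1) t)) 0
     (w * (h1 * (v - v1)))).
  { apply (is_derive_scal (fun e => Hline (-1) (perturbed c e zone1) (- t + e * v) - Hline (-1) (perturbed c e zone1) t)).
    evar_last.
    - apply (is_derive_minus (fun e => Hline (-1) (perturbed c e zone1) (- t + e * v)) (fun e => Hline (-1) (perturbed c e zone1) t)).
      + apply (derive_Hline_moving (zsign zone1) (base_sides zone1) (direction c zone1) (- t) v (zsign_sq _)); simpl; lra.
      + apply (derive_Hline_perturb (zsign zone1) (base_sides zone1) (direction c zone1) t); simpl; lra.
    - rewrite D1. unfold minus, plus, opp; simpl.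
      replace (h1 * (v - v1)) with (h1 * v - level_var c zone1 t) by (unfold v1; field; lra).
      unfold level_var; simpl. ring. }
  assert (F2 : is_derive (fun e => w * (Hline 1 (perturbed c e zone2) t - Hline 1 (perturbed c e zone2) (- t + e * v))) 0
     (w * (h2 * (v2 - v)))).
  { apply (is_derive_scal (fun e => Hline 1 (perturbed c e zone2) t - Hline 1 (perturbed c e zone2) (- t + e * v))).
    evar_last.
    - apply (is_derive_minus (fun e => Hline 1 (perturbed c e zone2) t) (fun e => Hline 1 (perturbed c e zone2) (- t + e * v))).
      + apply (derive_Hline_perturb (zsign zone2) (base_sides zone2) (direction c zone2) t); simpl; lra.
      + apply (derive_Hline_moving (zsign zone2) (base_sides zone2) (direction c zone2) (- t) v (zsign_sq _)); simpl; lra.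
    - rewrite D2. unfold minus, plus, opp; simpl.
      replace (h2 * (v2 - v)) with (level_var c zone2 t - h2 * v) by (unfold v2; field; lra).
      unfold level_var; simpl. ring. }
  assert (Z : forall i, Hline (zsign i) (perturbed c 0 i) (- t) = Hline (zsign i) (perturbed c 0 i) t).
  { intros i. unfold perturbed. rewrite perturb_0. apply Hline_base_even. lra. }
  assert (Z1 := Z zone1). assert (Z2 := Z zone2). simpl zsign in Z1, Z2.
  apply filter_and.
  - eapply positive_after; [exact F1| |].
    + rewrite Rmult_0_l, Rplus_0_r, Z1. ring.
    + unfold v. replace (w * (h1 * ((v1 + v2) / 2 - v1))) with (h1 * (w * (v2 - v1)) / 2) by field.
      assert (0 < h1 * (w * (v2 - v1))) by now apply Rmult_lt_0_compat. lra.
  - eapply positive_after; [exact F2| |].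
    + rewrite Rmult_0_l, Rplus_0_r, Z2. ring.
    + unfold v. replace (w * (h2 * (v2 - (v1 + v2) / 2))) with (h2 * (w * (v2 - v1)) / 2) by field.
      assert (0 < h2 * (w * (v2 - v1))) by now apply Rmult_lt_0_compat. lra.
Qed.

(** The half-return map of zone i exists and is differentiable beyond the fold,
    since Hline is strictly monotone with nonzero derivative on both sides. *)
Lemma partner sd z i lo b : folded sd z -> -(1/4) < lo < z i -> z i < b < 1/4 ->
  Hline (zsign i) (sd i) lo < Hline (zsign i) (sd i) b ->
  exists sg : R -> R, forall r, z i < r < b ->
    lo < sg r < z i /\ Hline (zsign i) (sd i) (sg r) = Hline (zsign i) (sd i) r /\
    continuous sg r /\
    is_derive sg r (psi (sd i) r * fold_poly (zsign i) (sd i) r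
                    / (psi (sd i) (sg r) * fold_poly (zsign i) (sd i) (sg r))).
Proof.
  intros G Hlo Hb Hlb. set (Hf := Hline (zsign i) (sd i)) in *.
  assert (HL : 1 < sL (sd i)) by apply G.
  assert (Df : forall x, -1 < x < 1 -> is_derive Hf x (psi (sd i) x * fold_poly (zsign i) (sd i) x)).
  { intros x Hx. apply is_derive_Hline; [apply zsign_sq|exact HL|exact Hx]. }
  assert (Cf : forall x, -1 < x < 1 -> continuous Hf x).
  { intros x Hx. eapply derive_continuous, Df, Hx. }
  assert (Ex : forall r, exists s, z i < r < b -> lo < s < z i /\ Hf s = Hf r).
  { intros r. destruct (Classical_Prop.classic (z i < r < b)) as [Hr|N]; [|now exists 0].
    assert (X1 : Hf b < Hf r) by (apply (Hline_decreasing sd z); auto; lra).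
    assert (X2 : Hf r < Hf (z i)) by (apply (Hline_decreasing sd z); auto; lra).
    destruct (IVT_interv (fun x => Hf x - Hf r) lo (z i)) as [s [Hs Es]]; [|lra|lra|lra|].
    - intros a Ha. apply continuity_pt_filterlim.
      apply (continuous_minus_R Hf (fun _ => Hf r)); [apply Cf; lra|apply continuous_const].
    - exists s. intros _. split; [|lra]. split.
      + destruct (Req_dec s lo) as [e|ne]; [rewrite e in Es; lra|lra].
      + destruct (Req_dec s (z i)) as [e|ne]; [rewrite e in Es; lra|lra]. }
  destruct (ClassicalChoice.choice _ Ex) as [sg Hsg].
  exists sg. intros r Hr. destruct (Hsg r Hr) as [S1 S2]. split; [exact S1|]. split; [exact S2|].
  assert (Cs : continuous sg r).
  { intros Q [e He].
    set (m := Rmin e (Rmin (sg r - lo) (z i - sg r))).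
    assert (Hm : 0 < m) by (repeat apply Rmin_glb_lt; try lra; apply cond_pos).
    assert (m1 : m <= e) by apply Rmin_l.
    assert (m2 : m <= sg r - lo) by (eapply Rle_trans; [apply Rmin_r|apply Rmin_l]).
    assert (m3 : m <= z i - sg r) by (eapply Rle_trans; [apply Rmin_r|apply Rmin_r]).
    assert (L1 : locally r (fun x => Hf (sg r - m / 2) < Hf x)).
    { apply (Cf r ltac:(lra) (fun y => Hf (sg r - m / 2) < y)). apply open_gt. rewrite <- S2.
      apply (Hline_increasing sd z); auto; lra. }
    assert (L2 : locally r (fun x => Hf x < Hf (sg r + m / 2))).
    { apply (Cf r ltac:(lra) (fun y => y < Hf (sg r + m / 2))). apply open_lt. rewrite <- S2.
      apply (Hline_increasing sd z); auto; lra. }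
    assert (L3 : locally r (fun x => z i < x)) by (apply open_gt; lra).
    assert (L4 : locally r (fun x => x < b)) by (apply open_lt; lra).
    change (locally r (fun x => Q (sg x))).
    generalize (filter_and _ _ (filter_and _ _ L1 L2) (filter_and _ _ L3 L4)).
    apply filter_imp. intros x [[X1 X2] [X3 X4]]. destruct (Hsg x ltac:(lra)) as [Y1 Y2].
    apply He. change (Rabs (sg x - sg r) < e). apply Rabs_def1.
    - destruct (Rle_or_lt (sg r + m / 2) (sg x)) as [l|l]; [|lra].
      assert (Hf (sg r + m / 2) <= Hf (sg x)); [|lra].
      destruct l as [l|l]; [|rewrite l; lra].
      apply Rlt_le, (Hline_increasing sd z); auto; lra.
    - destruct (Rle_or_lt (sg x) (sg r - m / 2)) as [l|l]; [|lra].
      assert (Hf (sg x) <= Hf (sg r - m / 2)); [|lra].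
      destruct l as [l|l]; [|rewrite l; lra].
      apply Rlt_le, (Hline_increasing sd z); auto; lra. }
  split; [exact Cs|].
  assert (Ch : forall x, -1 < x < 1 -> continuous (fun x => psi (sd i) x * fold_poly (zsign i) (sd i) x) x).
  { intros x Hx. apply continuous_mult_R; [now apply continuous_psi|].
    apply (ex_derive_continuous (fold_poly (zsign i) (sd i))). unfold fold_poly. auto_derive. exact I. }
  set (e := Rmin (r - z i) (b - r)).
  assert (He : 0 < e) by (apply Rmin_glb_lt; lra).
  assert (e1 : e <= r - z i) by apply Rmin_l. assert (e2 : e <= b - r) by apply Rmin_r.
  assert (He' : 0 < Rmin e (1/4)) by (apply Rmin_glb_lt; lra).
  assert (e3 := Rmin_l e (1/4)). assert (e4 := Rmin_r e (1/4)).
  destruct (G i) as [_ [Hz _]].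
  apply (implicit_derive Hf (fun x => psi (sd i) x * fold_poly (zsign i) (sd i) x) sg r (Rmin e (1/4)) He').
  - intros x Hx. apply Rabs_def2 in Hx. apply Df. lra.
  - intros x Hx. apply Rabs_def2 in Hx. apply Df. lra.
  - apply Ch. lra.
  - apply Ch. lra.
  - apply Rgt_not_eq, Rmult_lt_0_compat; [apply psi_pos; [exact HL|lra]|].
    apply (N_sign_left sd z); [exact G|lra].
  - exact Cs.
  - intros x Hx. apply Rabs_def2 in Hx. apply Hsg. lra.
Qed.

Lemma decreasing_points (x : nat -> R) : (forall j, (j < 6)%nat -> x (S j) < x j) ->
  forall i j, (i <= j)%nat -> (j < 7)%nat -> x j <= x i.
Proof.
  intros Hx i j Hij. induction Hij as [|j Hij IH]; intros Hj; [lra|].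
  assert (Y := Hx j ltac:(lia)). specialize (IH ltac:(lia)). lra.
Qed.

Lemma min_positive (n : nat) (g : nat -> R) : (forall j, (j < n)%nat -> 0 < g j) ->
  exists m, 0 < m /\ forall j, (j < n)%nat -> m <= g j.
Proof.
  induction n as [|n IH]; intros H.
  - exists 1. split; [lra|intros; lia].
  - destruct IH as [m [Hm Hj]]; [intros; apply H; lia|].
    exists (Rmin m (g n)). split; [apply Rmin_glb_lt; [exact Hm|apply H; lia]|].
    intros j Hjn. destruct (Nat.eq_dec j n) as [->|ne]; [apply Rmin_r|].
    eapply Rle_trans; [apply Rmin_l|apply Hj; lia].
Qed.

Definition set_f (sd : zone -> side) (f : R) (i : zone) : side :=
  match i with
  | zone1 => sd zone1
  | zone2 => Side (sL (sd zone2)) (sal (sd zone2)) (sga (sd zone2)) f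
  end.

Lemma Hline_set_f sd f t :
  Hline 1 (set_f sd f zone2) t = Hline 1 (set_f sd 0 zone2) t + f * Psi (sd zone2) t.
Proof.
  unfold Hline; simpl.
  change (Psi (Side (sL (sd zone2)) (sal (sd zone2)) (sga (sd zone2)) f) t) with (Psi (sd zone2) t).
  change (Psi (Side (sL (sd zone2)) (sal (sd zone2)) (sga (sd zone2)) 0) t) with (Psi (sd zone2) t).
  change (Phi (Side (sL (sd zone2)) (sal (sd zone2)) (sga (sd zone2)) f) t) with (Phi (sd zone2) t).
  change (Phi (Side (sL (sd zone2)) (sal (sd zone2)) (sga (sd zone2)) 0) t) with (Phi (sd zone2) t).
  ring.
Qed.

Lemma set_f_id sd : set_f sd (sf (sd zone2)) zone2 = sd zone2.
Proof. simpl. now destruct (sd zone2). Qed.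

Lemma sign_pow j : (-1) ^ j = 1 \/ (-1) ^ j = -1.
Proof. induction j as [|j [IH|IH]]; simpl; [left; ring|right|left]; rewrite IH; ring. Qed.

(** Since Hline of zone 2 is affine in f, the pair (sg r, r) solves both level
    equations exactly when f = K(r).  The hypotheses make f - K change sign six
    times, and a regular value of K nearby keeps these changes and makes the
    zeros simple. *)
Lemma isolated_solutions sd z x s lo b tau rho :
  folded sd z -> (forall i, - tau < z i < tau) -> 0 < tau -> tau < x 6%nat ->
  (forall j, (j < 6)%nat -> x (S j) < x j) -> x 0%nat < b < 1/4 ->
  -(1/4) < lo -> lo < - tau ->
  Hline (-1) (sd zone1) lo < Hline (-1) (sd zone1) b ->
  Hline (-1) (sd zone1) (x 6%nat) < Hline (-1) (sd zone1) (- tau) ->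
  (forall j, (j < 7)%nat -> lo < s j < - tau /\
     0 < (-1) ^ j * (Hline (-1) (sd zone1) (s j) - Hline (-1) (sd zone1) (x j)) /\
     0 < (-1) ^ j * (Hline 1 (sd zone2) (x j) - Hline 1 (sd zone2) (s j))) ->
  0 < rho ->
  exists f, Rabs (f - sf (sd zone2)) < rho /\
    forall j, (j < 6)%nat -> exists r s' eta, x (S j) < r < x j /\ lo < s' < r /\ 0 < eta /\
      (forall i, Hline (zsign i) (set_f sd f i) s' = Hline (zsign i) (set_f sd f i) r) /\
      (forall s' r', -(1/4) < s' -> s' < r' -> r' < 1/4 -> Rabs (r' - r) < eta ->
         (forall i, Hline (zsign i) (set_f sd f i) s' = Hline (zsign i) (set_f sd f i) r') -> r' = r).
Proof.
  intros G Hz Ht0 Ht6 Hx Hb Hlo Hlt Hlb Htau Hs Hrho.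
  assert (Hz1 := Hz zone1). assert (Hz2 := Hz zone2).
  assert (HL : 1 < sL (sd zone2)) by apply G.
  assert (Mon := decreasing_points x Hx).
  assert (Xr : forall j, (j < 7)%nat -> x 6%nat <= x j <= x 0%nat).
  { intros j Hj. split; apply Mon; lia. }
  assert (Xr0 := Xr 0%nat ltac:(lia)).
  destruct (partner sd z zone1 lo b G) as [sg Hsg]; [lra|lra|exact Hlb|]. simpl zsign in Hsg.
  set (P := Psi (sd zone2)). set (B := fun t => - Hline 1 (set_f sd 0 zone2) t).
  set (bb := fun t => - (psi (sd zone2) t * fold_poly 1 (set_f sd 0 zone2) t)).
  set (sg' := fun r => psi (sd zone1) r * fold_poly (-1) (sd zone1) r
                    / (psi (sd zone1) (sg r) * fold_poly (-1) (sd zone1) (sg r))).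
  (* Hline of zone 2 is - B + f P. *)
  set (K := fun r => (B r - B (sg r)) / (P r - P (sg r))).
  set (K' := chord_slope B P bb (psi (sd zone2)) sg sg').
  assert (DP : forall t, -1 < t < 1 -> is_derive P t (psi (sd zone2) t)).
  { intros t Ht. now apply is_derive_Psi. }
  assert (DB : forall t, -1 < t < 1 -> is_derive B t (bb t)).
  { intros t Ht. apply (is_derive_opp (Hline 1 (set_f sd 0 zone2))).
    apply (is_derive_Hline 1 (set_f sd 0 zone2)); [ring|exact HL|exact Ht]. }
  assert (Inc : forall r, z zone1 < r < b -> 0 < P r - P (sg r)).
  { intros r Hr. destruct (Hsg r Hr) as [S1 _].
    assert (P (sg r) < P r); [|lra].
    apply (increasing_of_derive P (psi (sd zone2))); [lra| | |].
    - intros y Hy. apply DP. lra.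
    - intros y Hy. eapply derive_continuous, DP. lra.
    - intros y Hy. apply psi_pos; [exact HL|lra]. }
  assert (DK : forall r, z zone1 < r < b -> is_derive K r (K' r)).
  { intros r Hr. destruct (Hsg r Hr) as [S1 [_ [_ D]]]. assert (Y := Inc r Hr).
    apply chord_slope_derive; [apply DB|apply DP|apply DB|apply DP| |]; try lra. exact D. }
  assert (Cpsi : forall i t, -1 < t < 1 -> continuous (psi (sd i)) t).
  { intros i t Ht. apply continuous_psi; [apply G|exact Ht]. }
  assert (CN : forall k s t, continuous (fold_poly k s) t).
  { intros k s' t. apply (ex_derive_continuous (fold_poly k s')). unfold fold_poly. auto_derive. exact I. }
  assert (CK : forall r, z zone1 < r < b -> continuous K' r).
  { intros r Hr. destruct (Hsg r Hr) as [S1 [_ [Cs _]]]. assert (Y := Inc r Hr).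
    assert (Cb : forall t, -1 < t < 1 -> continuous bb t).
    { intros t Ht. apply (continuous_opp (fun t => psi (sd zone2) t * fold_poly 1 (set_f sd 0 zone2) t)).
      apply continuous_mult_R; [now apply Cpsi|apply CN]. }
    assert (CB : forall t, -1 < t < 1 -> continuous B t).
    { intros t Ht. eapply derive_continuous, DB, Ht. }
    assert (CP : forall t, -1 < t < 1 -> continuous P t).
    { intros t Ht. eapply derive_continuous, DP, Ht. }
    assert (R1 : -1 < r < 1) by lra. assert (R2 : -1 < sg r < 1) by lra.
    apply chord_slope_continuous;
      [apply CB|apply CP|apply Cb|apply Cpsi|apply CB|apply CP|apply Cb|apply Cpsi| | |];
      try assumption; [|lra].
    apply continuous_div_R.
    - apply continuous_mult_R; [apply Cpsi; lra|apply CN].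
    - apply (continuous_comp sg (fun y => psi (sd zone1) y * fold_poly (-1) (sd zone1) y)); [exact Cs|].
      apply continuous_mult_R; [apply Cpsi; lra|apply CN].
    - apply Rgt_not_eq, Rmult_lt_0_compat; [apply psi_pos; [apply G|lra]|].
      apply (N_sign_left sd z zone1); [exact G|lra]. }
  assert (Gap : forall f r, z zone1 < r < b ->
     Hline 1 (set_f sd f zone2) r - Hline 1 (set_f sd f zone2) (sg r) = (f - K r) * (P r - P (sg r))).
  { intros f r Hr. assert (Y := Inc r Hr). rewrite !(Hline_set_f sd f). fold P. unfold K, B. field. lra. }
  assert (Sgn : forall j, (j < 7)%nat -> 0 < (-1) ^ j * (sf (sd zone2) - K (x j))).
  { intros j Hj. assert (Xj := Xr j Hj). destruct (Hs j Hj) as [Sj [S1 S2]].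
    assert (Rj : z zone1 < x j < b) by lra.
    destruct (Hsg (x j) Rj) as [T1 [T2 _]]. assert (Y := Inc _ Rj).
    assert (Gp := Gap (sf (sd zone2)) (x j) Rj). rewrite set_f_id in Gp.
    (* This places sg (x j) to the left of both folds, where the two functions
       Hline increase. *)
    assert (T3 : sg (x j) < - tau).
    { destruct (Rlt_or_le (sg (x j)) (- tau)) as [l|l]; [exact l|exfalso].
      assert (Hline (-1) (sd zone1) (- tau) <= Hline (-1) (sd zone1) (sg (x j))).
      { destruct l as [l|l]; [|rewrite l; lra].
        apply Rlt_le, (Hline_increasing sd z zone1); auto; lra. }
      assert (Hline (-1) (sd zone1) (x j) <= Hline (-1) (sd zone1) (x 6%nat)); [|lra].
      destruct (proj1 Xj) as [l'|l']; [|rewrite l'; lra].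
      apply Rlt_le, (Hline_decreasing sd z zone1); auto; lra. }
    destruct (sign_pow j) as [e|e]; rewrite e in *.
    - assert (sg (x j) < s j).
      { destruct (Rlt_or_le (sg (x j)) (s j)) as [l|l]; [exact l|exfalso].
        destruct l as [l|l]; [|rewrite l in S1; lra].
        assert (X := Hline_increasing sd z zone1 (s j) (sg (x j)) G). simpl in X. lra. }
      assert (X := Hline_increasing sd z zone2 (sg (x j)) (s j) G). simpl in X.
      assert (0 < (sf (sd zone2) - K (x j)) * (P (x j) - P (sg (x j)))) by lra.
      destruct (Rlt_or_le 0 (sf (sd zone2) - K (x j))) as [l|l]; [lra|nra].
    - assert (s j < sg (x j)).
      { destruct (Rlt_or_le (s j) (sg (x j))) as [l|l]; [exact l|exfalso].
        destruct l as [l|l]; [|rewrite l in T2; lra].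
        assert (X := Hline_increasing sd z zone1 (sg (x j)) (s j) G). simpl in X. lra. }
      assert (X := Hline_increasing sd z zone2 (s j) (sg (x j)) G). simpl in X.
      assert ((sf (sd zone2) - K (x j)) * (P (x j) - P (sg (x j))) < 0) by lra.
      destruct (Rlt_or_le 0 (- (sf (sd zone2) - K (x j)))) as [l|l]; [lra|nra]. }
  destruct (min_positive 7 (fun j => (-1) ^ j * (sf (sd zone2) - K (x j))) Sgn) as [m [Hm Hmj]].
  assert (Hrm : 0 < Rmin rho m) by now apply Rmin_glb_lt.
  assert (x06 : x 6%nat < x 0%nat).
  { assert (Y := Hx 5%nat ltac:(lia)). assert (Y' := Mon 0%nat 5%nat ltac:(lia) ltac:(lia)). lra. }
  destruct (regular_value K K' (x 6%nat) (x 0%nat) (sf (sd zone2) - Rmin rho m) (sf (sd zone2) + Rmin rho m))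
    as [f [Hf Reg]]; [exact x06|lra| | |].
  { intros r Hr. apply DK. lra. }
  { intros r Hr. apply CK. lra. }
  assert (f1 := Rmin_l rho m). assert (f2 := Rmin_r rho m).
  exists f. split; [apply Rabs_def1; lra|]. intros j Hj.
  assert (Sf : forall j, (j < 7)%nat -> 0 < (-1) ^ j * (f - K (x j))).
  { intros k Hk. specialize (Hmj k Hk). simpl in Hmj. destruct (sign_pow k) as [e|e]; rewrite e in *; lra. }
  assert (Xj := Xr j ltac:(lia)). assert (XSj := Xr (S j) ltac:(lia)). assert (Xd := Hx j Hj).
  assert (Sa := Sf j ltac:(lia)). assert (Sb := Sf (S j) ltac:(lia)). simpl pow in Sb.
  destruct (IVT_interv (fun y => (-1) ^ j * (f - K y)) (x (S j)) (x j)) as [r [Hr Er]].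
  { intros y Hy. apply continuity_pt_filterlim.
    apply (continuous_mult_R (fun _ => (-1) ^ j) (fun y => f - K y)); [apply continuous_const|].
    apply (continuous_minus_R (fun _ => f) K); [apply continuous_const|].
    eapply derive_continuous, DK. lra. }
  { exact Xd. }
  { lra. }
  { exact Sa. }
  assert (Ek : K r = f) by (destruct (sign_pow j) as [e|e]; rewrite e in Er; lra).
  assert (Hr' : x (S j) < r < x j).
  { split.
    - destruct (Req_dec r (x (S j))) as [e|ne]; [|lra]. rewrite <- e in Sb. lra.
    - destruct (Req_dec r (x j)) as [e|ne]; [|lra]. rewrite <- e in Sa. lra. }
  assert (Rr : z zone1 < r < b) by lra.
  destruct (isolated_root K r (K' r)) as [e0 [He0 Iso]]; [now apply DK|apply Reg; lra|].
  destruct (Hsg r Rr) as [T1 [T2 _]].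
  set (eta := Rmin e0 (Rmin (r - x (S j)) (x j - r))).
  assert (n1 : eta <= e0) by apply Rmin_l.
  assert (n2 : eta <= r - x (S j)) by (eapply Rle_trans; [apply Rmin_r|apply Rmin_l]).
  assert (n3 : eta <= x j - r) by (eapply Rle_trans; [apply Rmin_r|apply Rmin_r]).
  exists r, (sg r), eta. split; [exact Hr'|]. split; [lra|].
  split; [repeat apply Rmin_glb_lt; lra|]. split.
  - intros [|]; simpl zsign; [exact T2|].
    assert (Gp := Gap f r Rr). rewrite Ek in Gp. lra.
  - intros s' r' Hs' Hsr Hr1 Hd Hall. apply Rabs_def2 in Hd.
    assert (Rr' : z zone1 < r' < b) by lra.
    destruct (Hsg r' Rr') as [U1 [U2 _]].
    assert (A1 := Hall zone1). assert (A2 := Hall zone2). simpl zsign in A1, A2.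
    assert (S1 : s' < z zone1 < r') by (apply (level_sides sd z zone1); auto).
    assert (Es : s' = sg r').
    { apply Rle_antisym; apply (Hline_inj_left sd z zone1); auto; try lra; simpl;
        rewrite U2; change (sd zone1) with (set_f sd f zone1); lra. }
    apply Iso; [apply Rabs_def1; lra|].
    assert (Gp := Gap f r' Rr'). rewrite <- Es, A2, Rminus_diag in Gp.
    assert (Y := Inc r' Rr'). rewrite <- Es in Y.
    symmetry in Gp. apply Rmult_integral in Gp. destruct Gp as [Gp|Gp]; lra.
Qed.

(** * The perturbed system *)

Lemma eventually_close (F : R -> R) (m : R) : ex_derive F 0 -> 0 < m ->
  at_right 0 (fun e => Rabs (F e - F 0) < m).
Proof.
  intros D Hm. destruct (ex_derive_continuous F 0 D (ball (F 0) (mkposreal m Hm))) as [d Hd].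
  { now exists (mkposreal m Hm). }
  exists d. intros e He _. exact (Hd e He).
Qed.

Lemma eventually_lt (F G : R -> R) : ex_derive F 0 -> ex_derive G 0 -> F 0 < G 0 ->
  at_right 0 (fun e => F e < G e).
Proof.
  intros DF DG H.
  assert (X := filter_and (F := at_right 0) _ _ (eventually_close F ((G 0 - F 0) / 2) DF ltac:(lra))
    (eventually_close G ((G 0 - F 0) / 2) DG ltac:(lra))).
  revert X. apply (filter_imp (F := at_right 0)). intros e [X1 X2].
  apply Rabs_def2 in X1, X2. lra.
Qed.

Lemma perturbed_0 c i : perturbed c 0 i = base_sides i.
Proof. apply perturb_0. Qed.

(** Distance to the unperturbed parameters; the two contributions in
    near_base_set_f come from the perturbation and from the choice of f. *)
Definition near_base (m : R) (sd : zone -> side) : Prop := forall i,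
  Rabs (sL (sd i) - sL (base_sides i)) < m /\ Rabs (sal (sd i) - sal (base_sides i)) < m /\
  Rabs (sga (sd i) - sga (base_sides i)) < m /\ Rabs (sf (sd i) - sf (base_sides i)) < m.

Lemma eventually_near_base c m : 0 < m -> at_right 0 (fun e => near_base m (perturbed c e)).
Proof.
  intros Hm.
  assert (X : forall i, at_right 0 (fun e =>
    Rabs (sL (perturbed c e i) - sL (base_sides i)) < m /\ Rabs (sal (perturbed c e i) - sal (base_sides i)) < m /\
    Rabs (sga (perturbed c e i) - sga (base_sides i)) < m /\ Rabs (sf (perturbed c e i) - sf (base_sides i)) < m)).
  { intros i. rewrite <- (perturbed_0 c i).
    repeat apply filter_and;
      [apply (eventually_close (fun e => sL (perturbed c e i)))
      |apply (eventually_close (fun e => sal (perturbed c e i)))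
      |apply (eventually_close (fun e => sga (perturbed c e i)))
      |apply (eventually_close (fun e => sf (perturbed c e i)))];
      try exact Hm; unfold perturbed, perturb; simpl; auto_derive; exact I. }
  assert (Y := filter_and (F := at_right 0) _ _ (X zone1) (X zone2)).
  revert Y. apply (filter_imp (F := at_right 0)). intros e [Y1 Y2] [|]; assumption.
Qed.

Lemma near_base_set_f m1 m2 sd f : near_base m1 sd -> Rabs (f - sf (sd zone2)) < m2 ->
  near_base (m1 + m2) (set_f sd f).
Proof.
  intros N Hf. assert (P := Rabs_pos (f - sf (sd zone2))).
  intros i. destruct (N i) as [N1 [N2 [N3 N4]]]. destruct i; simpl in *; repeat split; try lra.
  replace (f - 8) with ((f - sf (sd zone2)) + (sf (sd zone2) - 8)) by ring.
  eapply Rle_lt_trans; [apply Rabs_triang|]. lra.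
Qed.

Lemma near_base_box m sd : m <= 1/50 -> near_base m sd -> box sd.
Proof. intros Hm N i. destruct (N i) as [N1 [N2 [N3 N4]]]. lra. Qed.

Lemma near_base_close m eta sd : 0 < m <= 1 -> 8 * m <= eta -> near_base m sd ->
  coefficients_close eta (pwsys base_sides) (pwsys sd).
Proof.
  intros Hm He N.
  split; [|simpl; rewrite !Rminus_diag, Rabs_R0; lra].
  intros i. destruct (N i) as [N1 [N2 [N3 N4]]].
  assert (HL : sL (base_sides i) = 2) by now destruct i.
  assert (Ha : Rabs (sal (base_sides i)) <= 1).
  { apply Rabs_le. destruct i; simpl; lra. }
  assert (Hg : Rabs (sga (base_sides i)) <= 1).
  { apply Rabs_le. destruct i; simpl; lra. }
  rewrite HL in N1. apply Rabs_le_inv in Ha, Hg. apply Rabs_def2 in N1, N2, N3, N4.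
  set (L := sL (sd i)) in *. set (a := sal (sd i)) in *. set (g := sga (sd i)) in *.
  set (a0 := sal (base_sides i)) in *. set (g0 := sga (base_sides i)) in *.
  assert (Ka : Rabs (a * (L + 2) - a0 * 4) < 8 * m).
  { apply Rabs_def1; nra. }
  assert (Kg : Rabs (g * (1 + L) - g0 * 3) < 8 * m).
  { apply Rabs_def1; nra. }
  assert (Zs : forall y, Rabs (zsign i * y) = Rabs y).
  { intros y. destruct i; simpl; [|f_equal; ring].
    replace (-1 * y) with (- y) by ring. apply Rabs_Ropp. }
  unfold kolmogorov_close, pwsys, lv_field; simpl. rewrite HL. fold L a g a0 g0.
  replace (- zsign i * (2 + L) - - zsign i * (2 + 2)) with (zsign i * (2 - L)) by ring.
  replace (zsign i * (1 + L) - zsign i * (1 + 2)) with (zsign i * (L - 2)) by ring.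
  replace (- zsign i * a * (L + 2) - - zsign i * a0 * (2 + 2))
    with (zsign i * - (a * (L + 2) - a0 * 4)) by ring.
  replace (- zsign i * g * (1 + L) - - zsign i * g0 * (1 + 2))
    with (zsign i * - (g * (1 + L) - g0 * 3)) by ring.
  rewrite !Zs, Rminus_diag, Rabs_R0, !Rabs_Ropp.
  repeat split; try lra; apply Rabs_def1; lra.
Qed.

Lemma ex_derive_Hline c i t : -1 < t < 1 -> ex_derive (fun e => Hline (zsign i) (perturbed c e i) t) 0.
Proof.
  intros Ht. eexists. apply derive_Hline_perturb; [destruct i; simpl; lra|exact Ht].
Qed.

Lemma ex_derive_fold_poly c i t : ex_derive (fun e => fold_poly (zsign i) (perturbed c e i) t) 0.
Proof. unfold fold_poly, perturbed, perturb; simpl. auto_derive. exact I. Qed.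

Lemma base_H1_order t u : 0 < t -> t < u -> u < 1/4 ->
  Hline (-1) (base_sides zone1) u < Hline (-1) (base_sides zone1) t.
Proof. intros Ht tu Hu. apply (Hline_decreasing base_sides _ zone1 t u folded_base_sides); lra. Qed.

Lemma base_N_signs i t : 0 < t < 1/4 ->
  fold_poly (zsign i) (base_sides i) t < 0 < fold_poly (zsign i) (base_sides i) (- t).
Proof.
  intros Ht. split.
  - apply (N_sign_right base_sides _ i t folded_base_sides). lra.
  - apply (N_sign_left base_sides _ i (- t) folded_base_sides). lra.
Qed.

(** For a direction c with alternating signs of splitting c at seven points, a
    short step decides the order of the two half-return maps at these points;
    the other conditions are open and hold for the unperturbed system. *)
Lemma interlaced_perturbation (d m : R) : 0 < d < 1/8 -> 0 < m ->
  exists (sd : zone -> side) (x s : nat -> R) (lo b tau : R),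
    near_base m sd /\ 0 < tau /\ tau < x 6%nat /\ (forall j, (j < 6)%nat -> x (S j) < x j) /\
    x 0%nat < b < 2 * d /\ - (2 * d) < lo /\ lo < - tau /\
    (forall i, fold_poly (zsign i) (sd i) tau < 0 < fold_poly (zsign i) (sd i) (- tau)) /\
    Hline (-1) (sd zone1) lo < Hline (-1) (sd zone1) b /\
    Hline (-1) (sd zone1) (x 6%nat) < Hline (-1) (sd zone1) (- tau) /\
    (forall j, (j < 7)%nat -> lo < s j < - tau /\
     0 < (-1) ^ j * (Hline (-1) (sd zone1) (s j) - Hline (-1) (sd zone1) (x j)) /\
     0 < (-1) ^ j * (Hline 1 (sd zone2) (x j) - Hline 1 (sd zone2) (s j))).
Proof.
  intros Hd Hm.
  destruct (interpolation d ltac:(lra) 7 (le_n 7)) as [x [Hx [Hdec Hv]]].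
  destruct (Hv (fun j => (-1) ^ j)) as [c [_ Hc]].
  assert (Hx0 := Hx 0%nat ltac:(lia)). assert (Hx6 := Hx 6%nat ltac:(lia)).
  (* The folds stay in (- tau, tau); lo and b give the half-return map of zone 1
     room on both sides. *)
  set (tau := x 6%nat / 2). set (lo := - (3/2 * x 0%nat)). set (b := 5/4 * x 0%nat).
  assert (Xr : forall j, (j < 7)%nat -> x 6%nat <= x j <= x 0%nat).
  { intros j Hj. split.
    - destruct (Nat.eq_dec j 6) as [->|ne]; [lra|]. apply Rlt_le, Hdec; lia.
    - destruct (Nat.eq_dec j 0) as [->|ne]; [lra|]. apply Rlt_le, Hdec; lia. }
  assert (Hv' : forall j, exists v, (j < 7)%nat -> at_right 0 (fun e =>
    0 < (-1) ^ j * (Hline (-1) (perturbed c e zone1) (- x j + e * v) - Hline (-1) (perturbed c e zone1) (x j)) /\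
    0 < (-1) ^ j * (Hline 1 (perturbed c e zone2) (x j) - Hline 1 (perturbed c e zone2) (- x j + e * v)))).
  { intros j. destruct (Classical_Prop.classic (j < 7)%nat) as [Hj|N]; [|exists 0; tauto].
    destruct (separating_point c (x j) ((-1) ^ j)) as [v Ev].
    - assert (Y := Hx j Hj). lra.
    - rewrite Hc by exact Hj. destruct (sign_pow j) as [e|e]; rewrite e; lra.
    - now exists v. }
  destruct (ClassicalChoice.choice _ Hv') as [v Ev].
  assert (F1 : at_right 0 (fun e => near_base m (perturbed c e))) by now apply eventually_near_base.
  assert (F2 : forall i, at_right 0 (fun e => fold_poly (zsign i) (perturbed c e i) tau < 0 < fold_poly (zsign i) (perturbed c e i) (- tau))).
  { intros i. assert (Y := base_N_signs i tau ltac:(unfold tau; lra)). rewrite <- (perturbed_0 c i) in Y.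
    apply filter_and.
    - apply (eventually_lt (fun e => fold_poly (zsign i) (perturbed c e i) tau) (fun _ => 0));
        [apply ex_derive_fold_poly|apply ex_derive_const|apply Y].
    - apply (eventually_lt (fun _ => 0) (fun e => fold_poly (zsign i) (perturbed c e i) (- tau)));
        [apply ex_derive_const|apply ex_derive_fold_poly|apply Y]. }
  assert (F3 : at_right 0 (fun e => Hline (-1) (perturbed c e zone1) lo < Hline (-1) (perturbed c e zone1) b)).
  { apply (eventually_lt (fun e => Hline (-1) (perturbed c e zone1) lo) (fun e => Hline (-1) (perturbed c e zone1) b)).
    - apply (ex_derive_Hline c zone1). unfold lo. lra.
    - apply (ex_derive_Hline c zone1). unfold b. lra.
    - rewrite perturbed_0. unfold lo. rewrite (Hline_base_even zone1) by lra. apply base_H1_order; unfold b; lra. }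
  assert (F4 : at_right 0 (fun e => Hline (-1) (perturbed c e zone1) (x 6%nat) < Hline (-1) (perturbed c e zone1) (- tau))).
  { apply (eventually_lt (fun e => Hline (-1) (perturbed c e zone1) (x 6%nat)) (fun e => Hline (-1) (perturbed c e zone1) (- tau))).
    - apply (ex_derive_Hline c zone1). lra.
    - apply (ex_derive_Hline c zone1). unfold tau. lra.
    - rewrite perturbed_0. rewrite (Hline_base_even zone1) by (unfold tau; lra). apply base_H1_order; unfold tau; lra. }
  assert (F5 : at_right 0 (fun e => forall j, (j < 7)%nat ->
    (lo < - x j + e * v j /\ - x j + e * v j < - tau) /\
    0 < (-1) ^ j * (Hline (-1) (perturbed c e zone1) (- x j + e * v j) - Hline (-1) (perturbed c e zone1) (x j)) /\
    0 < (-1) ^ j * (Hline 1 (perturbed c e zone2) (x j) - Hline 1 (perturbed c e zone2) (- x j + e * v j)))).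
  { apply eventually_forall. intros j Hj. assert (Y := Xr j Hj).
    apply filter_and; [apply filter_and|now apply Ev].
    - apply (eventually_lt (fun _ => lo) (fun e => - x j + e * v j)).
      + apply ex_derive_const.
      + auto_derive. exact I.
      + unfold lo. lra.
    - apply (eventually_lt (fun e => - x j + e * v j) (fun _ => - tau)).
      + auto_derive. exact I.
      + apply ex_derive_const.
      + unfold tau. lra. }
  destruct (filter_ex (F := at_right 0) _ (filter_and (F := at_right 0) _ _
     (filter_and (F := at_right 0) _ _ F1 (filter_and (F := at_right 0) _ _ (F2 zone1) (F2 zone2)))
     (filter_and (F := at_right 0) _ _ F5 (filter_and (F := at_right 0) _ _ F3 F4))))
    as [e [[E1 [E2 E2']] [E5 [E3 E4]]]].
  exists (perturbed c e), x, (fun j => - x j + e * v j), lo, b, tau.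
  split; [exact E1|]. split; [unfold tau; lra|]. split; [unfold tau; lra|].
  split; [intros j Hj; apply Hdec; lia|]. split; [unfold b; lra|]. split; [unfold lo; lra|].
  assert (X60 := Xr 0%nat ltac:(lia)).
  split; [unfold lo, tau; lra|]. split; [intros [|]; assumption|]. split; [exact E3|].
  split; [exact E4|]. exact E5.
Qed.

Theorem theorem1p1 :
  exists (S0 : pw_system) (p : R * R),
    h_degree_one S0 /\
    monodromic_pseudo_equilibrium S0 p /\
    forall (U : R * R -> Prop) (eta : R), locally p U -> 0 < eta ->
      exists S : pw_system,
        h_degree_one S /\
        coefficients_close eta S0 S /\
        has_crossing_limit_cycles S 6 U.
Proof.
  exists (pwsys base_sides), (2, 1). split; [left; simpl; lra|]. split; [apply monodromic_base|].
  intros U eta [th HU] Heta. assert (C := cst_pos). assert (Pth := cond_pos th).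
  (* With |t| <= 2 d along the cycles, 1/y stays within 1/2 of 1 and the cycles
     stay in the ball of radius th. *)
  set (d := Rmin (1/10) (Rmin (/ (4 * size_cst)) (th / (8 * size_cst)))).
  assert (I1 : 0 < / (4 * size_cst)) by (apply Rinv_0_lt_compat; lra).
  assert (I2 : 0 < th / (8 * size_cst)) by (apply Rdiv_lt_0_compat; lra).
  assert (Hd : 0 < d) by (repeat apply Rmin_glb_lt; lra).
  assert (d1 : d <= 1/10) by apply Rmin_l.
  assert (d2 : d <= / (4 * size_cst)) by (eapply Rle_trans; [apply Rmin_r|apply Rmin_l]).
  assert (d3 : d <= th / (8 * size_cst)) by (eapply Rle_trans; [apply Rmin_r|apply Rmin_r]).
  assert (c2 : size_cst * (2 * d) <= 1/2).
  { apply (Rmult_le_compat_l size_cst) in d2; [|lra].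
    replace (size_cst * / (4 * size_cst)) with (1/4) in d2 by (field; lra). lra. }
  assert (c3 : 4 * (size_cst * d) <= th / 2).
  { apply (Rmult_le_compat_l size_cst) in d3; [|lra].
    replace (size_cst * (th / (8 * size_cst))) with (th / 8) in d3 by (field; lra). lra. }
  set (m := Rmin (1/100) (eta / 16)).
  assert (Hm : 0 < m) by (apply Rmin_glb_lt; lra).
  assert (m1 : m <= 1/100) by apply Rmin_l. assert (m2 : m <= eta / 16) by apply Rmin_r.
  destruct (interlaced_perturbation d m ltac:(lra) Hm)
    as [sd [x [s [lo [b [tau [N0 [Ht0 [Ht6 [Hx [Hb [Hlo [Hlt [HN [Hlb [Htau Hs]]]]]]]]]]]]]]]].
  assert (Mon := decreasing_points x Hx).
  assert (x0 : forall j, (j < 7)%nat -> tau < x j).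
  { intros j Hj. assert (Y := Mon j 6%nat ltac:(lia) ltac:(lia)). lra. }
  assert (X0 := x0 0%nat ltac:(lia)).
  destruct (folded_of_box sd tau (near_base_box m sd ltac:(lra) N0) ltac:(lra) HN) as [z [Gz Hz]].
  destruct (min_positive 2 (fun k => match k with
     O => - fold_poly 1 (sd zone2) tau | _ => fold_poly 1 (sd zone2) (- tau) end)) as [gap [Hgap Gap]].
  { intros k Hk. assert (Y := HN zone2). simpl in Y. destruct k; lra. }
  assert (Gap0 := Gap 0%nat ltac:(lia)). assert (Gap1 := Gap 1%nat ltac:(lia)). simpl in Gap0, Gap1.
  assert (Hrho : 0 < Rmin m gap) by now apply Rmin_glb_lt.
  destruct (isolated_solutions sd z x s lo b tau (Rmin m gap) Gz Hz Ht0 Ht6 Hx ltac:(lra)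
     ltac:(lra) Hlt Hlb Htau Hs Hrho) as [f [Hf Sol]].
  assert (r1 := Rmin_l m gap). assert (r2 := Rmin_r m gap).
  assert (N1 : near_base (m + m) (set_f sd f)) by (apply near_base_set_f; [exact N0|lra]).
  assert (Bx : box (set_f sd f)) by (apply (near_base_box (m + m)); [lra|exact N1]).
  assert (HN' : forall i, fold_poly (zsign i) (set_f sd f i) tau < 0 < fold_poly (zsign i) (set_f sd f i) (- tau)).
  { intros [|]; [apply (HN zone1)|].
    assert (E : forall t, fold_poly (zsign zone2) (set_f sd f zone2) t
      = fold_poly 1 (sd zone2) t + (f - sf (sd zone2))) by (intros t; unfold fold_poly; simpl; ring).
    rewrite !E. apply Rabs_def2 in Hf. assert (Y := HN zone2). simpl in Y. lra. }
  destruct (folded_of_box (set_f sd f) tau Bx ltac:(lra) HN') as [z' [Gz' Hz']].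
  exists (pwsys (set_f sd f)). split; [left; simpl; lra|].
  split; [apply (near_base_close (m + m)); [lra|lra|exact N1]|].
  assert (Cyc : forall j, exists g, (j < 6)%nat -> exists r s', x (S j) < r < x j /\ lo < s' < r /\
    (forall i, Hline (zsign i) (set_f sd f i) s' = Hline (zsign i) (set_f sd f i) r) /\
    crossing_limit_cycle (pwsys (set_f sd f)) g /\
    forall q, orbit g q <-> exists i, half_cycle (set_f sd f) s' r i q).
  { intros j. destruct (Classical_Prop.classic (j < 6)%nat) as [Hj|N]; [|exists (fun _ => (0, 0)); tauto].
    destruct (Sol j Hj) as [r [s' [et [Hr [Hs' [He [Ev Iso]]]]]]].
    assert (Y1 := x0 (S j) ltac:(lia)). assert (Y2 := Mon 0%nat j ltac:(lia) ltac:(lia)).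
    destruct (limit_cycle (set_f sd f) z' s' r et Gz') as [g [Lc Orb]].
    - lra.
    - lra.
    - intros i. apply (level_sides (set_f sd f) z' i); auto; lra.
    - exact Ev.
    - intros i t Ht.
      assert (W := inv_y_close (set_f sd f) i s' t (2 * d) Bx ltac:(lra) ltac:(lra) ltac:(lra)).
      apply Rabs_le_inv in W. lra.
    - exact He.
    - exact Iso.
    - exists g. intros _. exists r, s'. split; [exact Hr|]. split; [exact Hs'|].
      split; [exact Ev|]. split; [exact Lc|exact Orb]. }
  destruct (ClassicalChoice.choice _ Cyc) as [gam Hgam].
  exists gam. split.
  - intros j Hj. destruct (Hgam j Hj) as [r [s' [Hr [Hs' [Ev [Lc Orb]]]]]]. split; [exact Lc|].
    assert (Y2 := Mon 0%nat j ltac:(lia) ltac:(lia)).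
    intros t. destruct (proj1 (Orb (gam j t))) as [i Hi]; [now exists t|].
    destruct (half_cycle_near (set_f sd f) s' r i (gam j t) (2 * d) Bx) as [Q1 Q2]; try lra; [exact Hi|].
    apply HU. split.
    + change (Rabs (fst (gam j t) - 2) < th). nra.
    + change (Rabs (snd (gam j t) - 1) < th). lra.
  - intros j k Hjk Hk Same.
    destruct (Hgam j ltac:(lia)) as [r [s' [Hr [Hs' [Ev [Lc Orb]]]]]].
    destruct (Hgam k Hk) as [r' [s'' [Hr' [Hs'' [Ev' [Lc' Orb']]]]]].
    assert (Y1 := x0 (S j) ltac:(lia)). assert (Y2 := Mon 0%nat j ltac:(lia) ltac:(lia)).
    assert (Y3 := Mon (S j) k ltac:(lia) ltac:(lia)).
    assert (Br : - (1/4) < r < 1/4) by lra.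
    destruct (line_pt_on (set_f sd f) r Br) as [Dr Lr].
    assert (Pt : orbit (gam j) (xcoord r, / (1 + r))).
    { apply Orb. exists zone1. split; [exact Dr|]. simpl fst. rewrite tcoord_xcoord by lra.
      split; [lra|]. split; [rewrite Lr; lra|].
      rewrite on_line_first_int by assumption. simpl fst. rewrite tcoord_xcoord by lra. symmetry. apply Ev. }
    apply Same, Orb' in Pt. destruct Pt as [i [_ [Hi _]]]. simpl fst in Hi.
    rewrite tcoord_xcoord in Hi by lra. lra.
Qed.
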